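(* Let $\mathcal{M}$ be a smooth, closed, bounded and connected orientable Riemannian manifold of dimension $n$, immersed into $\mathbb{R}^D$ for some $D>n$, with $\partial\mathcal{M}=\emptyset$. Let $\hat r>n/2$ and let $\mathcal{A}\in OPS^{\hat r}_{1,0}(\mathcal{M})$ be self-adjoint and positive in the sense that there is $a_->0$ with $\langle \mathcal{A}w,w\rangle\ge a_-\|w\|^2_{H^{\hat r/2}(\mathcal{M})}$ for all $w\in H^{\hat r/2}(\mathcal{M})$. Let $\mathcal{C}=\mathcal{A}^{-2}$ be the covariance operator of the Gaussian random field $\mathcal{Z}$ solving $\mathcal{A}\mathcal{Z}=\mathcal{W}$ on $\mathcal{M}$ ($\mathcal{W}$ white noise on $L^2(\mathcal{M})$). Let $\boldsymbol{\Psi},\widetilde{\boldsymbol{\Psi}}$ be biorthogonal MRAs with the properties listed in the context, with $\widetilde\gamma>\hat r$, $\gamma>0$, and let $\widetilde{\mathbf{z}}=\langle\mathcal{Z},\boldsymbol{\Psi}\rangle=(\langle\mathcal{Z},\psi_\lambda\rangle)_{\lambda\in\mathcal{J}}$ be the coordinates of $\mathcal{Z}$ when cast in the dual MRA $\widetilde{\boldsymbol{\Psi}}$. For $p=p(J)=\#(\Lambda_J)$ let $\mathbf{C}^\varepsilon_p$ be the tapered covariance matrix obtained by scheme (T) of the context with $\mathcal{B}=\mathcal{C}$, $r=-2\hat r$, where $\varepsilon\in(0,\varepsilon_0)$ is sufficiently small such that the compression properties (P) of the context hold. (i) Let $\mathbf{R}^\varepsilon_p=\mathbf{D}^{\hat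 r}_p\mathbf{C}^\varepsilon_p\mathbf{D}^{\hat r}_p\in\mathbb{R}^{p\times p}$ and let $\widetilde c_-,\widetilde c_+>0$ be constants such that $\sigma(\mathbf{R}^\varepsilon_p)\subset[\widetilde c_-,\widetilde c_+]$ for all $J\ge j_0$. Then the family of matrices $\{\mathbf{S}_K\}_{K\in\mathbb{N}}$ defined in the context satisfies: there exist $c,C>0$ such that for all $K\in\mathbb{N}$ $$\bigl\|\sqrt{\mathbf{R}^\varepsilon_p}-\mathbf{S}_K\bigr\|_2\le Ce^{-cK},$$ where the constants $c,C>0$ depend on $\varkappa_{\mathrm R}=\widetilde c_+/\widetilde c_-$, but not on $p$ and $K$. (ii) Let the $\mathbb{R}^p$-valued random vectors $\widetilde{\mathbf{z}}_p,\widetilde{\mathbf{z}}^\varepsilon_p,\widetilde{\mathbf{z}}^\varepsilon_{p,K}$ be defined as in the context. Then there exist constants $C,c>0$ such that for every $p,K\in\mathbb{N}$, $\varepsilon\in(0,\varepsilon_0)$ and $0\le s<\hat r-n/2$, $$\bigl(\mathbb{E}\bigl[\|\widetilde{\mathbf{z}}-\widetilde{\mathbf{z}}^\varepsilon_{p,K}\|_2^2\bigr]\bigr)^{1/2}\le C\bigl(2^{-sJ}+\varepsilon+e^{-cK}\bigr),$$ where the integers $J$ and $p$ are related by $p=p(J)=\#(\Lambda_J)$.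
   Context: Spaces and operators. For $s>0$, $H^s(\mathcal{M}) := (1-\Delta_{\mathcal{M}})^{-s/2}(L^2(\mathcal{M}))$ with norm $\|(1-\Delta_{\mathcal{M}})^{s/2}v\|_{L^2(\mathcal{M})}$, where $\Delta_{\mathcal{M}}$ is the Laplace–Beltrami operator; $H^{-s}(\mathcal{M})$ is its dual; $H^0=L^2$; $\langle\cdot,\cdot\rangle$ is the duality pairing. $OPS^r_{1,0}(\mathcal{M})$ is the H\''ormander class of pseudodifferential operators of order $r$ on $\mathcal{M}$. White noise $\mathcal{W}$ on $L^2(\mathcal{M})$ is the $L^2(\mathcal{M})$-valued weak random variable with characteristic function $\phi\mapsto\exp(-\tfrac12\|\phi\|^2_{L^2(\mathcal{M})})$. The symbol $\lesssim$ hides a constant independent of the level indices and of the functions involved. MRAs. $j_0$ is a fixed coarsest level. $\{V_j\}_{j>j_0}$ is a nested sequence of subspaces of $L^2(\mathcal{M})$, $\dim V_j=\mathcal{O}(2^{nj})$, $V_j=\operatorname{span}\{\phi_{j,k}:k\in\Delta_j\}$; the dual single-scale bases $\{\widetilde\phi_{j,k}:k\in\Delta_j\}$ satisfy $\langle\phi_{j,k},\widetilde\phi_{j,k'}\rangle=\delta_{k,k'}$ and span nested spaces $\widetilde V_j$. The regularity $\gamma$ and approximation order $d\in\mathbb{N}$ of $\{V_j\}$ are $\gamma=\sup\{s:V_j\subset H^s(\mathcal{M})\ \forall j>j_0\}$ and $d=\sup\{s:\inf_{v_j\in V_j}\|v-v_j\|_{L^2}\lesssim2^{-js}\|v\|_{H^s}\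 \forall v\in H^s(\mathcal{M}),\forall j>j_0\}$; $\widetilde\gamma,\widetilde d$ are the corresponding quantities for $\{\widetilde V_j\}$. $Q_jv:=\sum_{k\in\Delta_j}\langle v,\widetilde\phi_{j,k}\rangle\phi_{j,k}$, with convention $Q_{j_0}=0$. Put $\nabla_j=\Delta_{j+1}\setminus\Delta_j$ for $j>j_0$, $\nabla_{j_0}=\Delta_{j_0+1}$, $\mathcal{J}=\{(j,k):j\ge j_0,k\in\nabla_j\}$, $|(j,k)|=j$. The wavelets $\psi_{j,k},\widetilde\psi_{j,k}$ ($k\in\nabla_j$, $j>j_0$) span complements $W_j,\widetilde W_j$ with $V_{j+1}=W_j\oplus V_j$, $\widetilde V_{j+1}=\widetilde W_j\oplus\widetilde V_j$; on level $j_0$, $\psi_{j_0,k}=\phi_{j_0+1,k}$, $\widetilde\psi_{j_0,k}=\widetilde\phi_{j_0+1,k}$. $\boldsymbol{\Psi}=\{\psi_\lambda\}_{\lambda\in\mathcal{J}}$, $\widetilde{\boldsymbol{\Psi}}=\{\widetilde\psi_\lambda\}_{\lambda\in\mathcal{J}}$ satisfy $\langle\psi_\lambda,\widetilde\psi_{\lambda'}\rangle=\delta_{\lambda,\lambda'}$, $\operatorname{diam}(\operatorname{supp}\psi_{j,k})\simeq2^{-j}$, are normalized in $L^2(\mathcal{M})$, and have the vanishing moment property: $|\langle v,\psi_{j,k}\rangle|\lesssim2^{-j(\widetilde d+n/2)}\sup_{|\alpha|=\widetilde d,\,x\in\operatorname{supp}\psi_{j,k}}|\partial^\alpha v(x)|$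 for all $(j,k)\in\mathcal{J}$, and a corresponding property for the duals. The norm equivalences $\|v\|^2_{H^t}\simeq\sum_{j,k}2^{2jt}|\langle v,\widetilde\psi_{j,k}\rangle|^2$ for $t\in(-\widetilde\gamma,\gamma)$ and $\|v\|^2_{H^t}\simeq\sum_{j,k}2^{2jt}|\langle v,\psi_{j,k}\rangle|^2$ for $t\in(-\gamma,\widetilde\gamma)$ hold for all $v\in H^t(\mathcal{M})$. Sections. $\Lambda_J=\{(j,k):j_0\le j\le J,k\in\nabla_j\}$, $p=p(J)=\#(\Lambda_J)$, $\mathbf{D}^s_p=\operatorname{diag}(2^{s|\lambda|}:\lambda\in\Lambda_J)$, $\mathbf{C}_p=(\langle\mathcal{C}\psi_{\lambda'},\psi_\lambda\rangle)_{\lambda,\lambda'\in\Lambda_J}$, $\mathbf{R}_p=\mathbf{D}^{\hat r}_p\mathbf{C}_p\mathbf{D}^{\hat r}_p$. (T) Tapering. For $\mathcal{B}\in OPS^r_{1,0}(\mathcal{M})$, let $S_\lambda$ be the convex hull of $\operatorname{supp}\psi_\lambda$ and $S'_\lambda$ the singular support of $\psi_\lambda$ (the set of points where it is not smooth). With $\lambda=(j,k),\lambda'=(j',k')\in\Lambda_J$: $[\mathbf{B}^\varepsilon_p]_{\lambda,\lambda'}=0$ if $\operatorname{dist}(S_\lambda,S_{\lambda'})>\tau_{jj'}$ and $j,j'>j_0$; $[\mathbf{B}^\varepsilon_p]_{\lambda,\lambda'}=0$ if $\operatorname{dist}(S_\lambda,S_{\lambda'})\le2^{-\min\{j,j'\}}$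 and, moreover, $\operatorname{dist}(S'_\lambda,S_{\lambda'})>\tau'_{jj'}$ in the case $j'>j\ge j_0$, respectively $\operatorname{dist}(S_\lambda,S'_{\lambda'})>\tau'_{jj'}$ in the case $j>j'\ge j_0$; and $[\mathbf{B}^\varepsilon_p]_{\lambda,\lambda'}=\langle\mathcal{B}\psi_{\lambda'},\psi_\lambda\rangle$ otherwise. Here, with fixed $a,a'>1$ sufficiently large (chosen depending on $\varepsilon$, independently of $J$) and $d<d'<\widetilde d+r$, $$\tau_{jj'}=a\max\bigl\{2^{-\min\{j,j'\}},2^{[2J(d'-r/2)-(j+j')(d'+\widetilde d)]/(2\widetilde d+r)}\bigr\},$$ $$\tau'_{jj'}=a'\max\bigl\{2^{-\max\{j,j'\}},2^{[2J(d'-r/2)-(j+j')d'-\max\{j,j'\}\widetilde d]/(\widetilde d+r)}\bigr\}.$$ The operator corresponding to the tapered matrix $\mathbf{B}^\varepsilon_p$ is denoted by $\mathcal{B}^\varepsilon_p$. (P) Compression properties. For every $J\ge j_0$, $\mathbf{C}^\varepsilon_p$ is symmetric positive definite; there are constants $0<\widetilde c_-\le\widetilde c_+<\infty$ such that $\sigma(\mathbf{D}^{\hat r}_p\mathbf{C}^\varepsilon_p\mathbf{D}^{\hat r}_p)\subset[\widetilde c_-,\widetilde c_+]$ for all $J\ge j_0$ ($\sigma(\cdot)$ is the spectrum); as $J\to\infty$, the number of non-zero entries of $\mathbf{C}^\varepsilon_p$ is $\mathcal{O}(p(J))$; and, for $-\hat r\le t,t'\le d<\widetilde d-2\hat r$,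 every $J\ge j_0$ and all $v\in H^{t'}(\mathcal{M})$, $w\in H^t(\mathcal{M})$, $|\langle(\mathcal{C}-\mathcal{C}^\varepsilon_p)Q_Jw,Q_Jv\rangle|\lesssim\varepsilon2^{J(-2\hat r-t-t')}\|w\|_{H^t}\|v\|_{H^{t'}}$. Square root approximation. Let $\mathbf{I}_p$ be the identity matrix and $\widehat\varkappa_{\mathrm R}=\widetilde c_+/\widetilde c_-$. Let $\operatorname{sn},\operatorname{cn},\operatorname{dn}$ be the Jacobian elliptic functions and let $E$ be the complete elliptic integral of the second kind associated with the parameter $\widehat\varkappa_{\mathrm R}^{-1}$. For $K\in\mathbb{N}$ and $k=1,\dots,K$ put $t_k=(k-\tfrac12)E/K$, $w_k=\sqrt{\widetilde c_-}\,\operatorname{sn}(t_k|1-\widehat\varkappa_{\mathrm R}^{-1})/\operatorname{cn}(t_k|1-\widehat\varkappa_{\mathrm R}^{-1})$, and $$\mathbf{S}_K=\frac{2E\sqrt{\widetilde c_-}}{\pi K}\,\mathbf{R}^\varepsilon_p\sum_{k=1}^K\frac{\operatorname{dn}(t_k|1-\widehat\varkappa_{\mathrm R}^{-1})}{\operatorname{cn}^2(t_k|1-\widehat\varkappa_{\mathrm R}^{-1})}\bigl(\mathbf{R}^\varepsilon_p+w_k^2\mathbf{I}_p\bigr)^{-1}.$$ Random vectors. $\boldsymbol{\xi}_p\sim\mathsf{N}(\mathbf{0},\mathbf{I}_p)$ is a standard normal random vector in $\mathbb{R}^p$. $\widetilde{\mathbf{z}}_p\sim\mathsf{N}(\mathbf{0},\mathbf{C}_p)$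 is the part of $\widetilde{\mathbf{z}}$ with indices in $\Lambda_J$, and $\widetilde{\mathbf{z}}_p\overset{d}{=}\mathbf{D}^{-\hat r}_p\sqrt{\mathbf{D}^{\hat r}_p\mathbf{C}_p\mathbf{D}^{\hat r}_p}\,\boldsymbol{\xi}_p$ (equality in distribution). Further, $\widetilde{\mathbf{z}}^\varepsilon_p:=\mathbf{D}^{-\hat r}_p\sqrt{\mathbf{R}^\varepsilon_p}\,\boldsymbol{\xi}_p\sim\mathsf{N}(\mathbf{0},\mathbf{C}^\varepsilon_p)$ and $\widetilde{\mathbf{z}}^\varepsilon_{p,K}:=\mathbf{D}^{-\hat r}_p\mathbf{S}_K\boldsymbol{\xi}_p\sim\mathsf{N}(\mathbf{0},\mathbf{D}^{-\hat r}_p\mathbf{S}_K^2\mathbf{D}^{-\hat r}_p)$. In $\|\widetilde{\mathbf{z}}-\widetilde{\mathbf{z}}^\varepsilon_{p,K}\|_2$ (the $\ell^2(\mathcal{J})$ norm) vectors in $\mathbb{R}^p$ are regarded as sequences supported in $\Lambda_J$. For a matrix, $\|\cdot\|_2$ is the operator norm induced by the Euclidean norm.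
   Formalization: E is the complete first-kind integral K(1-1/κ), since (i) fails for the second-kind one; z̃_p = D^{-r̂}√R_p ξ_p holds a.s., not only in law; Q_J in (P) projects onto the span of Λ_J; vanishing moments are asked only for j>j0; L² norms are only bounded above and below. *)

(* Defs.v *)
From HB Require Import structures.
From mathcomp Require Import all_boot all_order all_algebra.
From mathcomp Require Import finmap.
From mathcomp Require Import all_classical all_reals all_analysis.

Set Implicit Arguments.
Unset Strict Implicit.
Unset Printing Implicit Defensive.

Import Order.TTheory GRing.Theory Num.Theory.
Import numFieldNormedType.Exports.

Local Open Scope classical_set_scope.
Local Open Scope ring_scope.

Section Euclid.
Context {R : realType}.

(* Euclidean norm; the library's norm on matrices is the maximum norm. *)
Definition enorm {m n} (A : 'M[R]_(m, n)) : R :=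
  Num.sqrt (\sum_i \sum_j A i j ^+ 2).

Definition dotv {n} (x y : 'rV[R]_n) : R := \sum_i x 0 i * y 0 i.

Definition pderiv {n} (i : 'I_n) (f : 'rV[R]_n -> R) : 'rV[R]_n -> R :=
  fun x => 'D_(delta_mx 0 i) f x.

(* The multi-index derivative of order [size s], one index per derivative. *)
Definition pderivs {n} (s : seq 'I_n) (f : 'rV[R]_n -> R) : 'rV[R]_n -> R :=
  foldr pderiv f s.

Definition smooth_on {n} (U : set 'rV[R]_n) (f : 'rV[R]_n -> R) : Prop :=
  forall (s : seq 'I_n) x, U x ->
    {for x, continuous (pderivs s f)} /\
    forall i, derivable (pderivs s f) x (delta_mx 0 i).

Definition smooth_map_on {n m} (U : set 'rV[R]_n)
    (f : 'rV[R]_n -> 'rV[R]_m) : Prop :=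
  forall b, smooth_on U (fun x => f x 0 b).

(* Lebesgue integral over R^n, as an iterated integral.  It is only applied to
   integrands of compact support that are continuous, and to products of
   symbols with rapidly decreasing functions. *)
Fixpoint integral_rV n : ('rV[R]_n -> R) -> R :=
  match n return ('rV[R]_n -> R) -> R with
  | 0%N => fun f => f 0
  | n'.+1 => fun f =>
      \int[@lebesgue_measure R]_t
        @integral_rV n' (fun y => f (row_mx (t%:M : 'M[R]_1) y : 'rV_(1 + n')))
  end.

Definition conv_hull {n} (A : set 'rV[R]_n) : set 'rV[R]_n :=
  [set y | exists (m : nat) (w : 'I_m -> R) (x : 'I_m -> 'rV[R]_n),
     [/\ forall i, 0 <= w i, \sum_i w i = 1, forall i, A (x i)
       & y = \sum_i w i *: x i]].

(* Extended real valued, so that the distance to the empty set is +oo. *)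
Definition set_dist {n} (A B : set 'rV[R]_n) : \bar R :=
  ereal_inf [set (enorm (x - y))%:E | x in A & y in B].

Definition set_diam {n} (A : set 'rV[R]_n) : \bar R :=
  ereal_sup [set (enorm (x - y))%:E | x in A & y in A].

(* Real functions in the class S^m_{1,0}(R^n x R^n); the variable of [p] is
   the concatenation of x and xi, so that the derivatives in xi are those with
   index at least n. *)
Definition symbol_class {n} (m : R) (p : 'rV[R]_(n + n) -> R) : Prop :=
  smooth_on setT p /\
  forall s : seq 'I_(n + n), exists C : R, forall z,
    `|pderivs s p z| <=
      C * (1 + enorm (rsubmx z))
            `^ (m - (count (fun i : 'I_(n + n) => (n <= i)%N) s)%:R).

Definition cosFT {n} (u : 'rV[R]_n -> R) (xi : 'rV[R]_n) : R :=
  integral_rV (fun y => cos (dotv y xi) * u y).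
Definition sinFT {n} (u : 'rV[R]_n -> R) (xi : 'rV[R]_n) : R :=
  integral_rV (fun y => sin (dotv y xi) * u y).

(* Real and imaginary parts of
     Op(a)u(x) = (2 pi)^{-n} \int e^{i x.xi} a(x, xi) u^(xi) dxi,
   where a = p + i q, u is real and u^ = cosFT u - i sinFT u. *)
Definition op_re {n} (p q : 'rV[R]_(n + n) -> R) (u : 'rV[R]_n -> R)
    (x : 'rV[R]_n) : R :=
  (2 * pi) ^- n * integral_rV (fun xi =>
    let z := row_mx x xi in let t := dotv x xi in
    (p z * cos t - q z * sin t) * cosFT u xi
    + (p z * sin t + q z * cos t) * sinFT u xi).
Definition op_im {n} (p q : 'rV[R]_(n + n) -> R) (u : 'rV[R]_n -> R)
    (x : 'rV[R]_n) : R :=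
  (2 * pi) ^- n * integral_rV (fun xi =>
    let z := row_mx x xi in let t := dotv x xi in
    (p z * sin t + q z * cos t) * cosFT u xi
    - (p z * cos t - q z * sin t) * sinFT u xi).

End Euclid.

(* The smooth structure is given by a finite atlas, which is no restriction as
   the manifold is compact.  Charts are total functions, meaningful on [dom];
   the field [mfd_metric c y] is the Gram matrix, at the point with coordinates
   y, of the metric in the chart c.  The immersion is not assumed isometric. *)
Record closed_manifold (R : realType) (n D : nat) := ClosedManifold {
  mfd_carrier :> ptopologicalType;
  mfd_hausdorff : hausdorff_space mfd_carrier;
  mfd_compact : compact [set: mfd_carrier];
  mfd_connected : connected [set: mfd_carrier];
  mfd_idx : finType;
  dom : mfd_idx -> set mfd_carrier;
  chart : mfd_idx -> mfd_carrier -> 'rV[R]_n;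
  chart_inv : mfd_idx -> 'rV[R]_n -> mfd_carrier;
  mfd_cover : forall x, exists c, dom c x;
  dom_open : forall c, open (dom c);
  chart_open : forall c, open (chart c @` dom c);
  chart_continuous : forall c, {within dom c, continuous (chart c)};
  chart_inv_continuous :
    forall c, {within chart c @` dom c, continuous (chart_inv c)};
  chart_invK : forall c x, dom c x -> chart_inv c (chart c x) = x;
  transition_smooth : forall c c',
    smooth_map_on (chart c @` (dom c `&` dom c')) (chart c' \o chart_inv c);
  (* a nowhere vanishing differential form of degree n *)
  mfd_orientable : exists omega : mfd_idx -> 'rV[R]_n -> R,
    (forall c, smooth_on (chart c @` dom c) (omega c)) /\
    (forall c y, (chart c @` dom c) y -> omega c y != 0) /\
    forall c c' y, (chart c @` (dom c `&` dom c')) y ->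
      omega c y = omega c' (chart c' (chart_inv c y)) *
                  \det ('J (chart c' \o chart_inv c) y);
  mfd_metric : mfd_idx -> 'rV[R]_n -> 'M[R]_n;
  metric_smooth : forall c a b,
    smooth_on (chart c @` dom c) (fun y => mfd_metric c y a b);
  metric_sym : forall c y, (chart c @` dom c) y ->
    (mfd_metric c y)^T = mfd_metric c y;
  metric_pos : forall c y (v : 'rV[R]_n), (chart c @` dom c) y -> v != 0 ->
    0 < (v *m mfd_metric c y *m v^T) 0 0;
  metric_transition : forall c c' y, (chart c @` (dom c `&` dom c')) y ->
    let Jy := 'J (chart c' \o chart_inv c) y in
    mfd_metric c y =
      Jy *m mfd_metric c' (chart c' (chart_inv c y)) *m Jy^T;
  imm : mfd_carrier -> 'rV[R]_D;
  imm_smooth : forall c, smooth_map_on (chart c @` dom c) (imm \o chart_inv c);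
  imm_rank : forall c y, (chart c @` dom c) y ->
    \rank ('J (imm \o chart_inv c) y) = n
}.

Arguments dom {R n D} _ _ _.
Arguments imm {R n D} _ _.

Section Manifold.
Context {R : realType} {n D : nat} (M : closed_manifold R n D).

Definition borel : Type := g_sigma_algebraType (@open M).
HB.instance Definition _ := Measurable.on borel.

Definition coord_img (c : mfd_idx M) : set 'rV[R]_n := chart c @` dom M c.

Definition smoothM (f : M -> R) : Prop :=
  forall c, smooth_on (coord_img c) (f \o chart_inv c).

Definition test : Type := {f : M -> R | smoothM f}.
Definition testval (u : test) : M -> R := proj1_sig u.
Coercion testval : test >-> Funclass.

Definition tsupp (f : M -> R) : set M := closure [set x | f x != 0].

(* f in the coordinates of the chart c, extended by zero *)
Definition in_chart (c : mfd_idx M) (f : M -> R) (y : 'rV[R]_n) : R :=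
  if y \in coord_img c then f (chart_inv c y) else 0.

Definition sqrt_det (c : mfd_idx M) (y : 'rV[R]_n) : R :=
  Num.sqrt (\det (mfd_metric c y)).

Definition laplace_beltrami (c : mfd_idx M) (f : 'rV[R]_n -> R)
    (y : 'rV[R]_n) : R :=
  (sqrt_det c y)^-1 * \sum_a pderiv a (fun z =>
    sqrt_det c z * \sum_b invmx (mfd_metric c z) a b * pderiv b f z) y.

(* By the Riesz representation theorem, this determines the measure. *)
Definition riemannian_volume (vol : {measure set borel -> \bar R}) : Prop :=
  forall (c : mfd_idx M) (f : M -> R), continuous f -> tsupp f `<=` dom M c ->
    (\int[vol]_x (f x)%:E)%E =
    (integral_rV (fun y => in_chart c f y * sqrt_det c y))%:E.

End Manifold.

Section Matrices.
Context {R : realType}.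

Definition opnorm {p} (A : 'M[R]_p) : R :=
  sup [set enorm (A *m x) | x in [set x : 'cV[R]_p | enorm x <= 1]].

Definition sym_posdef {p} (A : 'M[R]_p) : Prop :=
  A^T = A /\ forall x : 'cV[R]_p, x != 0 -> 0 < (x^T *m A *m x) 0 0.

Definition spectrum_in {p} (A : 'M[R]_p) (a b : R) : Prop :=
  forall x, eigenvalue A x -> a <= x <= b.

Definition sqrtmx {p} (A : 'M[R]_p) : 'M[R]_p :=
  xget 0 [set B | [/\ B^T = B, forall x : 'cV[R]_p, 0 <= (x^T *m B *m x) 0 0
                     & B *m B = A]].

Definition ellF (x m : R) : R :=
  let f t := (Num.sqrt (1 - m * sin t ^+ 2))^-1 in
  if 0 <= x then \int[lebesgue_measure]_(t in `[0, x]) f t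
  else - \int[lebesgue_measure]_(t in `[x, 0]) f t.

Definition am (t m : R) : R := xget 0 [set x | ellF x m = t].
Definition sn (t m : R) : R := sin (am t m).
Definition cn (t m : R) : R := cos (am t m).
Definition dn (t m : R) : R := Num.sqrt (1 - m * sn t m ^+ 2).

Definition ellK (m : R) : R := ellF (pi / 2) m.

(* With kappa = cp/cm, E is the complementary complete elliptic integral
   K'(1/kappa) = K(1 - 1/kappa), the first positive zero of cn(.|1 - 1/kappa).
   It is for this E, and not for the Legendre integral of the second kind, that
   the sum is the midpoint rule for
     sqrt A = (2 sqrt cm / pi) A \int_0^E dn/cn^2 (A + cm sn^2/cn^2)^{-1} dt. *)
Definition S_mx {p} (A : 'M[R]_p) (cm cp : R) (K : nat) : 'M[R]_p :=
  let m := 1 - (cp / cm)^-1 in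
  let E := ellK m in
  let t (k : 'I_K) := ((k.+1)%:R - 1 / 2) * E / K%:R in
  let w k := Num.sqrt cm * (sn (t k) m / cn (t k) m) in
  (2 * E * Num.sqrt cm / (pi * K%:R)) *:
    (A *m \sum_k (dn (t k) m / cn (t k) m ^+ 2) *:
            invmx (A + (w k ^+ 2)%:M)).

End Matrices.

Section FunctionSpaces.
Context {R : realType} {n D : nat} (M : closed_manifold R n D).
Variable vol : {measure set (borel M) -> \bar R}.

Definition ip (f g : M -> R) : R := \int[vol]_x (f x * g x).

Definition L2 : set (M -> R) := [set f | (f : borel M -> R) \in Lfun vol 2%:E].

Definition L2norm (f : M -> R) : R := Num.sqrt (ip f f).

Definition ae_eq_fun (f g : M -> R) : Prop :=
  {ae vol, forall x : borel M, f x = g x}.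

(* Functionals on the smooth functions; functions act through the L^2 inner
   product. *)
Definition dist : Type := test M -> R.
Definition dist_of (f : M -> R) : dist := fun u => ip f u.

(* An orthonormal basis of L^2(M) made of eigenfunctions of minus the
   Laplace-Beltrami operator. *)
Record laplace_basis := LaplaceBasis {
  eigf : nat -> test M;
  eigv : nat -> R;
  eigv_ge0 : forall k, 0 <= eigv k;
  eigf_laplace : forall k c y, coord_img c y ->
    - laplace_beltrami c (eigf k \o chart_inv c) y =
    eigv k * eigf k (chart_inv c y);
  eigf_orthonormal : forall k l, ip (eigf k) (eigf l) = (k == l)%:R;
  eigf_complete : forall f, L2 f ->
    (fun N => L2norm (fun x => f x - \sum_(k < N) ip f (eigf k) * eigf k x))
      @ \oo --> (0 : R)
}.

Variable B : laplace_basis.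

Definition hnorm2 (s : R) (u : dist) : \bar R :=
  (\sum_(0 <= k <oo) ((1 + eigv B k) `^ s * u (eigf B k) ^+ 2)%:E)%E.

(* The norm of (1 - Delta)^{s/2} u, the powers of 1 - Delta being defined by the
   functional calculus. *)
Definition hnorm (s : R) (u : dist) : R := Num.sqrt (fine (hnorm2 s u)).

(* H^s: for s >= 0 these are the u = dist_of f, with f = (1 - Delta)^{-s/2} g
   and g in L^2; for s < 0 they are the restrictions to the smooth functions of
   the continuous linear forms on H^{-s}. *)
Definition in_H (s : R) (u : dist) : Prop :=
  (hnorm2 s u < +oo)%E /\
  forall v : test M,
    (fun N => \sum_(k < N) u (eigf B k) * ip (eigf B k) v) @ \oo --> u v.

(* The duality pairing of H^s and H^{-s}, which extends [ip]. *)
Definition pairing (u v : dist) : R :=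
  limn (fun N => \sum_(k < N) u (eigf B k) * v (eigf B k)).

Definition operator : Type := test M -> test M.

Definition linear_op (A : operator) : Prop :=
  forall (a : R) (u v w : test M), (forall x, w x = a * u x + v x) ->
    forall x, A w x = a * A u x + A v x.

Definition smooth_kernel (K : M -> M -> R) : Prop :=
  forall c c' : mfd_idx M,
    smooth_on [set z : 'rV[R]_(n + n) |
                 coord_img c (lsubmx z) /\ coord_img c' (rsubmx z)]
      (fun z => K (chart_inv c (lsubmx z)) (chart_inv c' (rsubmx z))).

(* OPS^m_{1,0}(M): localized to any chart the operator is the quantization of a
   symbol of S^m_{1,0}, and off the diagonal its kernel is smooth.  Operators
   act on real functions; their local symbols are complex, p + i q. *)
Definition OPS (m : R) (A : operator) : Prop :=
  [/\ linear_op A,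
      forall (c : mfd_idx M) (eta chi : test M),
        tsupp eta `<=` dom M c -> tsupp chi `<=` dom M c ->
        exists p q : 'rV[R]_(n + n) -> R,
          [/\ symbol_class m p, symbol_class m q &
              forall w u : test M, (forall x, u x = chi x * w x) ->
              forall y,
                op_re p q (in_chart c u) y =
                  in_chart c (fun x => eta x * A u x) y /\
                op_im p q (in_chart c u) y = 0]
    & forall eta chi : test M, tsupp eta `&` tsupp chi = set0 ->
        exists2 K, smooth_kernel K &
          forall w u : test M, (forall x, u x = chi x * w x) ->
          forall x, eta x * A u x = ip (K x) w].

Definition self_adjoint (A : operator) : Prop :=
  forall u v : test M, ip (A u) v = ip u (A v).

(* The extension of a self-adjoint operator to distributions. *)
Definition op_dist (A : operator) (u : dist) : dist := fun v => u (A v).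

Definition coercive (A : operator) (r : R) : Prop :=
  exists2 a : R, 0 < a & forall w : dist, in_H (r / 2) w ->
    a * hnorm (r / 2) w ^+ 2 <= pairing (op_dist A w) w.

(* C = A^{-2}, the inverse of A^2 : H^{s+2r} -> H^s, for A of order r. *)
Definition inverse_square (A : operator) (r : R) (C : dist -> dist) : Prop :=
  forall (s : R) (u : dist), in_H s u ->
    [/\ in_H (s + 2 * r) (C u),
        op_dist A (op_dist A (C u)) = u
      & C (op_dist A (op_dist A u)) = u].

Section Random.
Context {d : measure_display} {Omega : measurableType d}.
Variable P : probability Omega R.

(* X ~ N(0, v), by the characteristic function; v = 0 is allowed. *)
Definition centered_normal (X : Omega -> R) (v : R) : Prop :=
  measurable_fun setT X /\
  forall t : R,
    \int[P]_w cos (t * X w) = expR (- (t ^+ 2 * v / 2)) /\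
    \int[P]_w sin (t * X w) = 0.

Definition std_normal p (xi : Omega -> 'cV[R]_p) : Prop :=
  forall a : 'cV[R]_p,
    centered_normal (fun w => \sum_i a i 0 * xi w i 0) (\sum_i a i 0 ^+ 2).

Definition white_noise (W : (M -> R) -> Omega -> R) : Prop :=
  (forall f, L2 f -> centered_normal (W f) (ip f f)) /\
  forall (a : R) f g, L2 f -> L2 g ->
    {ae P, forall w, W (fun x => a * f x + g x) w = a * W f w + W g w}.

(* Z is an L^2(M)-valued random variable and AZ = W. *)
Definition solves (A : operator) (Z : Omega -> M -> R)
    (W : (M -> R) -> Omega -> R) : Prop :=
  [/\ forall w, L2 (Z w),
      forall f, L2 f -> measurable_fun setT (fun w => ip (Z w) f)
    & forall u : test M, {ae P, forall w, ip (Z w) (A u) = W u w}].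

Definition covariance_operator (Z : Omega -> M -> R) (C : dist -> dist) : Prop :=
  forall f g, L2 f -> L2 g ->
    (\int[P]_w (ip (Z w) f * ip (Z w) g)%:E)%E =
    (pairing (C (dist_of f)) (dist_of g))%:E.

End Random.

(* The support of an equivalence class of functions. *)
Definition esupp (f : M -> R) : set M :=
  [set x | forall U : set M, open U -> U x ->
     ~ {ae vol, forall y : borel M, U y -> f y = 0}].

Definition sing_supp (f : M -> R) : set M :=
  [set x | ~ exists2 U : set M, open U /\ U x &
     exists h : test M, {ae vol, forall y : borel M, U y -> f y = h y}].

Section MRA.
Context {I : choiceType}.
Variable j0 : nat.

(* [phit] and [psit] are the dual single-scale functions and wavelets. *)
Record mra_data := MraData {
  Delta : nat -> {fset I};
  phi : nat -> I -> M -> R;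
  phit : nat -> I -> M -> R;
  psi : nat -> I -> M -> R;
  psit : nat -> I -> M -> R
}.

Variable S : mra_data.

Definition nabla (j : nat) : {fset I} :=
  if j == j0 then Delta S j0.+1 else (Delta S j.+1 `\` Delta S j)%fset.

Definition calJ : set (nat * I) :=
  [set l | (j0 <= l.1)%N /\ l.2 \in nabla l.1].

Definition span_of (K : {fset I}) (F : I -> M -> R) : set (M -> R) :=
  [set f | L2 f /\ exists a : I -> R,
     ae_eq_fun f (fun x => \sum_(k <- K) a k * F k x)].

Definition V j := span_of (Delta S j) (phi S j).
Definition Vt j := span_of (Delta S j) (phit S j).
Definition W j := span_of (nabla j) (psi S j).
Definition Wt j := span_of (nabla j) (psit S j).

Definition direct_sum (X Y Z : set (M -> R)) : Prop :=
  [/\ Y `<=` X, Z `<=` X,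
      forall f, X f -> exists g h,
        [/\ Y g, Z h & ae_eq_fun f (fun x => g x + h x)]
    & forall f, Y f -> Z f -> ae_eq_fun f (fun=> 0)].

Definition regularity (X : nat -> set (M -> R)) : \bar R :=
  ereal_sup [set s%:E | s in
    [set s | forall j f, (j0 < j)%N -> X j f -> in_H s (dist_of f)]].

Definition approx_order (X : nat -> set (M -> R)) : \bar R :=
  ereal_sup [set s%:E | s in
    [set s | 0 <= s /\ exists c : R, forall u j, in_H s u -> (j0 < j)%N ->
       (ereal_inf [set (hnorm 0 (fun v => u v - dist_of f v))%:E | f in X j]
        <= (c * 2 `^ (- (j%:R * s)) * hnorm s u)%:E)%E]].

(* Derivatives are taken in all the charts of the atlas around each point. *)
Definition sup_deriv (k : nat) (U : set M) (v : test M) : \bar R :=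
  ereal_sup [set r | exists (c : mfd_idx M) (s : seq 'I_n) (x : M),
    [/\ size s = k, U x, dom M c x
      & r = `|pderivs s (v \o chart_inv c) (chart c x)|%:E]].

(* Vanishing moments of order k.  They are required of the wavelets proper,
   j > j0: on the coarsest level these are scaling functions, which do not
   annihilate constants (by the norm equivalence for t = 0, no system of which
   all elements annihilate constants exists). *)
Definition vanishing_moments (k : nat) (F : nat -> I -> M -> R) : Prop :=
  exists c : R, forall j i (v : test M), (j0 < j)%N -> i \in nabla j ->
    (`|ip v (F j i)|%:E <=
     (c * 2 `^ (- (j%:R * (k%:R + n%:R / 2))))%:E
     * sup_deriv k (esupp (F j i)) v)%E.

Definition norm_equivalence (t : R) (F : nat -> I -> M -> R) : Prop :=
  exists c C : R, [/\ 0 < c, 0 < C & forall u : dist, in_H t u ->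
    let Sg := (\esum_(l in calJ)
      (2 `^ (2 * l.1%:R * t) * pairing u (dist_of (F l.1 l.2)) ^+ 2)%:E)%E in
    (c%:E * hnorm2 t u <= Sg /\ Sg <= C%:E * hnorm2 t u)%E].

(* Of a biorthogonal system only uniform boundedness from above and below of the
   L^2 norms is required, as L^2 norms equal to one for both the wavelets and
   their duals would force the two to coincide.  Since [phi] and [phit] are
   biorthogonal, the dimension of V_j is the cardinality of Delta_j. *)
Record biorthogonal_mra (d dt : nat) : Prop := BiorthogonalMRA {
  phi_L2 : forall j k, (j0 < j)%N -> k \in Delta S j ->
    L2 (phi S j k) /\ L2 (phit S j k);
  phi_biorthogonal : forall j k k', (j0 < j)%N ->
    k \in Delta S j -> k' \in Delta S j ->
    ip (phi S j k) (phit S j k') = (k == k')%:R;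
  V_nested : forall j, (j0 < j)%N -> V j `<=` V j.+1 /\ Vt j `<=` Vt j.+1;
  V_dim : exists c : R, forall j, (j0 < j)%N ->
    #|` Delta S j|%:R <= c * 2 `^ (n%:R * j%:R);
  V_order : approx_order V = (d%:R)%:E;
  Vt_order : approx_order Vt = (dt%:R)%:E;
  W_complement : forall j, (j0 < j)%N ->
    direct_sum (V j.+1) (W j) (V j) /\ direct_sum (Vt j.+1) (Wt j) (Vt j);
  psi_coarse : forall k, k \in nabla j0 ->
    psi S j0 k = phi S j0.+1 k /\ psit S j0 k = phit S j0.+1 k;
  psi_L2 : forall l, calJ l -> L2 (psi S l.1 l.2) /\ L2 (psit S l.1 l.2);
  psi_biorthogonal : forall l l', calJ l -> calJ l' ->
    ip (psi S l.1 l.2) (psit S l'.1 l'.2) = (l == l')%:R;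
  psi_diam : exists c C : R, [/\ 0 < c, 0 < C & forall l, calJ l ->
    ((c * 2 `^ (- l.1%:R))%:E <= set_diam (imm M @` esupp (psi S l.1 l.2)) /\
     set_diam (imm M @` esupp (psi S l.1 l.2)) <= (C * 2 `^ (- l.1%:R))%:E)%E];
  psi_normalized : exists c C : R, [/\ 0 < c, 0 < C & forall l, calJ l ->
    c <= L2norm (psi S l.1 l.2) <= C /\ c <= L2norm (psit S l.1 l.2) <= C];
  psi_moments : vanishing_moments dt (psi S);
  psit_moments : vanishing_moments d (psit S);
  psit_norm_equivalence : forall t : R,
    (- regularity Vt < t%:E < regularity V)%E -> norm_equivalence t (psit S);
  psi_norm_equivalence : forall t : R,
    (- regularity V < t%:E < regularity Vt)%E -> norm_equivalence t (psi S)
}.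

Definition Lambda (J : nat) : {fset nat * I} :=
  (\bigcup_(j <- index_iota j0 J.+1) [fset (j, k) | k in nabla j])%fset.

Definition psec (J : nat) : nat := #|{: Lambda J}|.

Definition lam (J : nat) (i : 'I_(psec J)) : nat * I := val (enum_val i).
Arguments lam : clear implicits.

Definition Dmx (J : nat) (s : R) : 'M[R]_(psec J) :=
  diag_mx (\row_i 2 `^ (s * (lam J i).1%:R)).

Definition extend (J : nat) (v : 'cV[R]_(psec J)) (l : nat * I) : R :=
  \sum_(i | lam J i == l) v i 0.

Definition cov_entry (C : dist -> dist) (l l' : nat * I) : R :=
  pairing (C (dist_of (psi S l'.1 l'.2))) (dist_of (psi S l.1 l.2)).

Definition cov_mx (C : dist -> dist) (J : nat) : 'M[R]_(psec J) :=
  \matrix_(i, i') cov_entry C (lam J i) (lam J i').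

Definition Q (j : nat) (u : dist) : dist := fun v =>
  if j == j0 then 0
  else \sum_(k <- Delta S j)
         pairing u (dist_of (phit S j k)) * dist_of (phi S j k) v.

(* S_lambda and the image of S'_lambda.  Distances and convex hulls are those of
   the ambient space R^D. *)
Definition hull_supp (l : nat * I) : set 'rV[R]_D :=
  conv_hull (imm M @` esupp (psi S l.1 l.2)).
Definition sing_img (l : nat * I) : set 'rV[R]_D :=
  imm M @` sing_supp (psi S l.1 l.2).

Definition tau (r d' dt a : R) (J j j' : nat) : R :=
  a * Num.max (2 `^ (- (minn j j')%:R))
    (2 `^ ((2 * J%:R * (d' - r / 2) - (j + j')%:R * (d' + dt))
           / (2 * dt + r))).

Definition tau' (r d' dt a' : R) (J j j' : nat) : R :=
  a' * Num.max (2 `^ (- (maxn j j')%:R))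
    (2 `^ ((2 * J%:R * (d' - r / 2) - (j + j')%:R * d' - (maxn j j')%:R * dt)
           / (dt + r))).

Definition taper_far (r d' dt a : R) (J : nat) (l l' : nat * I) : Prop :=
  [/\ ((tau r d' dt a J l.1 l'.1)%:E < set_dist (hull_supp l) (hull_supp l'))%E,
      (j0 < l.1)%N & (j0 < l'.1)%N].

Definition taper_near (r d' dt a' : R) (J : nat) (l l' : nat * I) : Prop :=
  (set_dist (hull_supp l) (hull_supp l')
     <= (2 `^ (- (minn l.1 l'.1)%:R))%:E)%E /\
  (((l.1 < l'.1)%N /\
    ((tau' r d' dt a' J l.1 l'.1)%:E < set_dist (sing_img l) (hull_supp l'))%E)
   \/
   ((l'.1 < l.1)%N /\
    ((tau' r d' dt a' J l.1 l'.1)%:E < set_dist (hull_supp l) (sing_img l'))%E)).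

(* The tapered matrix of an operator of order r. *)
Definition tapered_mx (C : dist -> dist) (r d' dt a a' : R) (J : nat) :
    'M[R]_(psec J) :=
  \matrix_(i, i')
    let l := lam J i in let l' := lam J i' in
    if `[< taper_far r d' dt a J l l' \/ taper_near r d' dt a' J l l' >] then 0
    else cov_entry C l l'.

Definition mx_form (J : nat) (A : 'M[R]_(psec J)) (w v : dist) : R :=
  \sum_i \sum_i' A i i'
    * pairing w (dist_of (psit S (lam J i').1 (lam J i').2))
    * pairing v (dist_of (psit S (lam J i).1 (lam J i).2)).

Section Compression.
(* [a] and [a'] are the tapering parameters chosen for a given epsilon. *)
Variables (C : dist -> dist) (rhat d' : R) (dt : nat) (a a' : R -> R).

Definition cov_eps (eps : R) (J : nat) : 'M[R]_(psec J) :=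
  tapered_mx C (- 2 * rhat) d' dt%:R (a eps) (a' eps) J.

Definition R_eps (eps : R) (J : nat) : 'M[R]_(psec J) :=
  Dmx J rhat *m cov_eps eps J *m Dmx J rhat.

Definition R_mx (J : nat) : 'M[R]_(psec J) :=
  Dmx J rhat *m cov_mx C J *m Dmx J rhat.

(* The bounds are uniform in eps.  In the consistency estimate the projector is
   the one onto the span of the wavelets indexed by Lambda_J.  These span
   V_{J+1}, so in the indexing of [Q] it is Q_{J+1}. *)
Record compression_properties (d : nat) (eps0 cm cp : R) : Prop :=
    CompressionProperties {
  taper_gt1 : forall eps, 0 < eps < eps0 -> 1 < a eps /\ 1 < a' eps;
  taper_order : d%:R < d' < dt%:R - 2 * rhat;
  cov_eps_posdef : forall eps J, 0 < eps < eps0 -> (j0 <= J)%N ->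
    sym_posdef (cov_eps eps J);
  R_eps_bounds : 0 < cm <= cp;
  R_eps_spectrum : forall eps J, 0 < eps < eps0 -> (j0 <= J)%N ->
    spectrum_in (R_eps eps J) cm cp;
  cov_eps_sparse : forall eps, 0 < eps < eps0 ->
    exists (c : R) (J1 : nat), forall J, (j0 <= J)%N -> (J1 <= J)%N ->
      #|[pred i : 'I_(psec J) * 'I_(psec J) | cov_eps eps J i.1 i.2 != 0]|%:R
        <= c * (psec J)%:R;
  cov_eps_consistent : forall t t' : R,
    - rhat <= t <= d%:R -> - rhat <= t' <= d%:R ->
    exists c : R, forall eps J (v w : dist), 0 < eps < eps0 -> (j0 <= J)%N ->
      in_H t' v -> in_H t w ->
      let Qw := Q J.+1 w in let Qv := Q J.+1 v in
      `|pairing (C Qw) Qv - mx_form (cov_eps eps J) Qw Qv| <=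
        c * eps * 2 `^ (J%:R * (- 2 * rhat - t - t')) * hnorm t w * hnorm t' v
}.

End Compression.

End MRA.
End FunctionSpaces.

Arguments lam {R n D M I} j0 S J i.
Arguments Dmx {R n D M I} j0 S J s.

(* Main.v *)
(* Midpoint rule.  For A with spectrum in [cm, cp], S_K is the midpoint rule with
   K nodes, in the variable t of the elliptic functions, for an integral equal to
   sqrt A; on the spectrum, after division by cm, the integrand is
   dn / (lam cn^2 + sn^2) with 1 <= lam <= cp / cm.  It is periodic, and sn, cn,
   dn and 1 / (lam cn^2 + sn^2) generate an algebra stable under d/dt, so that
   the derivative of order j is bounded by (q (4 j + 2))^j with q = 2 cp / cm.
   The average of a periodic function over the translates by h = E / K has all
   its derivatives vanishing somewhere, hence differs from the mean by at most
   h^j times the derivative of order j, and j of the order of K gives exp (- c K).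

   Mean square error.
   The consistency estimate for t = t' = - rhat, combined with the norm
   equivalence in H^{- rhat}, says that the scaled matrices R_p and R_p^eps
   differ by O(eps) in operator norm; hence so do their square roots, as R_p^eps
   is bounded below.  For one fixed eps it also yields
   E |<Z, psi_l>|^2 <= C 2^(- 2 rhat |l|), and there are O(2^(n j)) wavelets on
   the level j, so that the tail is O(2^(- 2 (rhat - n / 2) J)) and the squared
   Frobenius norm of D^(- rhat) is bounded.  *)
Require Import Defs.
From HB Require Import structures.
From mathcomp Require Import all_boot all_order all_algebra.
From mathcomp Require Import ring lra.
From mathcomp Require complex.
From mathcomp Require Import finmap.
From mathcomp Require Import all_classical all_reals all_analysis.
From mathcomp Require Import measurable_realfun.

Import Order.TTheory GRing.Theory Num.Theory.
Import numFieldNormedType.Exports.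

Local Open Scope classical_set_scope.
Local Open Scope ring_scope.

Set Implicit Arguments.
Unset Strict Implicit.
Unset Printing Implicit Defensive.

(** * Derivatives and the Jacobi amplitude *)

(** Exponential convergence of such midpoint rules is usually proved by contour integrals of
    elliptic functions of a complex variable. Here everything stays real: growth bounds on
    derivatives of all orders stand in for analyticity in a strip, and the integral occurs only as
    the increment of an explicit antiderivative. The K nodes lie in a quarter of the period 4 E; by
    the symmetries of the integrand their sum is a quarter of the sum over a whole period, where no
    boundary terms arise. For matrices, the square root and S_K are functions of the same symmetric
    matrix, so that only the error on the spectrum counts. The real diagonalization obtained below
    is not orthogonal, whence the separate proofs that functions of A are symmetric, positive and
    bounded. The mean square error compares vectors on one probability space. The coupling expresses
    the coordinates of Z through the square root of R_p and the same normal vector that drives the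
    approximation, so that each component of the error on the section is a linear form in this
    vector, whose variance is a squared row norm. *)

Section Derivatives.
Context {R : realType}.
Implicit Types f g df : R -> R.

Lemma is_derive_const (k x : R) : is_derive x 1 (fun=> k : R) 0.
Proof. exact: is_derive_cst. Qed.

Lemma is_derive_add f g (x a b c : R) : is_derive x 1 f a -> is_derive x 1 g b ->
  a + b = c -> is_derive x 1 (fun y => f y + g y) c.
Proof. by move=> fa gb <-; exact: is_deriveD. Qed.

Lemma is_derive_mul f g (x a b c : R) : is_derive x 1 f a -> is_derive x 1 g b ->
  a * g x + f x * b = c -> is_derive x 1 (fun y => f y * g y) c.
Proof.
move=> fa gb <-; have := is_deriveM fa gb.
by rewrite [X in is_derive _ _ _ X -> _]addrC /GRing.scale /= [g x * a]mulrC.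
Qed.

Lemma is_derive_scale f (k x a c : R) : is_derive x 1 f a ->
  k * a = c -> is_derive x 1 (fun y => k * f y) c.
Proof. by move=> fa <-; exact: is_deriveZ. Qed.

Lemma is_derive_inv f (x a c : R) : f x != 0 -> is_derive x 1 f a ->
  - a / f x ^+ 2 = c -> is_derive x 1 (fun y => (f y)^-1) c.
Proof.
move=> f0 fa <-; have := is_deriveV f0 fa.
by rewrite /GRing.scale /= mulNr mulrC -mulNr.
Qed.

Lemma is_derive_compose f g (x a b c : R) : is_derive (g x) 1 f a ->
  is_derive x 1 g b -> a * b = c -> is_derive x 1 (fun y => f (g y)) c.
Proof. by move=> fa gb <-; exact: is_derive1_comp. Qed.

Lemma is_derive_translate f df (a x : R) : (forall x : R, is_derive x 1 f (df x)) ->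
  is_derive x 1 (fun y => f (y + a)) (df (x + a)).
Proof.
move=> fd; apply: is_derive_compose (fd _) _ (mulr1 _).
by apply: is_derive_add (is_derive_id _ _) (is_derive_const _ _) _; rewrite addr0.
Qed.

Lemma is_derive_continuous f df : (forall x : R, is_derive x 1 f (df x)) ->
  continuous f.
Proof.
move=> fd x; apply: differentiable_continuous; apply/derivable1_diffP.
by have [] := fd x.
Qed.

Lemma mvt f df a b : (forall x : R, is_derive x 1 f (df x)) -> a <= b ->
  exists2 c, a <= c <= b & f b - f a = df c * (b - a).
Proof.
move=> fd ab.
have [|c cab E] := @MVT_segment R f df a b ab (fun x _ => fd x).
  exact/continuous_subspaceT/(is_derive_continuous fd).
by exists c => //; rewrite in_itv in cab.
Qed.

Lemma is_derive0_cst f (x y : R) : (forall x : R, is_derive x 1 f 0) -> f x = f y.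
Proof. exact: is_derive_0_is_cst. Qed.

End Derivatives.

Section Amplitude.
Context {R : realType} (m : R).
Hypothesis m01 : 0 <= m < 1.

Let D2 (x : R) : R := 1 - m * sin x ^+ 2.
Let D2_gt0 x : 0 < D2 x.
Proof.
have := cos2Dsin2 x; rewrite /D2; have := sqr_ge0 (cos x).
have := sqr_ge0 (sin x); move: m01 => /andP[]; nra.
Qed.
Let D2_le1 x : D2 x <= 1.
Proof. by rewrite /D2; have := sqr_ge0 (sin x); move: m01 => /andP[]; nra. Qed.

Let D2_derive (x : R) : is_derive x 1 D2 (- (2 * m * sin x * cos x)).
Proof.
have sd := is_derive_sin x.
have -> : D2 = fun y => 1 + (- m) * (sin y * sin y).
  by apply/funext => y; rewrite /D2 mulNr expr2.
refine (is_derive_add (is_derive_const _ _) (is_derive_scale (is_derive_mul sd sd erefl) erefl) _).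
ring.
Qed.

Let f (t : R) := (Num.sqrt (D2 t))^-1.

Let sD_gt0 x : 0 < Num.sqrt (D2 x). Proof. by rewrite sqrtr_gt0. Qed.
Let f_ge1 x : 1 <= f x.
Proof. by rewrite invf_ge1// -[leRHS]sqrtr1 ler_wsqrtr. Qed.

Let f_cont : continuous f.
Proof.
move=> x; apply: cvgV; first exact: lt0r_neq0.
apply: continuous_comp; first exact: is_derive_continuous D2_derive _.
exact: sqrt_continuous.
Qed.

Let f_int (a b : R) : (@lebesgue_measure R).-integrable `[a, b] (EFin \o f).
Proof.
apply: continuous_compact_integrable; first exact: segment_compact.
exact: continuous_subspaceT.
Qed.

(** Starting the integral at a point to the left of both 0 and x removes the case distinction on the
    sign of x, so that the fundamental theorem of calculus applies at every x, including 0. *)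
Let ellFE (M x : R) : 0 < M -> - M < x ->
  ellF x m = (\int[lebesgue_measure]_(t in `[- M, x]) f t) -
             (\int[lebesgue_measure]_(t in `[- M, 0]) f t).
Proof.
move=> M0 Mx; rewrite /ellF -/f; case: ifPn => [x0|].
  rewrite (Rintegral_itvB (f_int _ _)) ?bnd_simp ?oppr_le0 ?(ltW M0)//.
  rewrite Rintegral_itv_obnd_cbnd//.
  by apply: (integrableS _ _ _ (f_int 0 x)) => //; exact: subset_itv_oc_cc.
rewrite -ltNge => x0.
rewrite -[RHS]opprB (Rintegral_itvB (f_int _ _)) ?bnd_simp ?(ltW x0) ?(ltW Mx)//.
rewrite Rintegral_itv_obnd_cbnd//.
by apply: (integrableS _ _ _ (f_int x 0)) => //; exact: subset_itv_oc_cc.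
Qed.

Let ellF_derive (x : R) : is_derive x 1 (ellF^~ m) (f x).
Proof.
pose M := `|x| + 1.
have M0 : 0 < M by rewrite ltr_wpDl.
have Mx : - M < x.
  by rewrite ltrNl (le_lt_trans (ler_norm _))// normrN ltrDl.
have xx1 : x < x + 1 by rewrite ltrDl.
have [dF Fx] := continuous_FTC1_closed xx1 (f_int (- M) (x + 1)) Mx (@f_cont x).
pose G (y : R) := (\int[lebesgue_measure]_(t in `[- M, y]) f t) +
             - (\int[lebesgue_measure]_(t in `[- M, 0]) f t).
have dG : is_derive x 1 G (f x).
  apply: is_derive_add (is_derive_const _ _) (addr0 _).
  by split; [exact: dF|rewrite -derive1E].
apply: near_eq_is_derive dG.
near=> y; rewrite (@ellFE M)//.
by near: y; exact: lt_nbhsr.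
Unshelve. all: by end_near. Qed.

Let ellF_shift (x c : R) : is_derive x 1 (fun y => ellF (y + c) m) (f (x + c)).
Proof. by apply: (@is_derive_translate _ (ellF^~ m)). Qed.

Lemma ellF0 : ellF 0 m = 0.
Proof. by rewrite /ellF lexx set_itv1 Rintegral_set1. Qed.

Lemma ellFN x : ellF (- x) m = - ellF x m.
Proof.
apply/eqP; rewrite -addr_eq0 addrC; apply/eqP.
have -> : 0 = ellF 0 m + ellF (- 0) m by rewrite oppr0 ellF0 addr0.
apply: (@is_derive0_cst _ (fun y => ellF y m + ellF (- y) m)) => {}x.
refine (is_derive_add (ellF_derive x) (is_derive_compose (ellF_derive _) (is_deriveNid _ _) erefl) _).
by rewrite /f /D2 sinN sqrrN mulrN mulr1 subrr.
Qed.

(** The integrand is at least 1. This expansion yields both strict monotonicity and surjectivity of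
    [ellF], hence that [am] is a genuine inverse. *)
Lemma ellF_expand (x y : R) : x <= y -> y - x <= ellF y m - ellF x m.
Proof.
move=> xy; have [c _ ->] := mvt ellF_derive xy.
by rewrite ler_peMl ?subr_ge0.
Qed.

Lemma ellF_mono : {mono ellF^~ m : x y / x < y}.
Proof.
apply: leW_mono; apply: le_mono => x y xy.
by rewrite -subr_gt0; apply: lt_le_trans (ellF_expand (ltW xy)); rewrite subr_gt0.
Qed.

Lemma ellF_surj t : exists x, ellF x m = t.
Proof.
have le_tt : - `|t| <= `|t| by have := normr_ge0 t; lra.
have tF : t <= ellF `|t| m.
  have := ellF_expand (normr_ge0 t); rewrite ellF0 !subr0.
  exact: le_trans (ler_norm _).
have Ft : ellF (- `|t|) m <= t.
  have := ellF_expand (normr_ge0 t); rewrite ellF0 !subr0 ellFN lerNl.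
  by apply: le_trans; rewrite -normrN ler_norm.
have [||c _ <-] := @IVT R (ellF^~ m) (- `|t|) `|t| t le_tt.
- exact/continuous_subspaceT/(is_derive_continuous ellF_derive).
- by rewrite ge_min Ft le_max tF orbT.
- by exists c.
Qed.

Lemma amK t : ellF (am t m) m = t.
Proof. by rewrite /am; have [x xt] := ellF_surj t; case: xgetP => // /(_ x). Qed.

Lemma ellFK x : am (ellF x m) m = x.
Proof.
have E := amK (ellF x m); apply/eqP; rewrite eq_le !leNgt.
by rewrite -[_ < am _ _]ellF_mono -[am _ _ < _]ellF_mono E ltxx.
Qed.

Lemma am_derive (t : R) : is_derive t 1 (am^~ m) (dn t m).
Proof.
have := @is_derive_inverse R (ellF^~ m) (am^~ m) (f (am t m)) (am t m).
rewrite amK /f invrK; apply.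
- by near=> x; exact: ellFK.
- by near=> x; exact: (is_derive_continuous ellF_derive).
- exact: ellF_derive.
- by rewrite invr_eq0 lt0r_neq0 ?sD_gt0.
Unshelve. all: by end_near. Qed.

Lemma am0 : am 0 m = 0.
Proof. by rewrite -[X in am X]ellF0 ellFK. Qed.

Lemma am_ellK : am (ellK m) m = pi / 2.
Proof. exact: ellFK. Qed.

Lemma amN t : am (- t) m = - am t m.
Proof. by rewrite -[in LHS](amK t) -ellFN ellFK. Qed.

Lemma ellFDpi x : ellF (x + pi) m = ellF x m + ellK m *+ 2.
Proof.
apply/eqP; rewrite [eqbRHS]addrC -subr_eq addrC; apply/eqP.
(* The difference of the two sides is constant; at - pi / 2 it is known, since the translate by pi
   is pi / 2 and [ellF] is odd. *)
have -> : ellK m *+ 2 = - ellF (- (pi / 2)) m + ellF (- (pi / 2) + pi) m.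
  rewrite [in X in _ + X](_ : - (pi / 2) + pi = pi / 2 :> R); last by field.
  by rewrite ellFN opprK mulr2n.
apply: (@is_derive0_cst _ (fun y => - ellF y m + ellF (y + pi) m)) => {}x.
have dN := is_derive_scale (ellF_derive x) (erefl (- 1 * f x)).
have -> : (fun y => - ellF y m + ellF (y + pi) m) =
          (fun y => -1 * ellF y m + ellF (y + pi) m).
  by apply/funext => y; rewrite mulN1r.
apply: is_derive_add dN (ellF_shift _ _) _.
by rewrite /f /D2 sinDpi sqrrN mulN1r addNr.
Qed.

(** Two quarter periods turn the angle by pi: [sn] and [cn] change sign there, while [dn] and the
    squares are unchanged. *)
Lemma amD t : am (t + ellK m *+ 2) m = am t m + pi.
Proof. by rewrite -[in LHS](amK t) -ellFDpi ellFK. Qed.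

Lemma am_mono : {mono am^~ m : x y / x < y}.
Proof. by move=> x y /=; rewrite -[in RHS](amK x) -[in RHS](amK y) [RHS]ellF_mono. Qed.

Lemma ellK_gt0 : 0 < ellK m.
Proof. by rewrite -am_mono am0 am_ellK divr_gt0 ?pi_gt0. Qed.

Lemma dn_gt0 t : 0 < dn t m. Proof. exact: sD_gt0. Qed.

Lemma dn_le1 t : dn t m <= 1.
Proof. by rewrite /dn -[leRHS]sqrtr1 ler_wsqrtr// D2_le1. Qed.

Lemma cn_gt0 t : 0 < t < ellK m -> 0 < cn t m.
Proof.
rewrite -[0 < t]am_mono -[t < _]am_mono am0 am_ellK => /andP[t0 t1].
by rewrite cos_gt0_pihalf// t1 andbT (lt_trans _ t0)// oppr_lt0 divr_gt0 ?pi_gt0.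
Qed.

Lemma sn_derive (t : R) : is_derive t 1 (sn^~ m) (cn t m * dn t m).
Proof. exact: is_derive_compose (is_derive_sin _) (am_derive t) erefl. Qed.

Lemma cn_derive (t : R) : is_derive t 1 (cn^~ m) (- 1 * (sn t m * dn t m)).
Proof.
by apply: is_derive_compose (is_derive_cos _) (am_derive t) _; rewrite /sn; ring.
Qed.

Lemma dn_derive (t : R) : is_derive t 1 (dn^~ m) (- m * (sn t m * cn t m)).
Proof.
have d0 := dn_gt0 t; rewrite /dn.
have sd := is_derive1_sqrt (D2_gt0 (am t m)).
have Dd := is_derive_compose (D2_derive _) (am_derive t) erefl.
refine (@is_derive_compose _ Num.sqrt (fun y => D2 (am y m)) _ _ _ _ sd Dd _).
rewrite -/(dn t m) /D2 -/(sn t m) -/(cn t m) -/(dn t m); field; exact: lt0r_neq0.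
Qed.

End Amplitude.

(** * The trapezoidal rule for periodic functions *)

Section Trapezoid.
Context {R : realType}.
Implicit Types f df psi : R -> R.

Lemma is_derive_bigsum (n : nat) (F dF : nat -> R -> R) (x : R) :
  (forall k, is_derive x 1 (F k) (dF k x)) ->
  is_derive x 1 (fun y => \sum_(k < n) F k y) (\sum_(k < n) dF k x).
Proof.
move=> Fd; elim: n => [|n IH].
  have -> : (fun y => \sum_(k < 0) F k y) = fun=> 0.
    by apply/funext => y; rewrite big_ord0.
  by rewrite big_ord0; exact: is_derive_const.
have -> : (fun y => \sum_(k < n.+1) F k y) = fun y => \sum_(k < n) F k y + F n y.
  by apply/funext => y; rewrite big_ord_recr.
by rewrite big_ord_recr; exact: is_derive_add IH (Fd n) erefl.
Qed.

Lemma periodic_osc psi dpsi (h M : R) : 0 < h -> periodic psi h ->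
  (forall x : R, is_derive x 1 psi (dpsi x)) -> (forall x, `|dpsi x| <= M) ->
  forall x y, `|psi x - psi y| <= h * M.
Proof.
move=> h0 per psid bnd x y.
wlog xy : x y / y <= x => [H|].
  have [|/ltW] := leP y x; first exact: H.
  by rewrite distrC; exact: H.
(* Moving x back by n periods brings it into [y, y + h), where the mean value theorem gives the
   bound. *)
pose n := Num.truncn ((x - y) / h).
have q0 : 0 <= (x - y) / h by rewrite divr_ge0 ?subr_ge0 ?(ltW h0).
have /andP[n1 n2] := truncn_itv q0.
have E : (x - y) = ((x - y) / h) * h by rewrite divfK ?lt0r_neq0.
have -> : psi x = psi (x - h *+ n).
  by rewrite -{1}[x](subrK (h *+ n)) (periodicn per).
have yx : y <= x - h *+ n.
  rewrite -subr_ge0 addrAC E -mulr_natl -mulrBl mulr_ge0 ?(ltW h0)//.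
  by rewrite subr_ge0.
have [c _ ->] := mvt psid yx; rewrite normrM mulrC ler_pM//.
rewrite ger0_norm ?subr_ge0// addrAC E -mulr_natl -mulrBl -[leRHS]mul1r.
by rewrite ler_wpM2r ?(ltW h0)// lerBlDl natr1 ltW.
Qed.

Variables (h : R) (N : nat).
Hypothesis h_gt0 : 0 < h.
Let L := N%:R * h.

Let T f (x : R) := h * \sum_(k < N) f (x + k%:R * h).

Let T_derive f df : (forall x : R, is_derive x 1 f (df x)) ->
  forall x : R, is_derive x 1 (T f) (T df x).
Proof.
move=> fd x; have S := @is_derive_bigsum N (fun k y => f (y + k%:R * h))
  (fun k y => df (y + k%:R * h)) x (fun k => is_derive_translate _ _ fd).
exact: is_derive_scale S erefl.
Qed.

Let T_step f x : T f (x + h) = T f x + h * (f (x + L) - f x).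
Proof.
rewrite /T -mulrDr; congr (h * _); apply/eqP.
rewrite [eqbRHS]addrC -subr_eq -sumrB -(big_mkord xpredT
  (fun k => f (x + h + k%:R * h) - f (x + k%:R * h))).
rewrite (eq_bigr (fun k => f (x + k.+1%:R * h) - f (x + k%:R * h))).
  by rewrite (telescope_sumr (fun k => f (x + k%:R * h)))// mul0r addr0.
by move=> k _; rewrite -natr1 mulrDl mul1r addrAC addrA.
Qed.

(** The successive derivatives are carried as witnesses instead of being named by an operator. All
    of them are periodic, but only the one of order j is bounded by b. *)
Fixpoint periodic_bound (j : nat) (b : R) f : Prop :=
  periodic f L /\
  match j with
  | 0%N => forall x, `|f x| <= b
  | j'.+1 => exists2 df, (forall x : R, is_derive x 1 f (df x)) &
               periodic_bound j' b df
  end.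

Lemma periodic_boundW j a b f : a <= b -> periodic_bound j a f ->
  periodic_bound j b f.
Proof.
move=> ab; elim: j f => [|j IH] f [per H]; split => //.
  by move=> x; exact: le_trans ab.
by case: H => df fd H; exists df => //; exact: IH.
Qed.

Let T_periodic f : periodic f L -> periodic (T f) h.
Proof. by move=> per x; rewrite T_step per subrr mulr0 addr0. Qed.

(* Averaging over the translates by [h] turns [f] into an [h]-periodic function;
   all its derivatives vanish somewhere, so each differentiation gains [h]. *)
Let T_osc j b f c : periodic_bound j.+1 b f -> (exists z, T f z = c) ->
  forall x, `|T f x - c| <= h ^+ j.+1 * (L * b).
Proof.
elim: j f c => [|j IH] f c [per [df fd H]] [z <-] x.
  rewrite expr1; apply: (periodic_osc h_gt0 (T_periodic per) (T_derive fd)).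
  move=> {}x; rewrite /T normrM gtr0_norm// (_ : L * b = h * (N%:R * b)); last by rewrite /L; ring.
  rewrite ler_wpM2l ?(ltW h_gt0)//.
  apply: le_trans (ler_norm_sum _ _ _) _.
  rewrite -[N in leRHS]card_ord mulr_natl -sumr_const.
  by apply: ler_sum => k _; case: H.
rewrite exprS -mulrA.
apply: (periodic_osc h_gt0 (T_periodic per) (T_derive fd)) => {}x.
have [y _ ] := mvt (T_derive fd) (ltW h_gt0).
rewrite -[in T f h](add0r h) (T_periodic per) subrr => /esym/eqP.
rewrite subr0 mulf_eq0 (gt_eqF h_gt0) orbF => /eqP Ey.
by rewrite -[T df x]subr0; apply: IH => //; exists y.
Qed.

(** The integral I over a period is given as the increment of an antiderivative F. By [T_step],
    which telescopes, [T F] increases by h I from 0 to h; the mean value theorem then gives a point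
    where [T f] equals I, which is the value that [T_osc] asks for. *)
Lemma trapezoid_rule j b f F I x : periodic_bound j.+1 b f ->
  (forall x : R, is_derive x 1 F (f x)) -> (forall x, F (x + L) = F x + I) ->
  `|h * (\sum_(k < N) f (x + k%:R * h)) - I| <= h ^+ j.+1 * (L * b).
Proof.
move=> fb Fd FI; apply: (T_osc fb).
have [z _ ] := mvt (T_derive Fd) (ltW h_gt0).
rewrite -[in T F h](add0r h) T_step FI subr0.
rewrite [_ + I]addrC addrK [_ + h * I]addrC addrK mulrC.
by move/(mulIf (lt0r_neq0 h_gt0)) => ->; exists z.
Qed.

End Trapezoid.

(** * Polynomials in bounded generators and the growth of their derivatives *)

Section GeneratedAlgebra.
Context {R : realType}.
Variables (gen : (R -> R) -> Prop) (L q : R) (r : nat).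

(** [genpoly k a f] says that f can be written as a polynomial in the generators, without constant
    term, of degree at most k and with absolute values of the coefficients adding up to at most a.
    As the generators are bounded by 1, a bounds f; the degree controls the number of terms in the
    Leibniz rule. *)
Inductive genpoly : nat -> R -> (R -> R) -> Prop :=
| genpoly_gen f of gen f : genpoly 1 1 f
| genpolyM k l a b f g of genpoly k a f & genpoly l b g :
    genpoly (k + l) (a * b) (fun x => f x * g x)
| genpolyD k a b f g of genpoly k a f & genpoly k b g :
    genpoly k (a + b) (fun x => f x + g x)
| genpolyZ c k a f of genpoly k a f : genpoly k (`|c| * a) (fun x => c * f x)
| genpolyW k l a b f of (k <= l)%N & a <= b & genpoly k a f : genpoly l b f.

Hypothesis gen_periodic : forall f, gen f -> periodic f L.
Hypothesis gen_le1 : forall f x, gen f -> `|f x| <= 1.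
Hypothesis gen_derive : forall f, gen f -> exists2 df,
  (forall x : R, is_derive x 1 f (df x)) & genpoly (r.+1) q df.
Hypothesis q_ge0 : 0 <= q.

Lemma genpoly_bound k a f x : genpoly k a f -> `|f x| <= a.
Proof.
elim=> {k a f} [f /gen_le1//|k l a b f g _ fa _ gb|k a b f g _ fa _ gb
  |c k a f _ fa|k l a b f _ ab _ fa].
- by rewrite normrM ler_pM.
- by rewrite (le_trans (ler_normD _ _))// lerD.
- by rewrite normrM ler_wpM2l.
- exact: le_trans ab.
Qed.

Lemma genpoly_ge0 k a f : genpoly k a f -> 0 <= a.
Proof. by move=> /genpoly_bound-/(_ 0); exact: le_trans. Qed.

Lemma genpoly_periodic k a f : genpoly k a f -> periodic f L.
Proof.
elim=> {k a f} [f /gen_periodic//|k l a b f g _ fp _ gp|k a b f g _ fp _ gp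
  |c k a f _ fp|//] x.
- by rewrite fp gp.
- by rewrite fp gp.
- by rewrite fp.
Qed.

(** A monomial of degree k has k factors. Differentiating one of them replaces it by a polynomial of
    degree r + 1 and size q, so the degree grows by r and the size by the factor k q. *)
Lemma genpoly_derive k a f : genpoly k a f -> exists2 df,
  (forall x : R, is_derive x 1 f (df x)) & genpoly (k + r) (k%:R * q * a) df.
Proof.
elim=> {k a f} [f gf|k l a b f g fp [df fd dfp] gp [dg gd dgp]
  |k a b f g fp [df fd dfp] gp [dg gd dgp]|c k a f fp [df fd dfp]
  |k l a b f kl ab fp [df fd dfp]].
- have [df fd dfp] := gen_derive gf; exists df => //.
  by apply: genpolyW dfp; rewrite ?add1n// mul1r mulr1.
- exists (fun x => df x * g x + f x * dg x).
    by move=> x; exact: is_derive_mul (fd x) (gd x) erefl.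
  have -> : (k + l)%:R * q * (a * b) =
    (k%:R * q * a) * b + a * (l%:R * q * b) by rewrite natrD; ring.
  apply: genpolyD.
    by apply: genpolyW (genpolyM dfp gp) => //; rewrite addnAC.
  by apply: genpolyW (genpolyM fp dgp) => //; rewrite addnA.
- exists (fun x => df x + dg x).
    by move=> x; exact: is_derive_add (fd x) (gd x) erefl.
  by rewrite mulrDr; exact: genpolyD.
- exists (fun x => c * df x).
    by move=> x; exact: is_derive_scale (fd x) erefl.
  by rewrite mulrCA; exact: genpolyZ.
- exists df => //; apply: genpolyW dfp; first by rewrite leq_add2r.
  rewrite ler_pM ?mulr_ge0 ?(genpoly_ge0 fp)// ler_wpM2r// ler_nat//.
Qed.

End GeneratedAlgebra.

(** * The quadrature for a positive number *)

Section GenBound.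
Context {R : realType}.
Variables (gen : (R -> R) -> Prop) (h q : R) (N r : nat).
Hypothesis gen_periodic : forall f, gen f -> periodic f (N%:R * h).
Hypothesis gen_le1 : forall f x, gen f -> `|f x| <= 1.
Hypothesis gen_derive : forall f, gen f -> exists2 df,
  (forall x : R, is_derive x 1 f (df x)) & genpoly gen (r.+1) q df.
Hypothesis q_ge0 : 0 <= q.

(** Successive derivatives contribute the factors q (k + r i) with i < j, each of which is at most q
    (k + r j). *)
Lemma genpoly_periodic_bound j k a f : genpoly gen k a f ->
  periodic_bound h N j (a * (q * (k + r * j)%:R) ^+ j) f.
Proof.
elim: j k a f => [|j IH] k a f fp.
  split; first exact: genpoly_periodic fp.
  by move=> x; rewrite expr0 mulr1; exact: genpoly_bound fp.
split; first exact: genpoly_periodic fp.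
have [df fd dfp] := genpoly_derive gen_le1 gen_derive q_ge0 fp.
exists df => //; apply: periodic_boundW (IH _ _ _ dfp).
rewrite exprS mulnS addnA mulrA ler_wpM2r ?exprn_ge0 ?mulr_ge0//.
rewrite mulrC ler_wpM2l ?(genpoly_ge0 gen_le1 fp)// mulrC ler_wpM2l//.
by rewrite ler_nat -addnA leq_addr.
Qed.
End GenBound.

Section Decay.
Context {R : realType}.

(** The order j is free and is chosen in terms of u = K / (4 b exp 1). If u >= 2, take j + 1 to be
    the integer part of u: since 2 + 4 j <= 4 (j + 1), the base of the power is at most exp (- 1),
    and j > u - 2. If u < 2, the order 1 gives a constant, and the factor [expR 2] makes exp (2 - u)
    at least 1. *)
Lemma geometric_to_exponential (a b e : R) (K : nat) : 0 < a -> 0 < b ->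
  (0 < K)%N ->
  (forall j, (0 < j)%N -> e <= a * (b * (2 + 4 * j)%:R / K%:R) ^+ j) ->
  e <= (a + 6 * a * b) * expR 2 * expR (- (4 * b * expR 1)^-1 * K%:R).
Proof.
move=> a0 b0 K0 H; set u := (4 * b * expR 1)^-1 * K%:R.
have K0' : 0 < K%:R :> R by rewrite ltr0n.
have e0 : 0 < expR 1 :> R by exact: expR_gt0.
have c0 : 0 < 4 * b * expR 1 by rewrite !mulr_gt0.
have u0 : 0 <= u by rewrite mulr_ge0 ?ler0n ?invr_ge0 ?(ltW c0).
rewrite mulNr -/u -mulrA -expRD.
have [u2|u2] := leP 2 u; last first.
  apply: (@le_trans _ _ (a + 6 * a * b)).
    apply: (le_trans (H 1%N isT)); rewrite expr1 muln1.
    have -> : a * (b * (2 + 4)%:R / K%:R) = 6 * a * b / K%:R.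
      by field; exact: lt0r_neq0.
    rewrite ler_wpDl ?(ltW a0)// ler_pdivrMr// ler_peMr ?mulr_ge0 ?(ltW a0) ?(ltW b0)//.
    by rewrite ler1n.
  rewrite ler_peMr//; last by rewrite -[leLHS]expR0 ler_expR subr_ge0 ltW.
  by rewrite addr_ge0 ?mulr_ge0 ?(ltW a0) ?(ltW b0).
pose j := (Num.truncn u).-1.
have /andP[n1 n2] := truncn_itv u0.
have n0 : (0 < Num.truncn u)%N by rewrite -(ltr_nat R); move: n2; rewrite -natr1; lra.
have nE : (Num.truncn u)%:R = j%:R + 1 :> R by rewrite natr1 /j prednK.
rewrite -natr1 nE in n2; rewrite nE in n1.
have j0 : (0 < j)%N by rewrite -(ltr_nat R); lra.
apply: (le_trans (H _ j0)).
have step : b * (2 + 4 * j)%:R / K%:R <= expR (- 1).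
  rewrite ler_pdivrMr// natrD natrM expRN.
  have : expR 1 * 4 * b * (j%:R + 1) <= K%:R.
    have -> : K%:R = expR 1 * 4 * b * u.
      by rewrite /u; field; rewrite !lt0r_neq0.
    by rewrite ler_wpM2l ?mulr_ge0 ?(ltW b0) ?(ltW e0).
  move=> HK; rewrite [leRHS]mulrC ler_pdivlMr//; apply: le_trans HK.
  have := mulr_gt0 b0 e0; lra.
apply: (@le_trans _ _ (a * expR (- 1) ^+ j)).
  rewrite ler_wpM2l ?(ltW a0)// lerXn2r// nnegrE; last exact: expR_ge0.
  by rewrite divr_ge0 ?mulr_ge0 ?(ltW b0).
rewrite -expRM_natl mulrN mulr1.
apply: ler_pM; rewrite ?(ltW a0) ?expR_ge0//.
  by rewrite lerDl !mulr_ge0 ?(ltW a0) ?(ltW b0).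
by rewrite ler_expR; lra.
Qed.

End Decay.

(** Periodicity reduces the sum from four quarters of a period to two, and the reflection from two
    to one. *)
Lemma folded_sum (R : realType) (a : nat -> R) (K : nat) :
  (forall k, a (k + K * 2)%N = a k) ->
  (forall k, (k < K * 2)%N -> a (K * 2 - k.+1)%N = a k) ->
  \sum_(k < K * 4) a k = 4 * \sum_(k < K) a k.
Proof.
move=> aper arefl.
have fold2 : \sum_(0 <= k < K * 2) a k = 2 * \sum_(0 <= k < K) a k.
  rewrite (@big_cat_nat _ _ _ K)//=; last by rewrite muln2 -addnn leq_addr.
  rewrite -{2}[K]add0n big_addn (_ : (K * 2 - K = K)%N); last first.
    by rewrite muln2 -addnn addnK.
  rewrite [in X in _ + X]big_nat_rev/= add0n.
  rewrite [in X in _ + X](eq_big_nat _ _ (F2 := a)); first by rewrite mulr_natl mulr2n.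
  move=> k /andP[_ kK]; rewrite -[RHS]arefl; last first.
    by rewrite muln2 -addnn (leq_trans kK) ?leq_addr.
  by congr a; rewrite muln2 -addnn addnBAC.
rewrite -!(big_mkord xpredT) (@big_cat_nat _ _ _ (K * 2))//=; last first.
  by rewrite leq_mul2l orbT.
rewrite -{2}[(K * 2)%N]add0n big_addn (_ : (K * 4 - K * 2 = K * 2)%N); last first.
  by rewrite -mulnBr.
rewrite [in X in _ + X](eq_big_nat _ _ (F2 := a)) ?fold2; last by move=> k _.
ring.
Qed.

Section Quadrature.
Context {R : realType} (kap lam : R).
Hypothesis lam1 : 1 <= lam <= kap.

Let m := 1 - kap^-1.
Let kap_ge1 : 1 <= kap. Proof. by move: lam1 => /andP[]; exact: le_trans. Qed.
Let kap_gt0 : 0 < kap. Proof. exact: lt_le_trans kap_ge1. Qed.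
Let m01 : 0 <= m < 1.
Proof. by rewrite /m subr_ge0 invf_le1// kap_ge1 ltrBlDr ltrDl invr_gt0. Qed.

Let E := ellK m.
Let E_gt0 : 0 < E. Proof. exact: ellK_gt0. Qed.

Let s (t : R) := sn t m.
Let c (t : R) := cn t m.
Let d (t : R) := dn t m.
(** Multiplying numerator and denominator of the summand by cn^2 removes the apparent singularities
    at the zeros of cn. As cn^2 + sn^2 = 1 and lam >= 1, this denominator is at least 1, so that its
    inverse qualifies as a generator bounded by 1. *)
Let den (t : R) := lam * (c t * c t) + s t * s t.
Let g (t : R) := (den t)^-1.

Let cs1 t : c t * c t + s t * s t = 1.
Proof. by rewrite -!expr2 cos2Dsin2. Qed.

Let den_ge1 t : 1 <= den t.
Proof.
rewrite -(cs1 t) /den lerD2r ler_peMl ?(andP lam1).1//.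
by rewrite -expr2 sqr_ge0.
Qed.
Let den_gt0 t : 0 < den t. Proof. exact: lt_le_trans (den_ge1 t). Qed.

Let sD (t : R) : is_derive t 1 s (c t * d t). Proof. exact: sn_derive. Qed.
Let cD (t : R) : is_derive t 1 c (- 1 * (s t * d t)). Proof. exact: cn_derive. Qed.
Let dD (t : R) : is_derive t 1 d (- m * (s t * c t)). Proof. exact: dn_derive. Qed.
Let gD (t : R) :
  is_derive t 1 g (2 * (lam - 1) * (s t * (c t * (d t * (g t * g t))))).
Proof.
have dd : is_derive t 1 den (- (2 * (lam - 1) * (s t * (c t * d t)))).
  refine (is_derive_add (is_derive_scale (is_derive_mul (cD t) (cD t) erefl) erefl)
    (is_derive_mul (sD t) (sD t) erefl) _); ring.
refine (is_derive_inv (lt0r_neq0 (den_gt0 t)) dd _).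
by rewrite /g; field; exact: lt0r_neq0.
Qed.

Let s2E t : s (t + E *+ 2) = - s t. Proof. by rewrite /s /sn amD ?sinDpi. Qed.
Let c2E t : c (t + E *+ 2) = - c t. Proof. by rewrite /c /cn amD ?cosDpi. Qed.
Let d2E t : d (t + E *+ 2) = d t.
Proof. by rewrite /d /dn /= -/(s _) s2E sqrrN. Qed.
Let g2E t : g (t + E *+ 2) = g t. Proof. by rewrite /g /den s2E c2E !mulrNN. Qed.

Let gen (f : R -> R) := [\/ f = s, f = c, f = d | f = g].

Let per4 f : gen f -> periodic f (E *+ 4).
Proof.
have E4 t : t + E *+ 4 = t + E *+ 2 + E *+ 2 by rewrite -addrA -mulrnDr.
by case=> -> t; rewrite E4 ?s2E ?c2E ?d2E ?g2E ?opprK.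
Qed.

Let bnd1 f t : gen f -> `|f t| <= 1.
Proof.
case=> ->.
- by rewrite ler_norml sin_geN1 sin_le1.
- by rewrite ler_norml cos_geN1 cos_le1.
- by rewrite ger0_norm ?dn_le1// ltW// dn_gt0.
- by rewrite ger0_norm ?invr_ge0 ?(ltW (den_gt0 t))// invf_le1.
Qed.

(** The derivative of [g] is the most expensive one: its degree 5 is the reason for r = 4, and its
    coefficient 2 (lam - 1) is below 2 kap. *)
Let q := 2 * kap.

Let genD f : gen f -> exists2 df,
  (forall x : R, is_derive x 1 f (df x)) & genpoly gen 5 q df.
Proof.
have gs : genpoly gen 1 1 s by apply: genpoly_gen; exact: Or41.
have gc : genpoly gen 1 1 c by apply: genpoly_gen; exact: Or42.
have gd : genpoly gen 1 1 d by apply: genpoly_gen; exact: Or43.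
have gg : genpoly gen 1 1 g by apply: genpoly_gen; exact: Or44.
case=> ->.
- exists (fun x => c x * d x) => //.
  apply: genpolyW (genpolyM gc gd) => //; rewrite /q; move: kap_ge1; lra.
- exists (fun x => - 1 * (s x * d x)) => //.
  apply: genpolyW (genpolyZ (- 1) (genpolyM gs gd)) => //.
  by rewrite normrN normr1 /q; move: kap_ge1; lra.
- exists (fun x => - m * (s x * c x)) => //.
  apply: genpolyW (genpolyZ (- m) (genpolyM gs gc)) => //.
  move: m01 => /andP[m0 m1].
  by rewrite normrN ger0_norm // /q; move: kap_ge1; lra.
- exists (fun t => 2 * (lam - 1) * (s t * (c t * (d t * (g t * g t))))) => //.
  apply: genpolyW (genpolyZ (2 * (lam - 1))
    (genpolyM gs (genpolyM gc (genpolyM gd (genpolyM gg gg))))) => //.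
  by move: lam1 => /andP[? ?]; rewrite ger0_norm /q; lra.
Qed.

Let f t := d t * g t.

Let f_poly : genpoly gen 2 1 f.
Proof.
apply: genpolyW (genpolyM (genpoly_gen _) (genpoly_gen _)); rewrite ?mulr1//.
- exact: Or43.
- exact: Or44.
Qed.

Let r := Num.sqrt lam.
Let r_ge1 : 1 <= r.
Proof. by rewrite -[leLHS]sqrtr1 ler_wsqrtr// (andP lam1).1. Qed.
Let r_gt0 : 0 < r. Proof. exact: lt_le_trans r_ge1. Qed.
Let lamE : lam = r ^+ 2.
Proof. by rewrite sqr_sqrtr// (le_trans _ (andP lam1).1). Qed.

(* An antiderivative of [f]: on (- pi / 2, pi / 2), [Phi x] is
   [atan (tan x / r) / r], rewritten so as to be smooth on the whole line. *)
Let Phi (x : R) := r^-1 *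
  (x + atan ((1 - r) * (sin x * cos x) * (r * (cos x * cos x) + sin x * sin x)^-1)).

Let PhiD (x : R) :
  is_derive x 1 Phi (lam * (cos x * cos x) + sin x * sin x)^-1.
Proof.
have cs : cos x * cos x + sin x * sin x = 1 by rewrite -!expr2 cos2Dsin2.
have c0 : 0 <= cos x * cos x by rewrite -expr2 sqr_ge0.
have u0 : 0 < r * (cos x * cos x) + sin x * sin x.
  by rewrite -(ltr_pM2l r_gt0); move: r_ge1; nra.
have w0 : 0 < r ^+ 2 * (cos x * cos x) + sin x * sin x.
  by move: r_ge1; nra.
have sx := is_derive_sin x; have cx := is_derive_cos x.
have D1 := is_derive_scale (is_derive_mul sx cx erefl) (erefl ((1 - r) * _)).
have D2 := is_derive_add (is_derive_scale (is_derive_mul cx cx erefl) (erefl (r * _)))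
  (is_derive_mul sx sx erefl) erefl.
have D2' := @is_derive_inv _ (fun y => r * (cos y * cos y) + sin y * sin y)
  x _ _ (lt0r_neq0 u0) D2 erefl.
have D3 := is_derive_mul D1 D2' erefl.
have D4 := is_derive_compose (is_derive1_atan _) D3 erefl.
refine (is_derive_scale (is_derive_add (is_derive_id _ _) D4 erefl) _).
rewrite lamE; set C := cos x in cs c0 u0 w0 *; set S := sin x in cs u0 w0 *.
(* The numerator is the squared modulus of (r C + i S) (C - i S), which has real part r C^2 + S^2
   and imaginary part (1 - r) S C. The argument of this product is the correction inside [Phi]. *)
have E1 : 1 + ((1 - r) * (S * C) * (r * (C * C) + S * S)^-1) ^+ 2 =
    (r ^+ 2 * (C * C) + S * S) * (C * C + S * S) / (r * (C * C) + S * S) ^+ 2.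
  by field; exact: lt0r_neq0.
rewrite E1 cs mulr1.
set dn := (X in r^-1 * (1 + _ * X)).
have -> : dn = (1 - r) * (r * (C * C) - S * S) * (C * C + S * S) /
    (r * (C * C) + S * S) ^+ 2.
  by rewrite /dn; field; exact: lt0r_neq0.
rewrite cs mulr1; apply: (@mulfI _ (r * (r ^+ 2 * (C * C) + S * S))).
  by rewrite mulf_neq0 ?lt0r_neq0.
transitivity (r * (C * C + S * S)); last by rewrite cs; field; exact: lt0r_neq0.
by field; rewrite !lt0r_neq0.
Qed.

Variable K : nat.
Hypothesis K_gt0 : (0 < K)%N.

Let h := E / K%:R.
Let K_gt0' : 0 < K%:R :> R. Proof. by rewrite ltr0n. Qed.
Let h_gt0 : 0 < h. Proof. exact: divr_gt0. Qed.

Let node_sum : \sum_(k < K * 4) f (h / 2 + k%:R * h) =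
  4 * \sum_(k < K) f ((k.+1%:R - 1 / 2) * E / K%:R).
Proof.
have -> : \sum_(k < K) f ((k.+1%:R - 1 / 2) * E / K%:R) =
    \sum_(k < K) f (h / 2 + k%:R * h).
  apply: eq_bigr => k _; congr f; rewrite -natr1 /h; field; exact: lt0r_neq0.
apply: (@folded_sum _ (fun k => f (h / 2 + k%:R * h))) => k; last move=> kK; rewrite /f.
  have -> : h / 2 + (k + K * 2)%:R * h = (h / 2 + k%:R * h) + E *+ 2.
    by rewrite natrD natrM /h; field; exact: lt0r_neq0.
  by rewrite d2E g2E.
(* The reflection t -> 2 E - t exchanges the nodes k and 2 K - 1 - k, and [d] and [g] are even. *)
have -> : h / 2 + (K * 2 - k.+1)%:R * h = - (h / 2 + k%:R * h) + E *+ 2.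
  by rewrite natrB// natrM -natr1 /h; field; exact: lt0r_neq0.
rewrite d2E g2E; set t := _ + _.
have sN : s (- t) = - s t by rewrite /s /sn amN// sinN.
have cN : c (- t) = c t by rewrite /c /cn amN// cosN.
by rewrite /g /den /d /dn -!/(s _) sN cN mulrNN sqrrN.
Qed.

(** The trapezoidal rule is applied with 4 K nodes of step E / K over the period 4 E, and started at
    h / 2 to become the midpoint rule. *)
Lemma jacobi_midpoint_rule j : (0 < j)%N ->
  `|2 * h * lam / pi * (\sum_(k < K) f ((k.+1%:R - 1 / 2) * E / K%:R))
    - Num.sqrt lam| <=
  2 * kap * E * (2 * kap * E * (2 + 4 * j)%:R / K%:R) ^+ j.
Proof.
move=> j0; have q0 : 0 <= q by rewrite mulr_ge0// ltW.
have L4 : (K * 4)%:R * h = E *+ 4.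
  by rewrite /h natrM -[E *+ 4]mulr_natl; field; exact: lt0r_neq0.
have per f0 : gen f0 -> periodic f0 ((K * 4)%:R * h) by rewrite L4; exact: per4.
have fb := genpoly_periodic_bound per bnd1 genD q0 j f_poly.
have fd (x : R) : is_derive x 1 (fun y => Phi (am y m)) (f x).
  by apply: is_derive_compose (PhiD _) (am_derive _ _) _ => //; rewrite mulrC.
(* Over a whole period the amplitude gains 2 pi, and only the linear term of [Phi] is not periodic.
   The integral is therefore 2 pi / sqrt lam, which the factor lam / (2 pi) below turns into sqrt
   lam. *)
have FI x : Phi (am (x + (K * 4)%:R * h) m) = Phi (am x m) + r^-1 * (pi *+ 2).
  have -> : x + (K * 4)%:R * h = x + E *+ 2 + E *+ 2.
    by rewrite L4 -addrA -mulrnDr.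
  rewrite !amD// -addrA -mulr2n /Phi sinD2pi cosD2pi; ring.
rewrite -(prednK j0) in fb *.
have := trapezoid_rule h_gt0 (h / 2) fb fd FI.
rewrite node_sum L4; set sm := (X in 4 * X) => H.
have pi0 : 0 < pi :> R := pi_gt0 R.
have alg p : 0 < p -> 2 * h * lam / p * sm - r =
    (lam / (2 * p)) * (h * (4 * sm) - r^-1 * (p *+ 2)).
  by move=> p0; rewrite lamE; field; rewrite !lt0r_neq0.
rewrite -/r alg// normrM ger0_norm; last first.
  by rewrite divr_ge0 ?mulr_ge0 ?(ltW pi0)// (le_trans _ (andP lam1).1).
have l0 : 0 <= lam by rewrite (le_trans _ (andP lam1).1).
apply: le_trans (ler_wpM2l _ H) _; first by rewrite divr_ge0 ?mulr_ge0 ?(ltW pi0).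
set n := (2 + 4 * _)%:R.
have -> : lam / (2 * pi) * (h ^+ j.-1.+1 * (E *+ 4 * (1 * (q * n) ^+ j.-1.+1))) =
    (lam / pi) * (2 * E) * (2 * kap * E * n / K%:R) ^+ j.-1.+1.
  have -> : 2 * kap * E * n / K%:R = h * (q * n) by rewrite /h /q; ring.
  rewrite [in RHS]exprMn -mulr_natl; move: (h ^+ _) ((q * n) ^+ _) pi pi0 => u v p p0.
  by field; exact: lt0r_neq0.
rewrite ler_wpM2r ?exprn_ge0 ?divr_ge0 ?mulr_ge0 ?(ltW E_gt0) ?(ltW kap_gt0)//.
rewrite mulrCA mulrA ler_wpM2r ?(ltW E_gt0)// ler_wpM2l//.
rewrite ler_pdivrMr// (le_trans (andP lam1).2)// ler_peMr ?(ltW kap_gt0)//.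
by rewrite (le_trans _ (pi_ge2 R))// ler1n.
Qed.

End Quadrature.

(** The scalar rational function whose value at a symmetric matrix is [S_mx]. *)
Definition sqrt_quad {R : realType} (cm cp : R) (K : nat) (x : R) : R :=
  let m := 1 - (cp / cm)^-1 in
  let E := ellK m in
  let t (k : 'I_K) := ((k.+1)%:R - 1 / 2) * E / K%:R in
  let w k := Num.sqrt cm * (sn (t k) m / cn (t k) m) in
  (2 * E * Num.sqrt cm / (pi * K%:R)) *
    (x * \sum_k (dn (t k) m / cn (t k) m ^+ 2) * (x + w k ^+ 2)^-1).

(** With x = cm lam the error is sqrt cm times the error for lam in [1, kap], so the constants
    depend on the ratio only. *)
Lemma sqrt_quad_error (R : realType) (kap : R) : 1 <= kap ->
  exists c C, [/\ 0 < c, 0 < C & forall (cm cp x : R) (K : nat),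
    0 < cm -> cp / cm = kap -> cm <= x <= cp -> (0 < K)%N ->
    `|Num.sqrt x - sqrt_quad cm cp K x| <= Num.sqrt cm * (C * expR (- c * K%:R))].
Proof.
move=> kap1; set m := 1 - kap^-1; set E := ellK m.
have kap0 : 0 < kap by exact: lt_le_trans kap1.
have m01 : 0 <= m < 1.
  by rewrite /m subr_ge0 invf_le1// kap1 ltrBlDr ltrDl invr_gt0.
have E0 : 0 < E := ellK_gt0 m01.
pose a := 2 * kap * E; have a0 : 0 < a by rewrite !mulr_gt0.
exists (4 * a * expR 1)^-1, ((a + 6 * a * a) * expR 2); split.
- by rewrite invr_gt0 !mulr_gt0// expR_gt0.
- by rewrite mulr_gt0 ?expR_gt0// addr_gt0// !mulr_gt0.
move=> cm cp x K cm0 cpk /andP[cx xc] K0.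
have K0' : 0 < K%:R :> R by rewrite ltr0n.
pose lam := x / cm.
have xE : x = cm * lam by rewrite /lam mulrC divfK// lt0r_neq0.
have lam1 : 1 <= lam <= kap.
  by rewrite /lam ler_pdivlMr// mul1r cx -cpk ler_pM2r ?invr_gt0.
have s0 : 0 < Num.sqrt cm by rewrite sqrtr_gt0.
have := @geometric_to_exponential _ a a _ K a0 a0 K0 (jacobi_midpoint_rule lam1 K0).
rewrite -/m -/E -/a; set sm := \sum_(k < K) _ => H.
rewrite distrC [X in _ - Num.sqrt X]xE sqrtrM ?(ltW cm0)//.
suff -> : sqrt_quad cm cp K x = Num.sqrt cm * (2 * (E / K%:R) * lam / pi * sm).
  by rewrite -mulrBr normrM (gtr0_norm s0) ler_wpM2l ?(ltW s0).
rewrite /sqrt_quad cpk -/m -/E.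
set sm' := \sum_(k < K) _.
have -> : sm' = cm^-1 * sm.
  rewrite /sm' /sm mulr_sumr; apply: eq_bigr => k _.
  set t := (k.+1%:R - 1 / 2) * E / K%:R; rewrite exprMn sqr_sqrtr ?(ltW cm0)//.
  (* The nodes are strictly inside (0, E), so the division by cn in [sqrt_quad] is a genuine one and
     may be cleared. *)
  have c0 : 0 < cn t m.
    apply: cn_gt0 => //; rewrite -/E /t; apply/andP; split.
      by rewrite divr_gt0// mulr_gt0// -natr1; have := ler0n R k; lra.
    rewrite ltr_pdivrMr // [ltRHS]mulrC ltr_pM2r //.
    by have := ltn_ord k; rewrite -(ler_nat R); lra.
  have d0 : 0 < lam * (cn t m * cn t m) + sn t m * sn t m.
    have l0 : 0 < lam by rewrite (lt_le_trans _ (andP lam1).1).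
    have s2 := sqr_ge0 (sn t m); rewrite expr2 in s2.
    exact: ltr_wpDr s2 (mulr_gt0 l0 (mulr_gt0 c0 c0)).
  have d1 : 0 < cm * lam * cn t m ^+ 2 + cm * sn t m ^+ 2.
    by rewrite -mulrA -mulrDr !expr2 mulr_gt0.
  by rewrite xE; field; rewrite !lt0r_neq0.
move: (pi : R) (pi_gt0 R) => p p0; rewrite xE; clearbody sm.
by field; rewrite !lt0r_neq0.
Qed.

(** * Functional calculus for real symmetric matrices *)

Section Diagonalization.
Import complex.

(** The unitary diagonalization over the complex numbers has real eigenvalues, and real matrices
    that are similar over the complex numbers are similar over the reals. This descent yields an
    invertible [P], with no claim that it is orthogonal. *)
Lemma symmetric_diagonalizable (R : rcfType) n (A : 'M[R]_n) : A^T = A ->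
  exists (P : 'M[R]_n) (d : 'rV[R]_n), P \in unitmx /\ P *m A = diag_mx d *m P.
Proof.
move=> Asym; pose toC := real_complex R; pose AC := map_mx toC A.
have toC_real x : toC x \is Num.real by rewrite /toC complex_real.
have ACreal : AC \is a realmx by apply/mxOverP => i j; rewrite mxE.
have ACsym : AC \is symmetricmx.
  apply/eqP; rewrite expr0 scale1r; apply/matrixP => i j; rewrite !mxE.
  by rewrite -[in RHS]Asym mxE.
have ACherm := realsym_hermsym ACsym ACreal.
have dreal := hermitian_spectral_diag_real ACherm.
have /orthomx_spectralP ACE := hermitian_normalmx ACherm.
set U := spectralmx AC in ACE; set d := spectral_diag AC in ACE dreal.
have Uu : U \in unitmx := spectral_unit AC.
have sim : similar_in unitmx AC (diag_mx d).
  exists U => //; apply/similarP => //.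
  by rewrite {1}ACE !mulmxA mulmxV// mul1mx.
have ddreal : diag_mx d \is a realmx.
  apply/mxOverP => i j; rewrite mxE; have /mxOverP/(_ 0 i) := dreal.
  by case: eqP => // _ _; rewrite mulr0n.
have [Q /andP[Qreal Qu] /similarP - /(_ Qu) QE] := real_similar sim ACreal ddreal.
have pull k l (B : 'M[R[i]]_(k, l)) : B \is a realmx ->
    exists B0 : 'M[R]_(k, l), B = map_mx toC B0.
  move=> /mxOverP Breal; exists (map_mx (@complex.Re R) B).
  apply/matrixP => i j; rewrite !mxE.
  by have /complex_realP[x ->] := Breal i j.
have [P PE] := pull _ _ _ Qreal; have [e eE] := pull _ _ _ dreal.
exists P, e; split.
  by rewrite -(map_unitmx toC) -PE.
apply: (map_mx_inj (f := toC)).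
by rewrite !map_mxM map_diag_mx -PE -eE.
Qed.

End Diagonalization.

Section EuclideanNorm.
Context {R : realType}.

Lemma enorm_sqr m n (A : 'M[R]_(m, n)) :
  enorm A ^+ 2 = \sum_i \sum_j A i j ^+ 2.
Proof. by rewrite sqr_sqrtr// !sumr_ge0// => i _; rewrite sumr_ge0// => j _; rewrite sqr_ge0. Qed.

Lemma enorm_ge0 m n (A : 'M[R]_(m, n)) : 0 <= enorm A.
Proof. exact: sqrtr_ge0. Qed.

Lemma enorm_sqr_cV n (x : 'cV[R]_n) : enorm x ^+ 2 = (x^T *m x) 0 0.
Proof.
rewrite enorm_sqr mxE; apply: eq_bigr => i _.
by rewrite big_ord1 mxE expr2.
Qed.

Lemma enorm_le n (x y : 'cV[R]_n) (M : R) : 0 <= M ->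
  (x^T *m x) 0 0 <= M ^+ 2 * (y^T *m y) 0 0 -> enorm x <= M * enorm y.
Proof.
move=> M0; rewrite -!enorm_sqr_cV -exprMn.
by rewrite ler_pXn2r// nnegrE ?mulr_ge0 ?enorm_ge0.
Qed.

Lemma cV_sqr_gt0 n (x : 'cV[R]_n) : x != 0 -> 0 < (x^T *m x) 0 0.
Proof.
move=> x0; rewrite lt0r -enorm_sqr_cV sqr_ge0 andbT enorm_sqr.
apply: contra_neq x0 => /eqP; rewrite psumr_eq0; last first.
  by move=> i _; rewrite big_ord1 sqr_ge0.
move=> /allP x0; apply/matrixP => i j; rewrite ord1 mxE.
have := x0 i (mem_index_enum _); rewrite big_ord1 implyTb sqrf_eq0.
by move/eqP.
Qed.

Lemma opnorm_le p (A : 'M[R]_p) (M : R) : 0 <= M ->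
  (forall x : 'cV[R]_p, enorm (A *m x) <= M * enorm x) -> opnorm A <= M.
Proof.
move=> M0 AM; apply: ge_sup.
  exists (enorm (A *m (0 : 'cV[R]_p))), 0 => //=.
  by rewrite /enorm big1 ?sqrtr0// => i _; rewrite big1// => j _; rewrite mxE expr0n.
by move=> _ [x /= x1 <-]; apply: (le_trans (AM x)); rewrite ler_piMr.
Qed.

End EuclideanNorm.

Section SpectralCalculus.
Context {R : realType} {n : nat}.
Variables (A P : 'M[R]_n) (d : 'rV[R]_n).
Hypotheses (Asym : A^T = A) (Pu : P \in unitmx) (AP : P *m A = diag_mx d *m P).

Definition mxfun (f : R -> R) : 'M[R]_n :=
  invmx P *m diag_mx (map_mx f d) *m P.

Lemma eigenvalue_mxfun i : eigenvalue A (d 0 i).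
Proof.
apply/eigenvalueP; exists (row i P).
  by rewrite -row_mul AP row_mul row_diag_mx -scalemxAl -rowE.
apply: contraTneq Pu => rP0; rewrite -row_free_unit; apply/row_freePn.
exists i; rewrite rP0; exact: sub0mx.
Qed.

Lemma mxfun_id : mxfun id = A.
Proof.
have -> : mxfun id = invmx P *m (diag_mx d *m P).
  by rewrite /mxfun (_ : map_mx id d = d) ?mulmxA//; apply/matrixP => i j; rewrite mxE.
by rewrite -AP mulKmx.
Qed.

Lemma mxfunM f g : mxfun (fun x => f x * g x) = mxfun f *m mxfun g.
Proof.
rewrite /mxfun !mulmxA mulmxK// -[_ *m diag_mx _ *m diag_mx _]mulmxA.
rewrite mulmx_diag; congr (_ *m diag_mx _ *m _).
by apply/matrixP => i j; rewrite !mxE ord1.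
Qed.

Lemma mxfunD f g : mxfun (fun x => f x + g x) = mxfun f + mxfun g.
Proof.
rewrite /mxfun -mulmxDl -mulmxDr -raddfD; congr (_ *m diag_mx _ *m _).
by apply/matrixP => i j; rewrite !mxE.
Qed.

Lemma mxfunZ a f : mxfun (fun x => a * f x) = a *: mxfun f.
Proof.
rewrite /mxfun scalemxAl scalemxAr -linearZ; congr (_ *m diag_mx _ *m _).
by apply/matrixP => i j; rewrite !mxE.
Qed.

Lemma mxfun_cst a : mxfun (fun=> a) = a%:M.
Proof.
rewrite /mxfun (_ : map_mx (fun=> a) d = const_mx a); last first.
  by apply/matrixP => i j; rewrite !mxE.
by rewrite diag_const_mx mul_mx_scalar -scalemxAl mulVmx// scalemx1.
Qed.

Lemma mxfun_sum (K : nat) (F : 'I_K -> R -> R) :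
  mxfun (fun x => \sum_k F k x) = \sum_k mxfun (F k).
Proof.
elim: K F => [|K IH] F.
  have -> : (fun x => \sum_k F k x) = fun=> 0.
    by apply/funext => x; rewrite big_ord0.
  by rewrite big_ord0 mxfun_cst raddf0.
rewrite big_ord_recr /= -IH -mxfunD; congr mxfun; apply/funext => x.
by rewrite big_ord_recr.
Qed.

Lemma eq_mxfun f g : (forall i, f (d 0 i) = g (d 0 i)) -> mxfun f = mxfun g.
Proof.
move=> fg; congr (_ *m diag_mx _ *m _); apply/matrixP => i j.
by rewrite ord1 !mxE.
Qed.

Lemma mxfunV f : (forall i, f (d 0 i) != 0) ->
  invmx (mxfun f) = mxfun (fun x => (f x)^-1).
Proof.
move=> f0; have E : mxfun (fun x => (f x)^-1) *m mxfun f = 1%:M.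
  rewrite -mxfunM -(mxfun_cst 1); apply: eq_mxfun => i.
  by rewrite mulVf.
have [u _] := mulmx1_unit (mulmx1C E).
by rewrite -[RHS]mulmx1 -(mulmxV u) mulmxA E mul1mx.
Qed.

(* [A^T = A] says that [P P^T] commutes with [diag_mx d], hence with
   [diag_mx (map_mx f d)]. *)
Lemma tr_mxfun f : (mxfun f)^T = mxfun f.
Proof.
have comm (G : 'M[R]_n) e : G *m diag_mx e = diag_mx e *m G <->
    forall i j, G i j * e 0 j = e 0 i * G i j.
  rewrite mul_mx_diag mul_diag_mx; split=> [/matrixP H i j|H].
    by have := H i j; rewrite !mxE.
  by apply/matrixP => i j; rewrite !mxE.
have Pt : P^T \in unitmx by rewrite unitmx_tr.
have /comm H : (P *m P^T) *m diag_mx d = diag_mx d *m (P *m P^T).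
  have := congr1 trmx AP; rewrite !trmx_mul Asym tr_diag_mx => APt.
  by rewrite -mulmxA -APt !mulmxA AP.
have /comm G : forall i j, (P *m P^T) i j * (map_mx f d) 0 j =
    (map_mx f d) 0 i * (P *m P^T) i j.
  move=> i j; have := H i j; rewrite [LHS]mulrC => /eqP.
  rewrite -subr_eq0 -mulrBl mulf_eq0 subr_eq0 => /orP[/eqP E|/eqP ->].
    by rewrite ![map_mx f d _ _]mxE E mulrC.
  by rewrite mul0r mulr0.
rewrite /mxfun !trmx_mul trmx_inv tr_diag_mx.
apply: (can_inj (mulKmx Pu)); apply: (can_inj (mulmxK Pt)).
by rewrite !mulmxA mulmxV// mul1mx -!mulmxA mulVmx// mulmx1 mulmxA G mulmxA.
Qed.

(** With g the square root of f, the matrix is the square of the symmetric matrix [mxfun g], so the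
    form is a squared norm. No orthogonality of eigenvectors enters. *)
Lemma mxfun_ge0 f (x : 'cV[R]_n) : (forall i, 0 <= f (d 0 i)) ->
  0 <= (x^T *m mxfun f *m x) 0 0.
Proof.
move=> f0; pose g (y : R) := Num.sqrt (f y).
have -> : mxfun f = mxfun g *m mxfun g.
  by rewrite -mxfunM; apply: eq_mxfun => i; rewrite -expr2 sqr_sqrtr.
rewrite mulmxA -[X in (_ *m X *m _ *m _)]tr_mxfun -trmx_mul -mulmxA.
by rewrite -enorm_sqr_cV sqr_ge0.
Qed.

(** This is the positivity of the function M^2 - f^2 of the matrix. *)
Lemma enorm_mxfun f (M : R) (x : 'cV[R]_n) : 0 <= M ->
  (forall i, `|f (d 0 i)| <= M) -> enorm (mxfun f *m x) <= M * enorm x.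
Proof.
move=> M0 fM; apply: enorm_le => //.
rewrite trmx_mul tr_mxfun mulmxA -[x^T *m _ *m _]mulmxA -mxfunM -subr_ge0.
have := @mxfun_ge0 (fun y => M ^+ 2 + -1 * (f y * f y)) x.
rewrite mxfunD mxfun_cst mxfunZ scaleN1r mulmxBr mulmxBl mul_mx_scalar -scalemxAl.
rewrite [X in 0 <= X]mxE [X in X + _]mxE [X in _ + X]mxE; apply => i.
rewrite mulN1r subr_ge0 -expr2 -real_normK ?num_real// lerXn2r// nnegrE//.
Qed.

End SpectralCalculus.

(** * Square roots of positive semidefinite matrices: existence, perturbation, uniqueness *)

Section SquareRoot.
Context {R : realType} {n : nat}.
Implicit Types A X Y : 'M[R]_n.

Definition is_psd_sqrt A X :=
  [/\ X^T = X, forall x : 'cV[R]_n, 0 <= (x^T *m X *m x) 0 0 & X *m X = A].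

Lemma sqrtmx_of A X : is_psd_sqrt A X -> is_psd_sqrt A (sqrtmx A).
Proof. by move=> XA; rewrite /sqrtmx; case: xgetP => [_ -> //|/(_ X)]. Qed.

Lemma eigenvalue_cV A a : A^T = A -> eigenvalue A a ->
  exists2 x : 'cV[R]_n, x != 0 & A *m x = a *: x.
Proof.
move=> Asym /eigenvalueP[v vA v0]; exists v^T.
  by rewrite -(inj_eq trmx_inj) trmxK trmx0.
by rewrite -[in LHS]Asym -trmx_mul vA linearZ.
Qed.

Lemma psd_sqrt_exists A : A^T = A ->
  (forall x : 'cV[R]_n, 0 <= (x^T *m A *m x) 0 0) -> is_psd_sqrt A (sqrtmx A).
Proof.
move=> Asym Apsd; have [P [d [Pu AP]]] := symmetric_diagonalizable Asym.
apply: (@sqrtmx_of _ (mxfun P d Num.sqrt)); split.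
- exact: tr_mxfun Asym Pu AP _.
- by move=> x; apply: (mxfun_ge0 Asym Pu AP) => i; exact: sqrtr_ge0.
- rewrite -mxfunM// -[RHS](mxfun_id Pu AP); apply: eq_mxfun => i.
  rewrite -expr2 sqr_sqrtr//=.
  have [x x0 Ax] := eigenvalue_cV Asym (eigenvalue_mxfun Pu AP i).
  have := Apsd x; rewrite -mulmxA Ax -scalemxAr [X in 0 <= X]mxE.
  by rewrite pmulr_lge0 ?cV_sqr_gt0.
Qed.

(* If [v] is an eigenvector of [X - Y] for [a], then
   [v^T (X^2 - Y^2) v = a v^T (X + Y) v]. *)
Lemma sqrt_perturbation A A' X Y (q N : R) : 0 < q -> 0 <= N ->
  is_psd_sqrt A X -> is_psd_sqrt A' Y ->
  (forall x : 'cV[R]_n, q * (x^T *m x) 0 0 <= (x^T *m Y *m x) 0 0) ->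
  (forall x : 'cV[R]_n, `|(x^T *m (A - A') *m x) 0 0| <= N * (x^T *m x) 0 0) ->
  forall x : 'cV[R]_n, enorm ((X - Y) *m x) <= N / q * enorm x.
Proof.
move=> q0 N0 [Xsym Xpsd XA] [Ysym Ypsd YA] Yq AN x.
have Zsym : (X - Y)^T = X - Y by rewrite linearB /= Xsym Ysym.
have [P [d [Pu ZP]]] := symmetric_diagonalizable Zsym.
rewrite -[X - Y](mxfun_id Pu ZP).
apply: (enorm_mxfun Zsym Pu ZP); first by rewrite divr_ge0// ltW.
move=> i; set a := d 0 i.
have [v v0 Zv] := eigenvalue_cV Zsym (eigenvalue_mxfun Pu ZP i).
have vv := cV_sqr_gt0 v0.
have vZ : v^T *m (X - Y) = a *: v^T by rewrite -[in LHS]Zsym -trmx_mul Zv linearZ.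
have E : v^T *m (A - A') *m v = a *: (v^T *m X *m v + v^T *m Y *m v).
  have -> : A - A' = X *m (X - Y) + (X - Y) *m Y.
    by rewrite mulmxBr mulmxBl XA YA addrA subrK.
  rewrite mulmxDr mulmxDl !mulmxA -[v^T *m X *m (X - Y) *m v]mulmxA Zv vZ.
  by rewrite -!scalemxAl -scalemxAr scalerDr.
have := AN v; rewrite E mxE [X in a * X]mxE normrM /= => H.
have S : q * (v^T *m v) 0 0 <= (v^T *m X *m v) 0 0 + (v^T *m Y *m v) 0 0.
  by rewrite ler_wpDl.
rewrite /= ler_pdivlMr// -(ler_pM2r vv); apply: le_trans H; rewrite -mulrA.
rewrite ler_wpM2l//; apply: le_trans S (ler_norm _).
Qed.

(** [sqrtmx] selects some positive semidefinite root. The perturbation bound for A' = A, with N = 0,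
    forces that root to coincide with the spectral one. *)
Lemma sqrtmx_mxfun A P d : A^T = A -> P \in unitmx -> P *m A = diag_mx d *m P ->
  (forall i, 0 < d 0 i) -> sqrtmx A = mxfun P d Num.sqrt.
Proof.
move=> Asym Pu AP d0; set Y := mxfun P d Num.sqrt.
have YA : is_psd_sqrt A Y.
  split; first exact: tr_mxfun Asym Pu AP _.
    by move=> x; apply: (mxfun_ge0 Asym Pu AP) => i; exact: sqrtr_ge0.
  rewrite -mxfunM// -[RHS](mxfun_id Pu AP); apply: eq_mxfun => i.
  by rewrite -expr2 sqr_sqrtr//= ltW.
have XA := sqrtmx_of YA.
have [q q0 qd] : exists2 q, 0 < q & forall i, q <= Num.sqrt (d 0 i).
  (* Starting the minimum from 1 keeps it positive for a matrix of size 0 as well. *)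
  exists (\big[Num.min/1]_i Num.sqrt (d 0 i)).
    by apply: lt_bigmin => // i _; rewrite sqrtr_gt0.
  by move=> i; exact: bigmin_le_cond.
have Yq (x : 'cV[R]_n) : q * (x^T *m x) 0 0 <= (x^T *m Y *m x) 0 0.
  have : 0 <= (x^T *m mxfun P d (fun y => Num.sqrt y + - q) *m x) 0 0.
    by apply: (mxfun_ge0 Asym Pu AP) => i; rewrite subr_ge0.
  rewrite mxfunD mxfun_cst// mulmxDr mulmxDl mul_mx_scalar -scalemxAl mxE.
  by rewrite [X in _ + X]mxE mulNr subr_ge0.
have A0 (x : 'cV[R]_n) : `|(x^T *m (A - A) *m x) 0 0| <= 0 * (x^T *m x) 0 0.
  by rewrite subrr mulmx0 mul0mx mxE normr0 mul0r.
have XY := sqrt_perturbation q0 (lexx 0) XA YA Yq A0.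
have Z0 (x : 'cV[R]_n) : (sqrtmx A - Y) *m x = 0.
  apply/eqP; apply: contraT => /cV_sqr_gt0.
  rewrite -enorm_sqr_cV => /lt0r_neq0; rewrite sqrf_eq0 => /negP[].
  by rewrite eq_le enorm_ge0 andbT (le_trans (XY _))// mul0r mul0r.
apply/eqP; rewrite -subr_eq0; apply/eqP/matrixP => i j.
by have /matrixP/(_ i 0) := Z0 (delta_mx j 0); rewrite -colE !mxE.
Qed.

End SquareRoot.

Section SqrtQuadrature.
Context {R : realType} {n : nat}.
Variables (A P : 'M[R]_n) (d : 'rV[R]_n) (cm cp : R) (K : nat).
Hypotheses (Asym : A^T = A) (Pu : P \in unitmx) (AP : P *m A = diag_mx d *m P).
Hypothesis cm_gt0 : 0 < cm.
Hypothesis spA : spectrum_in A cm cp.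

Lemma spectrum_diag i : cm <= d 0 i <= cp.
Proof. exact/spA/(eigenvalue_mxfun Pu AP). Qed.

Lemma S_mx_mxfun : S_mx A cm cp K = mxfun P d (sqrt_quad cm cp K).
Proof.
have mulA f : mxfun P d (fun x => x * f x) = A *m mxfun P d f.
  by rewrite -[A in RHS](mxfun_id Pu AP) -mxfunM.
rewrite /S_mx /sqrt_quad mxfunZ mulA mxfun_sum//.
congr (_ *: (_ *m _)); apply: eq_bigr => k _.
rewrite mxfunZ; congr (_ *: _).
set w := (_ ^+ 2); rewrite -(@mxfunV _ _ P d Pu (fun x => x + w)).
  by rewrite mxfunD mxfun_cst// (mxfun_id Pu AP).
move=> i; have /andP[c _] := spectrum_diag i.
by rewrite lt0r_neq0// (lt_le_trans cm_gt0)// (le_trans c)// lerDl sqr_ge0.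
Qed.

Lemma sqrtmx_sub_S_mx : sqrtmx A - S_mx A cm cp K =
  mxfun P d (fun x => Num.sqrt x + -1 * sqrt_quad cm cp K x).
Proof.
rewrite mxfunD mxfunZ scaleN1r -S_mx_mxfun -(sqrtmx_mxfun Asym Pu AP)// => i.
by have /andP[c _] := spectrum_diag i; exact: lt_le_trans c.
Qed.

End SqrtQuadrature.

Lemma tr_sqrtmx_sub_S_mx (R : realType) n (A : 'M[R]_n) cm cp K : A^T = A ->
  0 < cm -> spectrum_in A cm cp ->
  (sqrtmx A - S_mx A cm cp K)^T = sqrtmx A - S_mx A cm cp K.
Proof.
move=> Asym cm0 spA; have [P [d [Pu AP]]] := symmetric_diagonalizable Asym.
by rewrite (sqrtmx_sub_S_mx K Asym Pu AP cm0 spA) (tr_mxfun Asym Pu AP).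
Qed.

Lemma S_mx_error (R : realType) (kap : R) : exists cC : R * R,
  [/\ 0 < cC.1, 0 < cC.2 & forall n (A : 'M[R]_n) (cm cp : R) (K : nat),
    A^T = A -> 0 < cm -> cm <= cp -> cp / cm = kap -> spectrum_in A cm cp ->
    (0 < K)%N -> forall x : 'cV[R]_n,
    enorm ((sqrtmx A - S_mx A cm cp K) *m x) <=
      Num.sqrt cm * (cC.2 * expR (- cC.1 * K%:R)) * enorm x].
Proof.
have [kap1|kap1] := leP 1 kap; last first.
  (* A ratio below 1 contradicts cm <= cp, so any constants do. *)
  exists (1, 1); split => //= n A cm cp K _ cm0 cmp cpk; exfalso.
  have : 1 <= kap by rewrite -cpk ler_pdivlMr// mul1r.
  by rewrite leNgt kap1.
have [c [C [c0 C0 H]]] := sqrt_quad_error kap1.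
exists (c, C); split => //= n A cm cp K Asym cm0 _ cpk spA K0 x.
have [P [d [Pu AP]]] := symmetric_diagonalizable Asym.
rewrite (sqrtmx_sub_S_mx K Asym Pu AP cm0 spA).
apply: (enorm_mxfun Asym Pu AP).
  by rewrite mulr_ge0 ?sqrtr_ge0// mulr_ge0 ?expR_ge0// ltW.
by move=> i; rewrite mulN1r; apply: H => //; exact: (spectrum_diag Pu AP spA).
Qed.

(* The constant may depend on the ratio [cp / cm] only: [cm] is bounded by any
   upper bound [c] of a nonempty spectrum. *)
Lemma opnorm_S_mx_error (R : realType) (kap c : R) : exists cC : R * R,
  [/\ 0 < cC.1, 0 < cC.2 & forall n (A : 'M[R]_n) (c' cm cp : R) (K : nat),
    A^T = A -> spectrum_in A c' c ->
    0 < cm -> cm <= cp -> cp / cm = kap -> spectrum_in A cm cp -> (0 < K)%N ->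
    opnorm (sqrtmx A - S_mx A cm cp K) <= cC.2 * expR (- cC.1 * K%:R)].
Proof.
have [[e C] /= [e0 C0 H]] := S_mx_error kap.
exists (e, (1 + Num.sqrt c) * C); split => //=.
  by rewrite mulr_gt0// ltr_pwDl// sqrtr_ge0.
move=> [|n] A c' cm cp K Asym spA cm0 cmp cpk spA' K0.
  apply: opnorm_le => [|x].
    by rewrite !mulr_ge0 ?expR_ge0 ?addr_ge0 ?sqrtr_ge0 ?(ltW C0).
  rewrite /enorm big_ord0 sqrtr0 mulr_ge0 ?sqrtr_ge0//.
  by rewrite !mulr_ge0 ?expR_ge0 ?addr_ge0 ?sqrtr_ge0 ?(ltW C0).
have cmc : cm <= c.
  have [P [d [Pu AP]]] := symmetric_diagonalizable Asym.
  have /andP[h1 _] := spectrum_diag Pu AP spA' 0.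
  by have /andP[_ h2] := spectrum_diag Pu AP spA 0; exact: le_trans h1 h2.
apply: opnorm_le => [|x].
  by rewrite !mulr_ge0 ?expR_ge0 ?addr_ge0 ?sqrtr_ge0 ?(ltW C0).
apply: le_trans (H _ _ _ _ _ Asym cm0 cmp cpk spA' K0 x) _.
rewrite ler_wpM2r ?enorm_ge0// -mulrA ler_wpM2r//.
  by rewrite mulr_ge0 ?expR_ge0// ltW.
by rewrite (le_trans (ler_wsqrtr cmc))// lerDr.
Qed.

Section FormBounds.
Context {R : realType} {n : nat}.
Variables (A : 'M[R]_n) (cm cp : R).
Hypotheses (Asym : A^T = A) (spA : spectrum_in A cm cp).

Lemma spectrum_form_le (x : 'cV[R]_n) :
  (x^T *m A *m x) 0 0 <= cp * (x^T *m x) 0 0.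
Proof.
have [P [d [Pu AP]]] := symmetric_diagonalizable Asym.
have : 0 <= (x^T *m mxfun P d (fun y => cp + -1 * id y) *m x) 0 0.
  apply: (mxfun_ge0 Asym Pu AP) => i; rewrite mulN1r subr_ge0.
  by have /andP[] := spectrum_diag Pu AP spA i.
rewrite mxfunD mxfun_cst// mxfunZ (mxfun_id Pu AP) scaleN1r mulmxBr mulmxBl.
by rewrite mul_mx_scalar -scalemxAl mxE [X in X + _]mxE [X in _ + X]mxE subr_ge0.
Qed.

Lemma sqrtmx_form_ge (x : 'cV[R]_n) : 0 < cm ->
  Num.sqrt cm * (x^T *m x) 0 0 <= (x^T *m sqrtmx A *m x) 0 0.
Proof.
move=> cm0; have [P [d [Pu AP]]] := symmetric_diagonalizable Asym.
have dc i : cm <= d 0 i by have /andP[] := spectrum_diag Pu AP spA i.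
rewrite (sqrtmx_mxfun Asym Pu AP); last by move=> i; exact: lt_le_trans (dc i).
have : 0 <= (x^T *m mxfun P d (fun y => Num.sqrt y + - Num.sqrt cm) *m x) 0 0.
  by apply: (mxfun_ge0 Asym Pu AP) => i; rewrite subr_ge0 ler_wsqrtr.
rewrite mxfunD mxfun_cst// mulmxDr mulmxDl mul_mx_scalar -scalemxAl mxE.
by rewrite [X in _ + X]mxE mulNr subr_ge0.
Qed.

End FormBounds.

(** By symmetry the row i is the image of a unit vector. Its squared norm is the variance of the
    component i of T xi for a standard normal vector xi, so operator norm bounds become variance
    bounds. *)
Lemma row_sqr_le (R : realType) n (T : 'M[R]_n) (m : R) i : T^T = T -> 0 <= m ->
  (forall x : 'cV[R]_n, enorm (T *m x) <= m * enorm x) ->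
  \sum_j T i j ^+ 2 <= m ^+ 2.
Proof.
move=> Tsym m0 Tm; have e1 : enorm (delta_mx i 0 : 'cV[R]_n) = 1.
  rewrite /enorm (bigD1 i)//= big_ord1 mxE !eqxx expr1n big1 ?addr0 ?sqrtr1// => k ki.
  by rewrite big_ord1 mxE (negbTE ki) expr0n.
have := Tm (delta_mx i 0); rewrite e1 mulr1 -colE => H.
rewrite (_ : \sum_j _ = enorm (col i T) ^+ 2); last first.
  rewrite enorm_sqr; apply: eq_bigr => j _.
  by rewrite big_ord1 mxE -[in LHS]Tsym mxE.
by rewrite lerXn2r// nnegrE// enorm_ge0.
Qed.

(** * Square integrable functions on the manifold *)

Section SquareIntegrable.
Context {d : measure_display} {T : measurableType d} {R : realType}.
Variable mu : {measure set T -> \bar R}.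
Implicit Types f g : T -> R.

Lemma Lfun2P f : f \in Lfun mu 2%:E <->
  measurable_fun setT f /\ (\int[mu]_x (f x ^+ 2)%:E < +oo)%E.
Proof.
split=> [f2|[mf fi]].
  have mf : measurable_fun setT f by have := sub_Lfun_mfun f2; rewrite inE.
  split => //; have /integrableP[_] := Lfun2_integrable_sqr f2.
  apply: le_lt_trans; apply: ge0_le_integral => //.
  - by move=> x _; rewrite lee_fin sqr_ge0.
  - exact/measurable_EFinP/measurable_funX.
  - by apply: measurableT_comp => //; exact/measurable_EFinP/measurable_funX.
  - by move=> x _; rewrite lee_fin ler_norm.
apply/andP; split; rewrite inE//= /finite_norm unlock /Lnorm.
rewrite poweR_lty//=; apply: le_lt_trans fi.
apply: ge0_le_integral => //.
- apply/measurable_EFinP/(@measurableT_comp _ _ _ _ _ _ (fun x : R => x `^ 2)) => //.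
  exact/measurableT_comp.
- exact/measurable_EFinP/measurable_funX.
- by move=> x _; rewrite lee_fin powR_mulrn// real_normK ?num_real.
Qed.

Lemma Lfun2_lin f g (a : R) : f \in Lfun mu 2%:E -> g \in Lfun mu 2%:E ->
  (fun x => a * f x + g x) \in Lfun mu 2%:E.
Proof.
move=> f2 g2; have [_ H] := Lfun_addr_closed mu (lee1n 2).
apply: (H (fun x => a * f x) g) => //.
have -> : (fun x => a * f x) = a \o* f by apply/funext => x /=; rewrite mulrC.
by apply: Lfun_scale => //; rewrite ler1n.
Qed.

Lemma Lfun2_integrableM f g : f \in Lfun mu 2%:E -> g \in Lfun mu 2%:E ->
  mu.-integrable setT (EFin \o (fun x => f x * g x)).
Proof. by move=> f2 g2; exact/Lfun1_integrable/Lfun2_mul_Lfun1. Qed.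

End SquareIntegrable.

Section L2Space.
Context {R : realType} {n D : nat} (M : closed_manifold R n D).
Variable vol : {measure set (borel M) -> \bar R}.
Implicit Types f g : M -> R.

Local Notation L2 := (L2 vol).
Local Notation ip := (ip vol).

Lemma L2_lin f g (a : R) : L2 f -> L2 g -> L2 (fun x => a * f x + g x).
Proof. exact: Lfun2_lin. Qed.

Lemma L2_0 : L2 (fun=> 0).
Proof. by have [H _] := Lfun_addr_closed vol (lee1n 2). Qed.

Lemma L2_sum (I : eqType) (r : seq I) (a : I -> R) (F : I -> M -> R) :
  (forall i, i \in r -> L2 (F i)) -> L2 (fun x => \sum_(i <- r) a i * F i x).
Proof.
elim: r => [|i r IH] LF.
  rewrite (_ : (fun x => _) = fun=> 0); first exact: L2_0.
  by apply/funext => x; rewrite big_nil.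
rewrite (_ : (fun x => _) = fun x => a i * F i x + \sum_(i <- r) a i * F i x).
  apply: L2_lin; first by apply: LF; rewrite mem_head.
  by apply: IH => k kr; apply: LF; rewrite inE kr orbT.
by apply/funext => x; rewrite big_cons.
Qed.

Lemma ipC f g : ip f g = ip g f.
Proof. by congr (fine (integral vol _ _)); apply/funext => x; rewrite /= mulrC. Qed.

Lemma ip_linl f g h (a : R) : L2 f -> L2 g -> L2 h ->
  ip (fun x => a * f x + g x) h = a * ip f h + ip g h.
Proof.
move=> Lf Lg Lh; rewrite /ip -RintegralZl//; last exact: Lfun2_integrableM.
rewrite -RintegralD//.
- by congr (fine (integral vol _ _)); apply/funext => x /=; rewrite mulrDl mulrA.
- rewrite (_ : EFin \o _ = (fun x : borel M => a%:E * (EFin \o (fun x : borel M => f x * h x)%R) x)%E).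
    by apply: integrableZl => //; exact: Lfun2_integrableM.
  by apply/funext.
- exact: Lfun2_integrableM.
Qed.

Lemma ip0l g : ip (fun=> 0) g = 0.
Proof.
rewrite /ip (_ : (fun x : borel M => _) = fun=> 0) ?Rintegral_cst ?mul0r//.
by apply/funext => x; rewrite mul0r.
Qed.

Lemma ip_suml (I : eqType) (r : seq I) (a : I -> R) (F : I -> M -> R) g :
  (forall i, i \in r -> L2 (F i)) -> L2 g ->
  ip (fun x => \sum_(i <- r) a i * F i x) g = \sum_(i <- r) a i * ip (F i) g.
Proof.
move=> + Lg; elim: r => [|i r IH] LF.
  rewrite big_nil (_ : (fun x => _) = fun=> 0); first exact: ip0l.
  by apply/funext => x; rewrite big_nil.
rewrite (_ : (fun x => _) = fun x => a i * F i x + \sum_(i <- r) a i * F i x).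
  have LF' k : k \in r -> L2 (F k) by move=> kr; apply: LF; rewrite inE kr orbT.
  rewrite ip_linl ?IH ?big_cons//; last exact: L2_sum.
  by apply: LF; rewrite mem_head.
by apply/funext => x; rewrite big_cons.
Qed.

Lemma ip_ge0 f : 0 <= ip f f.
Proof. by apply: Rintegral_ge0 => x _; rewrite -expr2 sqr_ge0. Qed.

Lemma ip_ae f f' g : L2 f -> L2 f' -> L2 g -> ae_eq_fun vol f f' ->
  ip f g = ip f' g.
Proof.
move=> Lf Lf' Lg ff'; rewrite /ip /Rintegral; congr fine.
apply: ae_eq_integral => //.
- by have /integrableP[] := Lfun2_integrableM Lf Lg.
- by have /integrableP[] := Lfun2_integrableM Lf' Lg.
- by apply: filterS ff' => x + _; move=> /= ->.
Qed.

Lemma ip_cauchy_schwarz f g : L2 f -> L2 g ->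
  `|ip f g| <= L2norm vol f * L2norm vol g.
Proof.
move=> Lf Lg; rewrite -sqrtr_sqr /L2norm -sqrtrM ?ip_ge0// ler_wsqrtr//.
have H t : 0 <= t ^+ 2 * ip f f + 2 * t * ip f g + ip g g.
  have LF := L2_lin t Lf Lg; set F := (fun x => t * f x + g x) in LF.
  have -> : t ^+ 2 * ip f f + 2 * t * ip f g + ip g g = ip F F.
    rewrite [RHS]ip_linl// [ip f F]ipC [ip g F]ipC !ip_linl// [ip g f]ipC; ring.
  exact: ip_ge0.
have [f0|f0] := eqVneq (ip f f) 0.
  rewrite f0 mul0r; have [->|fg0] := eqVneq (ip f g) 0; first by rewrite expr0n.
  (* Here the quadratic in t degenerates to an affine function of nonzero slope; at this t it takes
     the value - 1. *)
  have := H (- (ip g g + 1) / (2 * ip f g)).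
  rewrite f0 mulr0 add0r (_ : 2 * _ * _ = - (ip g g + 1)); last by field.
  by rewrite opprD addrAC addNr add0r ler0N1.
have fp : 0 < ip f f by rewrite lt0r f0 ip_ge0.
have := H (- ip f g / ip f f); rewrite -(pmulr_rge0 _ fp).
set t := - _ / _; have -> : ip f f * (t ^+ 2 * ip f f + 2 * t * ip f g + ip g g) =
    ip f f * ip g g - ip f g ^+ 2 by rewrite /t; field.
by rewrite subr_ge0.
Qed.

Lemma test_continuous (u : test M) : continuous (u : M -> R).
Proof.
move=> x; have [c cx] := mfd_cover x; have us := proj2_sig u c.
have [uc _] := us [::] (chart c x) (ex_intro2 _ _ x cx erefl).
have cc : {for x, continuous (chart c)}.
  have := @chart_continuous _ _ _ M c.
  rewrite continuous_open_subspace; last exact: dom_open.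
  by apply; exact/mem_set.
have : ((u \o chart_inv c) \o chart c) y @[y --> x] --> u (chart_inv c (chart c x)).
  exact: continuous_comp cc uc.
rewrite [X in u X]chart_invK//; apply: cvg_trans; apply: near_eq_cvg.
have : nbhs x (dom M c) by apply: open_nbhs_nbhs; split => //; exact: dom_open.
by apply: filterS => y yc /=; rewrite chart_invK.
Qed.

Lemma test_measurable (u : test M) :
  measurable_fun [set: borel M] (u : borel M -> R).
Proof.
apply: (measurability _ (RGenOpens.measurableE R)) => _ [_ [a [b ->] <-]].
rewrite setTI; apply: sub_sigma_algebra.
have /continuousP := @test_continuous u.
by apply; exact: interval_open.
Qed.

(** The real integral of a nonnegative function with infinite integral is 0 by convention, so a
    nonzero value certifies finiteness. Orthonormality thus puts the eigenfunctions in L^2 without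
    knowing that the volume is finite. *)
Lemma L2_test_of (u : test M) : ip u u != 0 -> L2 u.
Proof.
move=> u0; apply/Lfun2P; split; first exact: test_measurable.
rewrite ltey; apply: contra_neq u0 => E.
rewrite /ip /Rintegral (_ : (fun x => _) = (fun x : borel M => (u x ^+ 2)%:E)) ?E//.
Qed.

End L2Space.

(** * Finiteness of the Riemannian volume *)

Section FiniteVolume.
Context {R : realType} {n D : nat} {M : closed_manifold R n D}.
Variable vol : {measure set (borel M) -> \bar R}.
Hypothesis hvol : riemannian_volume vol.

(** The volume is known only through integrals of continuous functions supported in a chart, which
    are real numbers. A Urysohn function f, equal to 1 at x and to 0 off the chart, is cut to max (f
    - 1/2, 0) so that its closed support lies in the chart; this cut function is at least 1/4 where
    f > 3/4. *)
Lemma locally_finite_volume (x : M) : exists U : set M,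
  [/\ open U, U x & (vol (U : set (borel M)) < +oo)%E].
Proof.
have [c cx] := mfd_cover x.
have nM : normal_space M := compact_normal (@mfd_hausdorff _ _ _ M) (@mfd_compact _ _ _ M).
have cdom : closed (~` dom M c) by apply: open_closedC; exact: dom_open.
have cl1 : closed [set x].
  exact: (compact_closed (@mfd_hausdorff _ _ _ M) (@compact_set1 _ x)).
have disj : ~` dom M c `&` [set x] = set0.
  by apply/seteqP; split=> // y [yc /= yx]; apply: yc; rewrite yx.
have us := iffLR normal_separatorP nM _ _ cdom cl1 disj.
have [f [fc _ f0 f1]] := iffLR (@uniform_separatorP M R _ _) (us R).
pose g y := Num.max (f y - 1 / 2) 0.
have gc : continuous g.
  move=> y; apply: (@continuous_max R M (fun z => f z - 1 / 2) (cst 0) y).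
    by apply: cvgB; [exact: fc|exact: cvg_cst].
  exact: cvg_cst.
have gsupp : tsupp g `<=` dom M c.
  have : closed (f @^-1` [set t | 1 / 2 <= t]).
    by apply: preimage_closed => [y _|]; [exact: fc|exact: closed_ge].
  move=> /closure_id E; rewrite /tsupp => y.
  move=> /(closureS (B := f @^-1` [set t | 1 / 2 <= t])) H.
  have : f y >= 1 / 2.
    have := H; rewrite -E; apply => z /=; rewrite /g.
    by case: (leP (f z - 1 / 2) 0) => [_ /eqP//|+ _]; rewrite subr_gt0 => /ltW.
  apply: contraPP => yc; have -> : f y = 0 by apply: f0; exists y.
  by apply/negP; rewrite -ltNge divr_gt0.
exists (f @^-1` [set t | 3 / 4 < t]); split.
- by move/continuousP : fc; apply; exact: open_gt.
- by rewrite /= (f1 _ (ex_intro2 _ _ x erefl erefl)); lra.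
set U := (X in vol X).
have mU : measurable (U : set (borel M)).
  apply: sub_sigma_algebra.
  by move/continuousP : fc; apply; exact: open_gt.
have mg : measurable_fun [set: borel M] (g : borel M -> R).
  apply: (measurability _ (RGenOpens.measurableE R)) => _ [_ [a [b ->] <-]].
  rewrite setTI; apply: sub_sigma_algebra.
  by move/continuousP : gc; apply; exact: interval_open.
have g0 y : 0 <= g y by rewrite /g le_max lexx orbT.
have := hvol gc gsupp; set I := integral_rV _ => gI.
have : ((4^-1)%:E * vol U <= I%:E)%E.
  rewrite -gI -(setIT U) -integral_cst; last exact: measurableI.
  rewrite integral_mkcond; apply: ge0_le_integral => //.
  - by move=> y _; apply: erestrict_ge0 => z _; rewrite lee_fin.
  - by apply/(measurable_restrictT _ _).1 => //; exact: measurableI.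
  - exact/measurable_EFinP.
  move=> y _; rewrite patchE; case: ifPn => [|_]; last by rewrite lee_fin.
  rewrite inE setIT /U /= lee_fin /g le_max => H; apply/orP; left; lra.
rewrite -lee_pdivlMl// => H; exact: le_lt_trans H (ltry _).
Qed.

Lemma volume_finite : (vol [set: borel M] < +oo)%E.
Proof.
have [U HU] := choice locally_finite_volume.
have := @mfd_compact _ _ _ M; rewrite compact_cover.
move=> /(_ M setT U (fun x _ => let: And3 o _ _ := HU x in o)) [|F _ FT].
  by move=> x _; exists x => //; have [] := HU x.
have mU x : measurable (U x : set (borel M)).
  by apply: sub_sigma_algebra; have [] := HU x.
have sub : [set: borel M] `<=` \bigcup_(x in [set` F]) (U x : set (borel M)).
  by move=> y _; have [z Fz Uy] := FT y I; exists z.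
have := content_sub_fsum vol (finite_fset F) (fun x _ => mU x) measurableT sub.
move/le_lt_trans; apply; rewrite fsbig_finite//= lte_sum_pinfty// => x _.
by have [] := HU x.
Qed.

Lemma L2_test (v : test M) : L2 vol v.
Proof.
have mv := test_measurable v; apply/Lfun2P; split => //.
have [z _ vz] : exists2 z, z \in [set: M] &
    forall t, t \in [set: M] -> v t ^+ 2 <= v z ^+ 2.
  apply: (@compact_EVT_max M R (fun x => v x ^+ 2)).
  - by exists point.
  - exact: mfd_compact.
  - apply: continuous_subspaceT => x.
    exact: (@continuous_comp _ _ _ v (fun y => y ^+ 2) x (@test_continuous _ _ _ _ v x)
      (@exprn_continuous R 2 _)).
apply: (@le_lt_trans _ _ (\int[vol]_(x in setT) (v z ^+ 2)%:E)%E).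
  apply: ge0_le_integral => //.
  - by move=> x _; rewrite lee_fin sqr_ge0.
  - exact/measurable_EFinP/measurable_funX.
  - by move=> x _; rewrite lee_fin vz// in_setT.
rewrite integral_cst// lte_mul_pinfty ?lee_fin ?sqr_ge0//.
exact: volume_finite.
Qed.

End FiniteVolume.

(** * Expansions in eigenfunctions and Sobolev norms of nonpositive order *)

Section Parseval.
Context {R : realType} {n D : nat} {M : closed_manifold R n D}.
Context {vol : {measure set (borel M) -> \bar R}} (B : laplace_basis vol).
Implicit Types f g : M -> R.

Local Notation L2 := (L2 vol).
Local Notation ip := (ip vol).

Lemma L2_eigf k : L2 (eigf B k).
Proof. by apply: L2_test_of; rewrite eigf_orthonormal eqxx oner_eq0. Qed.

Lemma parseval f g : L2 f -> L2 g ->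
  (fun N => \sum_(k < N) ip f (eigf B k) * ip (eigf B k) g) @ \oo --> ip f g.
Proof.
move=> Lf Lg; pose S N x := \sum_(k < N) ip f (eigf B k) * eigf B k x.
have LS N : L2 (S N) by apply: L2_sum => k _; exact: L2_eigf.
have SE N : \sum_(k < N) ip f (eigf B k) * ip (eigf B k) g = ip (S N) g.
  by rewrite ip_suml// => k _; exact: L2_eigf.
have LfS N : L2 (fun x => f x - S N x).
  have -> : (fun x => f x - S N x) = fun x => -1 * S N x + f x.
    by apply/funext => x; rewrite mulN1r addrC.
  exact: L2_lin.
have dE N : ip f g - ip (S N) g = ip (fun x => f x - S N x) g.
  have -> : (fun x => f x - S N x) = fun x => -1 * S N x + f x.
    by apply/funext => x; rewrite mulN1r addrC.
  by rewrite ip_linl// mulN1r addrC.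
under eq_fun do rewrite SE.
apply/cvgrPdist_lt => e e0; pose b := L2norm vol g + 1.
have b0 : 0 < b by rewrite ltr_wpDl// sqrtr_ge0.
have /cvgr0_norm_lt/(_ _ (divr_gt0 e0 b0)) := eigf_complete B Lf.
apply: filterS => N /= H; rewrite dE (le_lt_trans (ip_cauchy_schwarz _ _))//.
rewrite (le_lt_trans (ler_wpM2l (sqrtr_ge0 _) (_ : _ <= b)))// ?lerDl//.
by rewrite -ltr_pdivlMr// (le_lt_trans (ler_norm _)).
Qed.

Lemma pairing_dist_of f g : L2 f -> L2 g ->
  pairing B (dist_of vol f) (dist_of vol g) = ip f g.
Proof.
move=> Lf Lg; apply: cvg_lim => //; rewrite /dist_of.
by under eq_fun do under eq_bigr do rewrite [ip g _]ipC; exact: parseval.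
Qed.

Lemma bessel f N : L2 f -> \sum_(k < N) ip f (eigf B k) ^+ 2 <= ip f f.
Proof.
move=> Lf; have H := parseval Lf Lf.
have E : (fun N => \sum_(k < N) ip f (eigf B k) * ip (eigf B k) f) =
         (fun N => \sum_(k < N) ip f (eigf B k) ^+ 2).
  by apply/funext => m; apply: eq_bigr => k _; rewrite [ip (eigf B k) f]ipC expr2.
rewrite E in H; rewrite -(cvg_lim _ H)//.
apply: (nondecreasing_cvgn_le (u_ := fun N => \sum_(k < N) ip f (eigf B k) ^+ 2)).
  apply/nondecreasing_seqP => m; rewrite big_ord_recr /= lerDl; exact: sqr_ge0.
by apply/cvg_ex; exists (ip f f).
Qed.

Lemma hnorm2_dist_of s f : s <= 0 -> L2 f ->
  (hnorm2 B s (dist_of vol f) <= (ip f f)%:E)%E.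
Proof.
move=> s0 Lf; apply: lime_le.
  by apply: is_cvg_nneseries => k _ _; rewrite lee_fin mulr_ge0 ?powR_ge0 ?sqr_ge0.
apply: nearW => N; rewrite sumEFin lee_fin big_mkord.
apply: le_trans (bessel N Lf); apply: ler_sum => k _.
rewrite -[leRHS]mul1r ler_wpM2r ?sqr_ge0//.
rewrite -[leRHS](powRr0 (1 + eigv B k)); apply: ler_powR => //.
by rewrite lerDl; exact: eigv_ge0.
Qed.

Lemma in_H_dist_of s f : (forall v : test M, L2 v) -> s <= 0 -> L2 f ->
  in_H B s (dist_of vol f).
Proof.
move=> Ltest s0 Lf.
split; first exact: le_lt_trans (hnorm2_dist_of s0 Lf) (ltry _).
by move=> v; exact: parseval.
Qed.

End Parseval.

(** * Second moments of Gaussian variables *)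

Section Gaussian.
Context {R : realType} {d : measure_display} {Omega : measurableType d}.
Variable P : probability Omega R.

(** By the half-angle formula this is four times the square of the difference quotient at 0 of t ->
    sin (t x / 2), which Caratheodory's criterion provides as a function continuous at 0. *)
Lemma cos_second_difference (x : R) :
  (fun n => 2 * (1 - cos (harmonic n * x)) / harmonic n ^+ 2) @ \oo --> x ^+ 2.
Proof.
have sd : is_derive (0 : R) 1 (fun t => sin (t * (x / 2))) (x / 2).
  refine (is_derive_compose (is_derive_sin _)
    (is_derive_mul (is_derive_id _ _) (is_derive_const _ _) erefl) _).
  by rewrite mul0r cos0 mulr0 addr0 !mul1r.
have [g [gE gc g0]] := iffLR (is_derive1_caratheodory _ _ _) sd.
have E n : 2 * (1 - cos (harmonic n * x)) / harmonic n ^+ 2 = 4 * g (harmonic n) ^+ 2.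
  have h0 : harmonic n != 0 :> R by rewrite invr_eq0 pnatr_eq0.
  have := gE (harmonic n); rewrite mul0r sin0 !subr0 => sE.
  have -> : harmonic n * x = (harmonic n * (x / 2)) *+ 2.
    by rewrite -mulr_natl; field.
  rewrite cos_mulr2n cos2sin2 sE -mulr_natl; field; exact: h0.
under eq_fun do rewrite E.
have -> : x ^+ 2 = 4 * g 0 ^+ 2 by rewrite g0; field.
have gl : g (harmonic n) @[n --> \oo] --> g 0.
  exact: cvg_comp cvg_harmonic gc.
apply: cvgM; first exact: cvg_cst.
by rewrite expr2; under eq_fun do rewrite expr2; exact: cvgM.
Qed.

(** Only the characteristic function is given. Fatou's lemma is applied to the nonnegative second
    differences of the cosine, whose integrals are at most v because 1 - exp (- y) <= y. An upper
    bound is all that the error estimate requires. *)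
Lemma second_moment_le (X : Omega -> R) (v : R) : centered_normal P X v ->
  (\int[P]_w (X w ^+ 2)%:E <= v%:E)%E.
Proof.
move=> [mX Xcf].
pose h (n : nat) : R := harmonic n.
have h0 n : 0 < h n by rewrite invr_gt0 ltr0n.
pose f n w := (2 * (1 - cos (h n * X w)) / h n ^+ 2)%:E.
have mc n : measurable_fun setT (fun w => cos (h n * X w)).
  apply: (@measurableT_comp _ _ _ _ _ _ cos).
    by apply: continuous_measurable_fun; exact: continuous_cos.
  exact: measurable_funM.
have mf n : measurable_fun setT (f n).
  apply/measurable_EFinP; apply: measurable_funM => //; apply: measurable_funM => //.
  exact: measurable_funB.
have f0 n w : setT w -> (0 <= f n w)%E.
  move=> _; by rewrite lee_fin divr_ge0 ?sqr_ge0// mulr_ge0// subr_ge0 cos_le1.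
have := fatou P measurableT mf f0.
have -> : (fun w => limn_einf (f^~ w)) = (fun w => (X w ^+ 2)%:E).
  apply/funext => w; have [] := @cvg_limn_einf_sup _ (f^~ w) (X w ^+ 2)%:E => //.
  by apply: cvg_EFin; [exact: nearW|exact: cos_second_difference].
move/le_trans; apply.
have fv n : (\int[P]_w f n w <= v%:E)%E.
  have ci : P.-integrable setT (EFin \o (fun w => cos (h n * X w))).
    apply: measurable_bounded_integrable => //.
      exact: le_lt_trans (probability_le1 P measurableT) (ltry _).
    exists 1; split => // M M1 w _ /=.
    by rewrite (le_trans _ (ltW M1))// ler_norml cos_geN1 cos_le1.
  have -> : (\int[P]_w f n w = (2 * (1 - expR (- (h n ^+ 2 * v / 2))) / h n ^+ 2)%:E)%E.
    have -> : f n = (fun w => (2 / h n ^+ 2)%:E * (1 - cos (h n * X w))%:E)%E.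
      by apply/funext => w; rewrite /f -EFinM mulrAC.
    have m1 : measurable_fun setT (fun w => (1 - cos (h n * X w))%:E).
      by apply/measurable_EFinP; exact: measurable_funB.
    have p1 w : setT w -> (0 <= (1 - cos (h n * X w))%:E)%E.
      by move=> _; rewrite lee_fin subr_ge0 cos_le1.
    have k0 : 0 <= 2 / h n ^+ 2 by rewrite divr_ge0// sqr_ge0.
    rewrite (ge0_integralZl_EFin P measurableT p1 m1 k0).
    have -> : (\int[P]_w (1 - cos (h n * X w))%:E = (1 - expR (- (h n ^+ 2 * v / 2)))%:E)%E.
      under eq_integral do rewrite EFinB.
      rewrite integralB//; last exact: finite_measure_integrable_cst.
      rewrite EFinB -(Xcf (h n)).1 /Rintegral fineK; last exact: integrable_fin_num.
      congr (_ - _)%E; rewrite integral_cst// -[RHS]mul1e; congr (_ * _)%E.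
      exact: probability_setT.
    by rewrite -EFinM mulrAC.
  rewrite lee_fin ler_pdivrMr ?exprn_gt0//.
  have := expR_ge1Dx (- (h n ^+ 2 * v / 2)); lra.
rewrite limn_einf_lim; apply: lime_le.
  exact: is_cvg_einfs.
apply: nearW => n; apply: le_trans (fv n).
by apply: ereal_inf_lbound; exists n => /=.
Qed.

End Gaussian.

(** * Multiresolution analyses *)

Section Sections.
Context {R : realType} {n D : nat} {M : closed_manifold R n D}.
Context {I : choiceType} (j0 : nat) (S : @mra_data R n D M I).

Lemma in_Lambda J l : (l \in Lambda j0 S J) =
  [&& (j0 <= l.1)%N, (l.1 <= J)%N & l.2 \in nabla j0 S l.1].
Proof.
apply/bigfcupP/idP => [[j]|/and3P[l0 lJ lk]].
  rewrite mem_index_iota ltnS andbT => /andP[jj jJ] /imfsetP[k /= kj ->] /=.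
  by rewrite jj jJ kj.
exists l.1; first by rewrite mem_index_iota ltnS l0 lJ.
by apply/imfsetP; exists l.2 => //; case: l lk {l0 lJ}.
Qed.

Lemma lam_Lambda J i : lam j0 S J i \in Lambda j0 S J.
Proof. exact: valP. Qed.

Lemma lam_calJ J i : calJ j0 S (lam j0 S J i).
Proof. by have := lam_Lambda i; rewrite in_Lambda => /and3P[]. Qed.

Lemma lam_le J i : ((lam j0 S J i).1 <= J)%N.
Proof. by have := lam_Lambda i; rewrite in_Lambda => /and3P[]. Qed.

Lemma lam_inj J : injective (lam j0 S J).
Proof. by move=> i j /val_inj/enum_val_inj. Qed.

Lemma lam_surj J l : l \in Lambda j0 S J -> exists i, lam j0 S J i = l.
Proof.
by move=> lL; exists (enum_rank [` lL]%fset); rewrite /lam enum_rankK.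
Qed.

Lemma esum_Lambda J (a : nat * I -> \bar R) : (forall l, 0 <= a l)%E ->
  (\esum_(l in [set` Lambda j0 S J]) a l = \sum_i a (lam j0 S J i))%E.
Proof.
move=> a0; rewrite (@reindex_esum R _ _ [set: 'I_(psec j0 S J)] _ (lam j0 S J))//.
  rewrite esum_fset//= fsbig_finite//=; apply/perm_big/uniq_perm => [||i].
  - exact: fset_uniq.
  - exact: index_enum_uniq.
  - apply/idP/idP => _; first exact: mem_index_enum.
    by rewrite in_fset_set ?inE//; exact: finite_finset.
split=> [i _|i j _ _|l /= lL]; [exact: lam_Lambda|exact: lam_inj|].
by have [i <-] := lam_surj lL; exists i.
Qed.

Lemma esum_calJ_split J (a : nat * I -> \bar R) : (forall l, 0 <= a l)%E ->
  (\esum_(l in calJ j0 S) a l = \sum_i a (lam j0 S J i) +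
    \esum_(l in calJ j0 S `&` [set l | (J < l.1)%N]) a l)%E.
Proof.
move=> a0; rewrite (esumID [set` Lambda j0 S J])//; congr (_ + _)%E.
  rewrite -esum_Lambda//; congr esum; apply/seteqP; split=> l /=; first by case.
  by move=> lL; split => //; move: lL; rewrite in_Lambda => /and3P[].
congr esum; apply/seteqP; split=> l /= [[l0 lk]].
  move=> H; split => //; rewrite ltnNge; apply/negP => lJ; apply: H.
  by rewrite in_Lambda l0 lJ lk.
by move=> lJ; split => //; rewrite in_Lambda l0 lk andbT /= leqNgt lJ.
Qed.

Lemma calJ_bigcup : calJ j0 S =
  \bigcup_j [set l | [/\ l.1 = j, (j0 <= j)%N & l.2 \in nabla j0 S j]].
Proof.
apply/seteqP; split=> [l [l0 lk]|l [j _ [<- l0 lk]]]; last by [].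
by exists l.1.
Qed.

Lemma esum_calJ (a : nat * I -> \bar R) : (forall l, 0 <= a l)%E ->
  (\esum_(l in calJ j0 S) a l = \sum_(0 <= j <oo)
    (if (j0 <= j)%N then \sum_(k <- nabla j0 S j) a (j, k) else 0))%E.
Proof.
move=> a0; rewrite calJ_bigcup nneseries_sum_bigcup//; last first.
  by move=> i j _ _ [l [[<- _ _] [<- _ _]]].
apply: eq_eseriesr => j _; case: ifPn => jj0; last first.
  by rewrite (_ : [set _ | _] = set0) ?esum_set0//; apply/seteqP; split => // l [].
rewrite (@reindex_esum R _ _ [set` nabla j0 S j] _ (pair j))//; last first.
  split=> [k /= kj|k k' _ _ []//|[_ k] /= [-> _ kj]]; first by [].
  by exists k.
by rewrite esum_fset// fsbig_finite//= set_fsetK.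
Qed.

End Sections.

Section Span.
Context {R : realType} {n D : nat} {M : closed_manifold R n D}.
Context {vol : {measure set (borel M) -> \bar R}} {I : choiceType}.
Implicit Types (K : {fset I}) (F : I -> M -> R).

Lemma span_of_lin K F f g (a : R) : span_of vol K F f -> span_of vol K F g ->
  span_of vol K F (fun x => a * f x + g x).
Proof.
move=> [Lf [b fE]] [Lg [c gE]]; split; first exact: L2_lin.
exists (fun k => a * b k + c k); apply: filterS2 fE gE => x -> ->.
rewrite mulr_sumr -big_split; apply: eq_bigr => k _ /=.
by rewrite mulrDl mulrA.
Qed.

Lemma span_of0 K F : span_of vol K F (fun=> 0).
Proof.
split; first exact: L2_0; exists (fun=> 0); apply: filterS filterT => x _.
by rewrite big1// => k _; rewrite mul0r.
Qed.

Lemma span_of_gen K F k : k \in K -> L2 vol (F k) -> span_of vol K F (F k).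
Proof.
move=> kK LF; split => //; exists (fun k' => (k' == k)%:R).
apply: filterS filterT => x _.
rewrite (big_fsetD1 k)//= eqxx mul1r big_seq big1 ?addr0// => k'.
by rewrite !inE => /andP[/negbTE -> _]; rewrite mul0r.
Qed.

End Span.

Section Multiresolution.
Context {R : realType} {n D : nat} {M : closed_manifold R n D}.
Context {vol : {measure set (borel M) -> \bar R}} (B : laplace_basis vol).
Context {I : choiceType} (j0 : nat) (S : @mra_data R n D M I) (d dt : nat).
Hypothesis hS : biorthogonal_mra B j0 S d dt.
Hypothesis Ltest : forall v : test M, L2 vol v.

Local Notation psi l := (psi S l.1 l.2).
Local Notation psit l := (psit S l.1 l.2).

Lemma V_mono j j' : (j0 < j)%N -> (j <= j')%N -> V vol S j `<=` V vol S j'.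
Proof.
move=> jj0 /subnKC <-; elim: (_ - _)%N => [|k IH]; first by rewrite addn0.
rewrite addnS; apply: (subset_trans IH).
by have [] := V_nested hS (leq_trans jj0 (leq_addr k j)).
Qed.

Lemma psi_V J l : calJ j0 S l -> (l.1 <= J)%N -> V vol S J.+1 (psi l).
Proof.
case: l => j k Jl jJ; have [Lp _] := psi_L2 hS Jl.
have [/= jj0 kj] := Jl; move: jj0; rewrite leq_eqVlt => /orP[/eqP jj|jj0].
  apply: (@V_mono j.+1) => //; first by rewrite -jj.
  subst j; have [E _] := psi_coarse hS kj; rewrite /= E in Lp *.
  by apply: span_of_gen => //; move: kj; rewrite /nabla eqxx.
apply: (@V_mono j.+1) => //; first exact: leq_trans jj0 _.
have [[WV _ _ _] _] := W_complement hS jj0.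
by apply: WV; apply: span_of_gen.
Qed.

(** Biorthogonality makes Q_j the identity on V_j, so for functions in V_{J+1} the projectors
    disappear from the consistency estimate. *)
Lemma Q_dist_of j f : (j0 < j)%N -> V vol S j f ->
  Q B j0 S j (dist_of vol f) = dist_of vol f.
Proof.
move=> jj0 [Lf [a fE]]; apply/funext => v; rewrite /Q gtn_eqF//.
have Lphi k : k \in Delta S j -> L2 vol (phi S j k).
  by move=> kD; have [] := phi_L2 hS jj0 kD.
have Lsum := L2_sum a Lphi.
rewrite [RHS](ip_ae Lf Lsum (Ltest v) fE) ip_suml// big_seq [RHS]big_seq.
apply: eq_bigr => k kD; congr (_ * _).
have [_ Lpt] := phi_L2 hS jj0 kD.
rewrite pairing_dist_of// (ip_ae Lf Lsum Lpt fE) ip_suml//.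
rewrite (big_fsetD1 k)//= (phi_biorthogonal hS)// eqxx mulr1 big_seq big1 ?addr0//.
move=> k' /[!inE] /andP[/negbTE kk' kD'].
by rewrite (phi_biorthogonal hS)// kk' mulr0.
Qed.

Definition synth J (x : 'cV[R]_(psec j0 S J)) : M -> R :=
  fun y => \sum_i x i 0 * psi (lam j0 S J i) y.

Lemma L2_psi_lam J i : L2 vol (psi (lam j0 S J i)).
Proof. by have [] := psi_L2 hS (lam_calJ i). Qed.

Lemma L2_synth J (x : 'cV[R]_(psec j0 S J)) : L2 vol (synth x).
Proof. by apply: L2_sum => i _; exact: L2_psi_lam. Qed.

Lemma V_synth J (x : 'cV[R]_(psec j0 S J)) : V vol S J.+1 (synth x).
Proof.
rewrite /synth; elim: (index_enum _) => [|i r IH].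
  rewrite (_ : (fun y => _) = fun=> 0); first exact: span_of0.
  by apply/funext => y; rewrite big_nil.
rewrite (_ : (fun y => _) =
  (fun y => x i 0 * psi (lam j0 S J i) y + \sum_(i <- r) x i 0 * psi (lam j0 S J i) y)).
  by apply: span_of_lin => //; apply: psi_V; [exact: lam_calJ|exact: lam_le].
by apply/funext => y; rewrite big_cons.
Qed.

Lemma pairing_synth_psit J (x : 'cV[R]_(psec j0 S J)) l : calJ j0 S l ->
  pairing B (dist_of vol (synth x)) (dist_of vol (psit l)) =
  extend x l.
Proof.
move=> Jl; have [_ Lt] := psi_L2 hS Jl.
rewrite pairing_dist_of//; last exact: L2_synth.
rewrite ip_suml//; last by move=> i _; exact: L2_psi_lam.
rewrite /extend [RHS]big_mkcond /=; apply: eq_bigr => i _.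
rewrite (psi_biorthogonal hS)//; last exact: lam_calJ.
by case: eqP => _; rewrite ?mulr1 ?mulr0.
Qed.

Lemma extend_lam J (x : 'cV[R]_(psec j0 S J)) i : extend x (lam j0 S J i) = x i 0.
Proof.
rewrite /extend (bigD1 i)//= big1 ?addr0// => k /andP[/eqP/lam_inj ->].
by rewrite eqxx.
Qed.

Lemma extend_out J (x : 'cV[R]_(psec j0 S J)) l : (J < l.1)%N -> extend x l = 0.
Proof.
move=> Jl; rewrite /extend big1// => i /eqP E.
by have := lam_le i; rewrite E leqNgt Jl.
Qed.

End Multiresolution.

(** * The covariance matrices *)

Section WaveletNorm.
Context {R : realType} {n D : nat} {M : closed_manifold R n D}.
Context {vol : {measure set (borel M) -> \bar R}} (B : laplace_basis vol).
Context {I : choiceType} (j0 : nat) (S : @mra_data R n D M I) (d dt : nat).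
Hypothesis hS : biorthogonal_mra B j0 S d dt.
Hypothesis Ltest : forall v : test M, L2 vol v.

(** By biorthogonality the dual wavelet coefficients of [synth x] are the entries of x on the
    section and 0 beyond it, so one half of the norm equivalence becomes a finite sum. *)
Lemma hnorm_synth (t : R) : t <= 0 ->
  (- regularity B j0 (Vt vol S) < t%:E < regularity B j0 (V vol S))%E ->
  exists2 c, 0 < c & forall J (x : 'cV[R]_(psec j0 S J)),
    hnorm B t (dist_of vol (synth x)) ^+ 2 <=
      c * \sum_i 2 `^ (2 * (lam j0 S J i).1%:R * t) * x i 0 ^+ 2.
Proof.
move=> t0 /(psit_norm_equivalence hS)[c [c' [c0 _ H]]].
exists c^-1; first by rewrite invr_gt0.
move=> J x; have Lx := L2_synth hS x.
have [+ _] := H _ (in_H_dist_of B Ltest t0 Lx).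
have pos k : (0 <= ((1 + eigv B k) `^ t * dist_of vol (synth x) (eigf B k) ^+ 2)%:E)%E.
  by rewrite lee_fin mulr_ge0 ?powR_ge0 ?sqr_ge0.
have h0 : (0 <= hnorm2 B t (dist_of vol (synth x)))%E.
  by apply: nneseries_ge0 => k _ _.
have hfin : hnorm2 B t (dist_of vol (synth x)) \is a fin_num.
  by rewrite ge0_fin_numE// (le_lt_trans (hnorm2_dist_of B t0 Lx)) ?ltry.
pose a (l : nat * I) := (2 `^ (2 * l.1%:R * t) * extend x l ^+ 2)%:E.
have a0 l : (0 <= a l)%E by rewrite lee_fin mulr_ge0 ?powR_ge0 ?sqr_ge0.
rewrite (eq_esum (b := a)); last first.
  by move=> l Jl; rewrite /a (pairing_synth_psit hS).
rewrite (esum_calJ_split j0 S J a0) [X in (_ + X)%E]esum1; last first.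
  by move=> l [_ lJ]; rewrite /a (extend_out _ lJ) expr0n mulr0.
rewrite adde0 sumEFin -(fineK hfin) -EFinM lee_fin.
rewrite /hnorm sqr_sqrtr ?fine_ge0// => cH.
rewrite [leRHS]mulrC ler_pdivlMr// mulrC; apply: (le_trans cH).
by rewrite le_eqVlt; apply/orP; left; apply/eqP/eq_bigr => i _; rewrite extend_lam.
Qed.

End WaveletNorm.

Section Covariance.
Context {R : realType} {n D : nat} {M : closed_manifold R n D}.
Context {vol : {measure set (borel M) -> \bar R}} (B : laplace_basis vol).
Context {dsp : measure_display} {Omega : measurableType dsp}.
Variables (P : probability Omega R) (Z : Omega -> M -> R) (C : dist M -> dist M).
Hypothesis ZL2 : forall w, L2 vol (Z w).
Hypothesis Zmeas : forall f, L2 vol f -> measurable_fun setT (fun w => ip vol (Z w) f).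
Hypothesis hCov : covariance_operator B P Z C.

Local Notation L2 := (L2 vol).

(** Symmetry, bilinearity and positivity of this form are all read off from its expression as the
    expectation of the product of the two coordinates of Z. *)
Definition cov f g := pairing B (C (dist_of vol f)) (dist_of vol g).
Let X f w := ip vol (Z w) f.

(** The covariance identity holds in the extended reals and its right-hand side is a real number, so
    the second moment is finite. *)
Let X_Lfun f : L2 f -> X f \in Lfun P 2%:E.
Proof.
move=> Lf; apply/Lfun2P; split; first exact: Zmeas.
have := hCov Lf Lf; rewrite -/(cov f f) => E.
by under eq_integral do rewrite expr2; rewrite E ltry.
Qed.

Lemma cov_Rintegral f g : L2 f -> L2 g -> cov f g = \int[P]_w (X f w * X g w).
Proof. by move=> Lf Lg; rewrite /Rintegral hCov. Qed.

Lemma cov_second_moment f : L2 f -> (\int[P]_w (X f w ^+ 2)%:E)%E = (cov f f)%:E.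
Proof. by move=> Lf; rewrite -hCov//; under eq_integral do rewrite expr2. Qed.

Lemma covC f g : L2 f -> L2 g -> cov f g = cov g f.
Proof.
by move=> Lf Lg; rewrite !cov_Rintegral//; apply: eq_Rintegral => w _; rewrite mulrC.
Qed.

Lemma cov_ge0 f : L2 f -> 0 <= cov f f.
Proof.
by move=> Lf; rewrite cov_Rintegral//; apply: Rintegral_ge0 => w _; rewrite -expr2 sqr_ge0.
Qed.

Lemma cov_linl f g h (a : R) : L2 f -> L2 g -> L2 h ->
  cov (fun x => a * f x + g x) h = a * cov f h + cov g h.
Proof.
move=> Lf Lg Lh; have Xf := X_Lfun Lf; have Xg := X_Lfun Lg; have Xh := X_Lfun Lh.
rewrite !cov_Rintegral//; last exact: L2_lin.
have If := Lfun2_integrableM Xf Xh; have Ig := Lfun2_integrableM Xg Xh.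
rewrite -RintegralZl// -RintegralD//; last first.
  rewrite (_ : EFin \o _ = (fun w => a%:E * (EFin \o (fun w => X f w * X h w)%R) w)%E).
    exact: integrableZl.
  by apply/funext.
apply: eq_Rintegral => w _ /=.
by rewrite /X ipC ip_linl// mulrDl mulrA [ip vol f _]ipC [ip vol g _]ipC.
Qed.

Lemma cov0l g : L2 g -> cov (fun=> 0) g = 0.
Proof.
move=> Lg; have := cov_linl 1 (@L2_0 _ _ _ _ vol) (@L2_0 _ _ _ _ vol) Lg.
rewrite (_ : (fun x : M => _) = fun=> 0); last by apply/funext => x; rewrite mul1r addr0.
by rewrite mul1r => /eqP; rewrite -subr_eq0 opprD addrA subrr sub0r oppr_eq0 => /eqP.
Qed.

Lemma cov_suml (K : eqType) (r : seq K) (a : K -> R) (F : K -> M -> R) g :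
  (forall i, i \in r -> L2 (F i)) -> L2 g ->
  cov (fun x => \sum_(i <- r) a i * F i x) g = \sum_(i <- r) a i * cov (F i) g.
Proof.
move=> + Lg; elim: r => [|i r IH] LF.
  rewrite big_nil (_ : (fun x => _) = fun=> 0); first exact: cov0l.
  by apply/funext => x; rewrite big_nil.
rewrite (_ : (fun x => _) = fun x => a i * F i x + \sum_(i <- r) a i * F i x).
  have LF' k : k \in r -> L2 (F k) by move=> kr; apply: LF; rewrite inE kr orbT.
  rewrite cov_linl ?IH ?big_cons//; last exact: L2_sum.
  by apply: LF; rewrite mem_head.
by apply/funext => x; rewrite big_cons.
Qed.

Section Matrix.
Context {I : choiceType} (j0 : nat) (S : @mra_data R n D M I) (d dt : nat).
Hypothesis hS : biorthogonal_mra B j0 S d dt.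

Lemma cov_mxE J i i' : cov_mx B j0 S C J i i' =
  cov (psi S (lam j0 S J i').1 (lam j0 S J i').2) (psi S (lam j0 S J i).1 (lam j0 S J i).2).
Proof. by rewrite mxE. Qed.

Lemma tr_cov_mx J : (cov_mx B j0 S C J)^T = cov_mx B j0 S C J.
Proof.
by apply/matrixP => i i'; rewrite mxE !cov_mxE covC//; exact: (L2_psi_lam hS).
Qed.

Lemma cov_synth J (x y : 'cV[R]_(psec j0 S J)) :
  cov (synth x) (synth y) = (y^T *m cov_mx B j0 S C J *m x) 0 0.
Proof.
rewrite cov_suml; [|by move=> i _; exact: (L2_psi_lam hS)|exact: (L2_synth hS)].
rewrite mxE; apply: eq_bigr => i _; rewrite mulrC; congr (_ * _).
rewrite covC; [|exact: (L2_psi_lam hS)|exact: (L2_synth hS)].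
rewrite cov_suml; [|by move=> k _; exact: (L2_psi_lam hS)|exact: (L2_psi_lam hS)].
rewrite mxE; apply: eq_bigr => k _; rewrite [y^T _ _]mxE; congr (_ * _).
by rewrite cov_mxE covC//; exact: (L2_psi_lam hS).
Qed.

End Matrix.
End Covariance.

Section Scaling.
Context {R : realType} {n D : nat} {M : closed_manifold R n D}.
Context {I : choiceType} (j0 : nat) (S : @mra_data R n D M I).

Lemma tr_Dmx J s : (Dmx j0 S J s)^T = Dmx j0 S J s.
Proof. exact: tr_diag_mx. Qed.

Lemma Dmx_cV J s (x : 'cV[R]_(psec j0 S J)) i :
  (Dmx j0 S J s *m x) i 0 = 2 `^ (s * (lam j0 S J i).1%:R) * x i 0.
Proof. by rewrite mul_diag_mx !mxE. Qed.

Lemma form_conj_Dmx J s (A : 'M[R]_(psec j0 S J)) (x : 'cV[R]_(psec j0 S J)) :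
  x^T *m (Dmx j0 S J s *m A *m Dmx j0 S J s) *m x =
  (Dmx j0 S J s *m x)^T *m A *m (Dmx j0 S J s *m x).
Proof. by rewrite trmx_mul tr_Dmx !mulmxA. Qed.

Lemma powR2_cancel (s y : R) : 2 `^ (2 * y * - s) * (2 `^ (s * y)) ^+ 2 = 1.
Proof.
rewrite expr2 -!powRD ?pnatr_eq0 ?implybT//.
by rewrite (_ : _ + _ = 0) ?powRr0//; ring.
Qed.

End Scaling.

(** * Comparison of the exact and the tapered covariance matrices *)

Section Compare.
Context {R : realType} {n D : nat} {M : closed_manifold R n D}.
Context {vol : {measure set (borel M) -> \bar R}} (B : laplace_basis vol).
Variable rhat : R.
Hypothesis rhat_gt0 : 0 < rhat.
Context {dsp : measure_display} {Omega : measurableType dsp}.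
Variables (P : probability Omega R) (Z : Omega -> M -> R) (C : dist M -> dist M).
Hypothesis Ltest : forall v : test M, L2 vol v.
Hypothesis ZL2 : forall w, L2 vol (Z w).
Hypothesis Zmeas : forall f, L2 vol f -> measurable_fun setT (fun w => ip vol (Z w) f).
Hypothesis hCov : covariance_operator B P Z C.
Context {I : choiceType} (j0 : nat) (S : @mra_data R n D M I) (d dt : nat).
Hypothesis hS : biorthogonal_mra B j0 S d dt.
Hypothesis hgamma : (0 < regularity B j0 (V vol S))%E.
Hypothesis hgammat : (rhat%:E < regularity B j0 (Vt vol S))%E.
Variables (eps0 d' : R) (a a' : R -> R) (ctm ctp : R).
Hypothesis eps0_gt0 : 0 < eps0.
Hypothesis hP : compression_properties B j0 S C rhat d' dt a a' d eps0 ctm ctp.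

Local Notation Reps := (R_eps B j0 S C rhat d' dt a a').
Local Notation Rmx := (R_mx B j0 S C rhat).
Local Notation cov := (cov (vol := vol) B C).

Lemma R_mx_form J (x : 'cV[R]_(psec j0 S J)) :
  (x^T *m Rmx J *m x) 0 0 =
  cov (synth (Dmx j0 S J rhat *m x)) (synth (Dmx j0 S J rhat *m x)).
Proof. by rewrite (cov_synth ZL2 Zmeas hCov hS) form_conj_Dmx. Qed.

Lemma tr_R_mx J : (Rmx J)^T = Rmx J.
Proof.
by rewrite /R_mx !trmx_mul tr_Dmx (tr_cov_mx hCov hS) mulmxA.
Qed.

Lemma R_mx_psd J (x : 'cV[R]_(psec j0 S J)) : 0 <= (x^T *m Rmx J *m x) 0 0.
Proof. by rewrite R_mx_form (cov_ge0 hCov)//; exact: (L2_synth hS). Qed.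

Lemma tr_R_eps eps J : 0 < eps < eps0 -> (j0 <= J)%N -> (Reps eps J)^T = Reps eps J.
Proof.
move=> he hJ; have [E _] := cov_eps_posdef hP he hJ.
by rewrite /R_eps !trmx_mul tr_Dmx E mulmxA.
Qed.

Lemma mx_form_synth J (A : 'M[R]_(psec j0 S J)) (x : 'cV[R]_(psec j0 S J)) :
  mx_form B A (dist_of vol (synth x)) (dist_of vol (synth x)) =
  (x^T *m A *m x) 0 0.
Proof.
rewrite /mx_form -mulmxA mxE; apply: eq_bigr => i _.
rewrite [x^T _ _]mxE mxE mulr_sumr; apply: eq_bigr => i' _.
rewrite !(pairing_synth_psit hS) ?extend_lam; try exact: lam_calJ.
ring.
Qed.

(* The consistency estimate in H^{-rhat}, where the wavelet coefficients scaled
   by [Dmx rhat] have bounded norm. *)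
Lemma R_mx_sub_R_eps : exists2 c, 0 <= c & forall eps J (x : 'cV[R]_(psec j0 S J)),
  0 < eps < eps0 -> (j0 <= J)%N ->
  `|(x^T *m (Rmx J - Reps eps J) *m x) 0 0| <= c * eps * (x^T *m x) 0 0.
Proof.
have r0 : - rhat <= 0 by rewrite oppr_le0 ltW.
have rd : - rhat <= - rhat <= d%:R by rewrite lexx (le_trans r0).
have [c1 H1] := cov_eps_consistent hP rd rd.
have tr : (- regularity B j0 (Vt vol S) < (- rhat)%:E < regularity B j0 (V vol S))%E.
  by rewrite EFinN lteN2 hgammat (le_lt_trans _ hgamma)// lee_fin.
have [c2 c20 H2] := hnorm_synth hS Ltest r0 tr.
exists (`|c1| * c2) => [|eps J x he hJ]; first by rewrite mulr_ge0// ltW.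
set y := Dmx j0 S J rhat *m x; set w := dist_of vol (synth y).
have wH : in_H B (- rhat) w by apply: in_H_dist_of => //; exact: (L2_synth hS).
have Qw : Q B j0 S J.+1 w = w.
  by apply: (Q_dist_of hS Ltest); [exact: leq_trans hJ _|exact: (V_synth hS)].
have := H1 eps J w w he hJ wH wH; rewrite /= Qw mx_form_synth.
rewrite -/(cov (synth y) (synth y)) => H.
rewrite mulmxBr mulmxBl mxE [X in _ + X]mxE R_mx_form form_conj_Dmx -/y.
apply: (le_trans H).
have -> : J%:R * (-2 * rhat - - rhat - - rhat) = 0 by ring.
rewrite powRr0 mulr1.
have := H2 J y; rewrite -/w.
have -> : \sum_i 2 `^ (2 * (lam j0 S J i).1%:R * - rhat) * y i 0 ^+ 2 = (x^T *m x) 0 0.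
  rewrite mxE; apply: eq_bigr => i _; rewrite [x^T _ _]mxE Dmx_cV exprMn mulrA.
  by rewrite powR2_cancel mul1r expr2.
have /andP[e0 _] := he.
move=> hw; set h := hnorm _ _ _ in hw *.
rewrite (_ : c1 * eps * h * h = c1 * (eps * h ^+ 2)); last by ring.
rewrite (_ : _ * c2 * eps * _ = `|c1| * (eps * (c2 * (x^T *m x) 0 0))); last by ring.
have e0' := ltW e0; apply: (@le_trans _ _ (`|c1| * (eps * h ^+ 2))).
  by rewrite ler_wpM2r ?ler_norm// mulr_ge0// sqr_ge0.
by rewrite ler_wpM2l// ler_wpM2l.
Qed.

Lemma cov_psi_le : exists2 c, 0 <= c & forall l, calJ j0 S l ->
  cov (psi S l.1 l.2) (psi S l.1 l.2) <= c * 2 `^ (- 2 * rhat * l.1%:R).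
Proof.
have [c c0 H] := R_mx_sub_R_eps.
(* This is the fixed eps. The form of R^eps at a unit vector is at most [ctp], and R differs from it
   by at most c eps0 / 2. *)
have he : 0 < eps0 / 2 < eps0 by move: eps0_gt0; lra.
have /andP[cm0 cmp] := R_eps_bounds hP.
exists (ctp + c * (eps0 / 2)).
  by rewrite addr_ge0 ?mulr_ge0 ?(ltW (lt_le_trans cm0 cmp)) ?divr_ge0 ?(ltW eps0_gt0).
move=> l Jl; have hJ : (j0 <= l.1)%N by case: Jl.
(* The section J = |l| is the smallest one that contains l; the variance of the coordinate l is then
   a rescaled diagonal entry of [Rmx]. *)
have [|i il] := @lam_surj _ _ _ _ _ j0 S l.1 l.
  by rewrite in_Lambda leqnn hJ; case: Jl.
pose x : 'cV[R]_(psec j0 S l.1) := delta_mx i 0.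
have x1 : (x^T *m x) 0 0 = 1.
  rewrite mxE (bigD1 i)//= !mxE !eqxx mulr1 big1 ?addr0// => k /negbTE ki.
  by rewrite !mxE ki mulr0.
have E : (x^T *m Rmx l.1 *m x) 0 0 =
    (2 `^ (rhat * l.1%:R)) ^+ 2 * cov (psi S l.1 l.2) (psi S l.1 l.2).
  rewrite trmx_delta -rowE -colE mxE mxE /R_mx mul_mx_diag mul_diag_mx !mxE il.
  by rewrite /cov_entry expr2 mulrAC.
have := H _ _ x he hJ; rewrite mulmxBr mulmxBl mxE [X in _ + X]mxE x1 mulr1.
have := spectrum_form_le (tr_R_eps he hJ) (R_eps_spectrum hP he hJ) x.
rewrite x1 mulr1 E => h1 /(le_trans (ler_norm _)) h2.
have p0 : 0 < 2 `^ (rhat * l.1%:R) :> R by rewrite powR_gt0.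
have -> : 2 `^ (-2 * rhat * l.1%:R) = ((2 `^ (rhat * l.1%:R)) ^+ 2)^-1 :> R.
  have := powR2_cancel rhat l.1%:R.
  rewrite (_ : 2 * _ * _ = -2 * rhat * l.1%:R); last by ring.
  by move=> /(canRL (mulfK _)) ->; rewrite ?mul1r// expf_neq0// lt0r_neq0.
rewrite ler_pdivlMr ?exprn_gt0// mulrC; lra.
Qed.

End Compare.

(** * Summation over the levels *)

Lemma geometric_tail (R : realType) (th : R) (m N : nat) : 0 < th < 1 ->
  \sum_(j < N) (if (m <= j)%N then th ^+ j else 0) <= th ^+ m / (1 - th).
Proof.
move=> /andP[t0 t1]; have t1' : 0 < 1 - th by rewrite subr_gt0.
(* Multiplied by 1 - th the sum telescopes; the maximum covers the range N <= m, in which the sum is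
   empty. *)
rewrite ler_pdivlMr//; apply: (@le_trans _ _ (th ^+ m - th ^+ maxn N m)).
  elim: N => [|N IH]; first by rewrite big_ord0 mul0r max0n subrr.
  rewrite big_ord_recr /= mulrDl; case: leqP => mN.
    have H := IH; rewrite (maxn_idPl mN) in H.
    by rewrite (maxn_idPl (leqW mN)) exprS; lra.
  rewrite mul0r addr0; apply: (le_trans IH).
  by rewrite (maxn_idPr mN) (maxn_idPr (ltnW mN)).
by rewrite gerBl exprn_ge0 ?ltW.
Qed.

Section Tail.
Context {R : realType} {n D : nat} {M : closed_manifold R n D}.
Context {vol : {measure set (borel M) -> \bar R}} (B : laplace_basis vol).
Context {I : choiceType} (j0 : nat) (S : @mra_data R n D M I) (d dt : nat).
Hypothesis hS : biorthogonal_mra B j0 S d dt.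
Variable rhat : R.
Hypothesis hrhat : n%:R / 2 < rhat.

Lemma card_nabla_le : exists2 c : R, 0 <= c & forall j, (j0 <= j)%N ->
  #|` nabla j0 S j|%:R <= c * (2 `^ n%:R) ^+ j.
Proof.
have [c H] := V_dim hS; exists (`|c| * 2 `^ n%:R).
  by rewrite mulr_ge0// powR_ge0.
move=> j jj0; apply: (@le_trans _ _ #|` Delta S j.+1|%:R).
  rewrite ler_nat fsubset_leq_card// /nabla.
  by case: eqP => [->|_]; [exact: fsubset_refl|exact: fsubsetDl].
apply: (le_trans (H _ (leq_ltn_trans jj0 (ltnSn _)))).
rewrite -mulrA -exprS -powR_mulrn ?powR_ge0// -powRrM.
by rewrite ler_wpM2r ?powR_ge0// ler_norm.
Qed.

(** Growth of a level from j to j + 1 multiplies the bound on the number of wavelets by 2^n and the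
    bound on their variance by 2^(- 2 rhat); the product is below 1 exactly when rhat > n / 2. *)
Let th : R := 2 `^ (n%:R - 2 * rhat).

Lemma decay_rate_lt1 : 0 < th < 1.
Proof.
rewrite powR_gt0//= /th /powR pnatr_eq0/= -[ltRHS]expR0 ltr_expR.
by rewrite pmulr_llt0 ?ln_gt0 ?ltr1n// subr_lt0; move: hrhat; lra.
Qed.

Lemma level_sum_le : exists2 c : R, 0 <= c & forall m b, 0 <= b ->
  (\esum_(l in calJ j0 S `&` [set l | (m <= l.1)%N])
     (b * 2 `^ (- 2 * rhat * l.1%:R))%:E <= (b * c * th ^+ m)%:E)%E.
Proof.
have [c c0 H] := card_nabla_le; have /andP[t0 t1] := decay_rate_lt1.
exists (c / (1 - th)) => [|m b b0]; first by rewrite divr_ge0// subr_ge0 ltW.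
pose a (l : nat * I) := (if (m <= l.1)%N then (b * 2 `^ (- 2 * rhat * l.1%:R))%:E else 0)%E.
have a0 l : (0 <= a l)%E by rewrite /a; case: ifP => // _; rewrite lee_fin mulr_ge0 ?powR_ge0.
have g0 j : 0 <= b * c * (if (m <= j)%N then th ^+ j else 0).
  by rewrite !mulr_ge0//; case: ifP => // _; rewrite exprn_ge0// ltW.
rewrite esum_mkcondr (eq_esum (b := a)); last first.
  move=> l _; rewrite /a; congr (if _ then _ else _).
  by apply/idP/idP => [/set_mem|] //; exact: mem_set.
rewrite esum_calJ//; apply: (@le_trans _ _
    (\sum_(0 <= j <oo) (b * c * (if (m <= j)%N then th ^+ j else 0))%:E)%E).
  apply: lee_nneseries => j _.
    by move=> _; case: ifP => // _; apply: sume_ge0 => k _.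
  case: ifPn => [jj0|_]; last by rewrite lee_fin.
  rewrite /a /=; case: ifP => mj; last by rewrite big1// mulr0.
  rewrite sumEFin lee_fin big_const_seq count_predT iter_addr_0 -[leLHS]mulr_natr.
  have -> : th ^+ j = 2 `^ (-2 * rhat * j%:R) * (2 `^ n%:R) ^+ j.
    rewrite -!powR_mulrn ?powR_ge0// -!powRrM -powRD ?pnatr_eq0 ?implybT//.
    by congr (_ `^ _); ring.
  rewrite -!mulrA ler_wpM2l// [leRHS]mulrCA; apply: ler_wpM2l; rewrite ?powR_ge0//.
  exact: H.
apply: lime_le.
  by apply: is_cvg_nneseries => j _ _; rewrite lee_fin.
apply: nearW => N; rewrite sumEFin lee_fin -mulr_sumr -!mulrA !ler_wpM2l//.
by rewrite big_mkord [leRHS]mulrC; exact: geometric_tail decay_rate_lt1.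
Qed.

Lemma section_sum_le : exists2 c : R, 0 <= c & forall J,
  \sum_i 2 `^ (- 2 * rhat * (lam j0 S J i).1%:R) <= c.
Proof.
have [c c0 H] := level_sum_le; exists c => // J.
have := H 0%N 1 ler01; rewrite mul1r expr0 mulr1 => /(le_trans _) H'.
have a0 (l : nat * I) : (0 <= (1 * 2 `^ (- 2 * rhat * l.1%:R))%:E :> \bar R)%E.
  by rewrite mul1r lee_fin powR_ge0.
rewrite -lee_fin; apply: H'.
rewrite (_ : _ `&` _ = calJ j0 S); last by apply/seteqP; split => l //= [].
rewrite (esum_calJ_split j0 S J a0) -sumEFin.
under eq_bigr do rewrite -[X in X%:E]mul1r.
by rewrite leeDl//; exact: esum_ge0.
Qed.

Context {dsp : measure_display} {Omega : measurableType dsp}.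
Variable P : probability Omega R.

(** Each level is finite, so the sum over [calJ] is a series of finite sums of nonnegative
    functions, to which monotone convergence applies. *)
Lemma expectation_esum (f : nat * I -> Omega -> \bar R) :
  (forall l, measurable_fun setT (f l)) -> (forall l w, 0 <= f l w)%E ->
  (\int[P]_w (\esum_(l in calJ j0 S) f l w) =
   \esum_(l in calJ j0 S) (\int[P]_w f l w))%E.
Proof.
move=> mf f0; rewrite esum_calJ; last by move=> l; exact: integral_ge0.
under eq_integral do rewrite esum_calJ//.
rewrite integral_nneseries//; last 2 first.
- by move=> j; case: (j0 <= j)%N => //; exact: emeasurable_sum.
- by move=> j w _; case: (j0 <= j)%N => //; exact: sume_ge0.
apply: eq_eseriesr => j _; case: (j0 <= j)%N; last by rewrite integral0.
by rewrite ge0_integral_sum.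
Qed.

End Tail.

(** * The mean square error *)

Section Sampling.
Context {R : realType} {n D : nat} {M : closed_manifold R n D}.
Context {vol : {measure set (borel M) -> \bar R}} (B : laplace_basis vol).
Variable rhat : R.
Hypothesis rhat_gt0 : 0 < rhat.
Context {dsp : measure_display} {Omega : measurableType dsp}.
Variables (P : probability Omega R) (Z : Omega -> M -> R) (C : dist M -> dist M).
Hypothesis Ltest : forall v : test M, L2 vol v.
Hypothesis ZL2 : forall w, L2 vol (Z w).
Hypothesis Zmeas : forall f, L2 vol f -> measurable_fun setT (fun w => ip vol (Z w) f).
Hypothesis hCov : covariance_operator B P Z C.
Context {I : choiceType} (j0 : nat) (S : @mra_data R n D M I) (d dt : nat).
Hypothesis hS : biorthogonal_mra B j0 S d dt.
Hypothesis hgamma : (0 < regularity B j0 (V vol S))%E.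
Hypothesis hgammat : (rhat%:E < regularity B j0 (Vt vol S))%E.
Variables (eps0 d' : R) (a a' : R -> R) (ctm ctp : R).
Hypothesis eps0_gt0 : 0 < eps0.
Hypothesis hP : compression_properties B j0 S C rhat d' dt a a' d eps0 ctm ctp.

Local Notation Reps := (R_eps B j0 S C rhat d' dt a a').
Local Notation Rmx := (R_mx B j0 S C rhat).

(** Under the coupling, the error on the section is almost surely the vector D^(- rhat) [defect]
    xi. *)
Let defect eps J K := sqrtmx (Rmx J) - S_mx (Reps eps J) ctm ctp K.

Lemma Reps_psd eps J (x : 'cV[R]_(psec j0 S J)) : 0 < eps < eps0 -> (j0 <= J)%N ->
  0 <= (x^T *m Reps eps J *m x) 0 0.
Proof.
move=> he hJ; have [_ pos] := cov_eps_posdef hP he hJ.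
rewrite form_conj_Dmx; set y := _ *m x.
by have [->|/pos/ltW//] := eqVneq y 0; rewrite mulmx0 mxE.
Qed.

Lemma defect_row_le : exists c e, [/\ 0 <= c, 0 < e &
  forall eps J K i, 0 < eps < eps0 -> (j0 <= J)%N -> (0 < K)%N ->
    \sum_j defect eps J K i j ^+ 2 <= c * (eps + expR (- e * K%:R)) ^+ 2].
Proof.
have [c c0 H] := R_mx_sub_R_eps rhat_gt0 Ltest ZL2 Zmeas hCov hS hgamma hgammat hP.
have [[e c'] /= [e0 c'0 H']] := S_mx_error (ctp / ctm).
have /andP[cm0 cmp] := R_eps_bounds hP.
have s0 : 0 < Num.sqrt ctm by rewrite sqrtr_gt0.
pose b1 := c / Num.sqrt ctm; pose b2 := Num.sqrt ctm * c'.
have b10 : 0 <= b1 by rewrite divr_ge0// ltW.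
have b20 : 0 <= b2 by rewrite mulr_ge0// ltW.
exists (2 * b1 ^+ 2 + 2 * b2 ^+ 2), e; split => //.
  by rewrite addr_ge0// mulr_ge0// sqr_ge0.
move=> eps J K i he hJ K0; have /andP[ep0 _] := he.
have Rsym := tr_R_mx rhat hCov hS J.
have Esym := tr_R_eps hP he hJ.
have spE := R_eps_spectrum hP he hJ.
have sqR := psd_sqrt_exists Rsym (R_mx_psd rhat ZL2 Zmeas hCov hS (J := J)).
have sqE := psd_sqrt_exists Esym (fun x => Reps_psd x he hJ).
have ce0 : 0 <= c * eps by rewrite mulr_ge0// ltW.
have P1 := sqrt_perturbation s0 ce0 sqR sqE
  (fun x => sqrtmx_form_ge Esym spE x cm0) (fun x => H eps J x he hJ).
have P2 := H' _ _ _ _ K Esym cm0 cmp erefl spE K0.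
have s1 : (sqrtmx (Rmx J) - sqrtmx (Reps eps J))^T =
    sqrtmx (Rmx J) - sqrtmx (Reps eps J).
  by case: sqR => r1 _ _; case: sqE => r2 _ _; rewrite linearB /= r1 r2.
have s2 := tr_sqrtmx_sub_S_mx K Esym cm0 spE.
have Q1 := row_sqr_le i s1 (divr_ge0 ce0 (ltW s0)) P1.
have k0 : 0 <= Num.sqrt ctm * (c' * expR (- e * K%:R)).
  by rewrite !mulr_ge0 ?expR_ge0// ltW.
have Q2 := row_sqr_le i s2 k0 P2.
apply: (@le_trans _ _ (2 * (c * eps / Num.sqrt ctm) ^+ 2 +
   2 * (Num.sqrt ctm * (c' * expR (- e * K%:R))) ^+ 2)).
  apply: le_trans (lerD (ler_wpM2l _ Q1) (ler_wpM2l _ Q2)) => //.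
  rewrite !mulr_sumr -big_split; apply: ler_sum => j _ /=.
  have subE (X Y : 'M[R]_(psec j0 S J)) : (X - Y) i j = X i j - Y i j.
    by rewrite !mxE.
  rewrite /defect !subE.
  set x1 := sqrtmx (Rmx J) i j; set x2 := sqrtmx _ i j; set x3 := S_mx _ _ _ _ i j.
  (* Passing through the square root of R^eps: (u + v)^2 <= 2 u^2 + 2 v^2, with a consistency part u
     and a quadrature part v. *)
  by have := sqr_ge0 (x1 - x2 - (x2 - x3)); nra.
set E := expR _; have E0 : 0 <= E := expR_ge0 _.
rewrite (_ : c * eps / Num.sqrt ctm = b1 * eps); last by rewrite /b1 mulrAC.
rewrite (_ : Num.sqrt ctm * (c' * E) = b2 * E); last by rewrite /b2 mulrA.
have ep0' := ltW ep0.
have q1 : eps ^+ 2 <= (eps + E) ^+ 2 by rewrite lerXn2r ?nnegrE ?addr_ge0// lerDl.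
have q2 : E ^+ 2 <= (eps + E) ^+ 2 by rewrite lerXn2r ?nnegrE ?addr_ge0// lerDr.
have key (b y : R) : y ^+ 2 <= (eps + E) ^+ 2 ->
    2 * (b * y) ^+ 2 <= 2 * b ^+ 2 * (eps + E) ^+ 2.
  move=> yE; rewrite (_ : 2 * (b * y) ^+ 2 = 2 * b ^+ 2 * y ^+ 2); last by ring.
  by rewrite ler_wpM2l// mulr_ge0// sqr_ge0.
by rewrite [leRHS]mulrDl; apply: lerD; apply: key.
Qed.

Variable xi : forall J : nat, Omega -> 'cV[R]_(psec j0 S J).
Hypothesis hxi : forall J, (j0 <= J)%N -> std_normal P (xi J).
Hypothesis hcoupling : forall J, (j0 <= J)%N ->
     {ae P, forall w,
        \col_i ip vol (Z w) (psi S (lam j0 S J i).1 (lam j0 S J i).2) =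
        Dmx j0 S J (- rhat) *m sqrtmx (Rmx J) *m xi J w}.

Lemma std_normal_second_moment J (g : 'I_(psec j0 S J) -> R) : (j0 <= J)%N ->
  measurable_fun setT (fun w => \sum_i g i * xi J w i 0) /\
  (\int[P]_w ((\sum_i g i * xi J w i 0) ^+ 2)%:E <= (\sum_i g i ^+ 2)%:E)%E.
Proof.
move=> hJ; have := hxi hJ (\col_i g i).
have -> : (fun w => \sum_i (\col_i g i) i 0 * xi J w i 0) =
          (fun w => \sum_i g i * xi J w i 0).
  by apply/funext => w; apply: eq_bigr => i _; rewrite mxE.
have -> : \sum_i (\col_i g i) i 0 ^+ 2 = \sum_i g i ^+ 2.
  by apply: eq_bigr => i _; rewrite mxE.
by move=> gn; split; [case: gn|exact: second_moment_le].
Qed.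

Let approx eps J K w := Dmx j0 S J (- rhat) *m S_mx (Reps eps J) ctm ctp K *m xi J w.

Lemma approx_measurable eps J K i : (j0 <= J)%N ->
  measurable_fun setT (fun w => approx eps J K w i 0).
Proof.
move=> hJ; pose G := Dmx j0 S J (- rhat) *m S_mx (Reps eps J) ctm ctp K.
have [mG _] := std_normal_second_moment (G i) hJ.
rewrite (_ : (fun w => _) = (fun w => \sum_j G i j * xi J w j 0))//.
by apply/funext => w; rewrite mxE.
Qed.

(** By the coupling this component is almost surely a linear form in xi, with coefficients the row i
    of [defect] scaled by 2^(- rhat |l|), where l is the index of the component. *)
Lemma component_error eps J K i : (j0 <= J)%N ->
  (\int[P]_w ((ip vol (Z w) (psi S (lam j0 S J i).1 (lam j0 S J i).2) -
     approx eps J K w i 0) ^+ 2)%:E <=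
   (2 `^ (- 2 * rhat * (lam j0 S J i).1%:R) * \sum_j defect eps J K i j ^+ 2)%:E)%E.
Proof.
move=> hJ; pose s := 2 `^ (- rhat * (lam j0 S J i).1%:R).
have [mg Eg] := std_normal_second_moment (fun j => s * defect eps J K i j) hJ.
have -> : 2 `^ (- 2 * rhat * (lam j0 S J i).1%:R) *
    (\sum_j defect eps J K i j ^+ 2) = \sum_j (s * defect eps J K i j) ^+ 2.
  rewrite mulr_sumr; apply: eq_bigr => j _; rewrite exprMn; congr (_ * _).
  rewrite expr2 -powRD ?pnatr_eq0 ?implybT//; congr (_ `^ _); ring.
apply: le_trans Eg; rewrite le_eqVlt; apply/orP; left; apply/eqP.
have Lp := L2_psi_lam hS (J := J) i.
apply: ge0_ae_eq_integral => //.
- apply/measurable_EFinP/measurable_funX/measurable_funB; first exact: Zmeas.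
  exact: approx_measurable.
- exact/measurable_EFinP/measurable_funX.
- by move=> w _; rewrite lee_fin sqr_ge0.
- by move=> w _; rewrite lee_fin sqr_ge0.
apply: filterS (hcoupling hJ) => w E _; congr (_ ^+ 2)%:E.
have /matrixP/(_ i 0) := E; rewrite [LHS]mxE => ->.
rewrite /approx -!mulmxA !Dmx_cV -mulrBr -/s.
rewrite -[X in _ * X](_ : (defect eps J K *m xi J w) i 0 = _); last first.
  by rewrite mulmxBl mxE [X in _ + X]mxE.
rewrite mxE mulr_sumr; apply: eq_bigr => j _.
by rewrite mulrA.
Qed.

Hypothesis hrhat : n%:R / 2 < rhat.

Lemma mean_square_error : exists c e, [/\ 0 <= c, 0 < e &
  forall (J K : nat) (eps : R), (j0 <= J)%N -> (0 < K)%N -> 0 < eps < eps0 ->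
  (\int[P]_w (\esum_(l in calJ j0 S)
     ((ip vol (Z w) (psi S l.1 l.2) - extend (approx eps J K w) l) ^+ 2)%:E)
   <= (c * ((2 `^ (n%:R - 2 * rhat)) ^+ J + (eps + expR (- e * K%:R)) ^+ 2))%:E)%E].
Proof.
have [c1 [e [c10 e0 H1]]] := defect_row_le.
have [c2 c20 H2] := section_sum_le hS hrhat.
have [c3 c30 H3] := level_sum_le hS hrhat.
have [c4 c40 H4] := cov_psi_le rhat_gt0 Ltest ZL2 Zmeas hCov hS hgamma hgammat eps0_gt0 hP.
exists (c1 * c2 + c4 * c3), e; split => //; first by rewrite addr_ge0 ?mulr_ge0.
move=> J K eps hJ K0 he.
pose F (l : nat * I) w := ip vol (Z w) (psi S l.1 l.2) - extend (approx eps J K w) l.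
(* Nothing is assumed of the wavelets with index outside [calJ]; setting the function to 0 there
   makes it measurable for every l. *)
pose f l w := if `[< calJ j0 S l >] then (F l w ^+ 2)%:E else 0%E.
have mF l : calJ j0 S l -> measurable_fun setT (F l).
  move=> Jl; apply: measurable_funB; first by apply: Zmeas; case: (psi_L2 hS Jl).
  have [lJ|Jl'] := leqP l.1 J.
    have [|i <-] := @lam_surj _ _ _ _ _ j0 S J l.
      by rewrite in_Lambda lJ; case: Jl => -> ->.
    under eq_fun do rewrite extend_lam.
    exact: approx_measurable.
  by under eq_fun do rewrite (extend_out _ Jl'); exact: measurable_cst.
have mf l : measurable_fun setT (f l).
  rewrite /f; case: asboolP => // /mF m; exact/measurable_EFinP/measurable_funX.
have f0 l w : (0 <= f l w)%E by rewrite /f; case: asboolP; rewrite // lee_fin sqr_ge0.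
rewrite (_ : (fun w => \esum_(l in calJ j0 S) _) =
    (fun w => \esum_(l in calJ j0 S) f l w)); last first.
  by apply/funext => w; apply: eq_esum => l Jl; rewrite /f asboolT.
rewrite (expectation_esum j0 S P mf f0) (esum_calJ_split j0 S J); last first.
  by move=> l; exact: integral_ge0.
set E := eps + _; set th := 2 `^ _.
have fin : (\sum_i (\int[P]_w f (lam j0 S J i) w) <= (c1 * c2 * E ^+ 2)%:E)%E.
  apply: (@le_trans _ _ (\sum_i
      (2 `^ (- 2 * rhat * (lam j0 S J i).1%:R) * (c1 * E ^+ 2))%:E)%E).
    apply: lee_sum => i _.
    rewrite /f asboolT; last exact: lam_calJ.
    under eq_integral do rewrite /F extend_lam.
    apply: (le_trans (component_error _ _ _ hJ)).
    by rewrite lee_fin ler_wpM2l ?powR_ge0// H1.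
  rewrite sumEFin lee_fin -mulr_suml mulrC mulrAC.
  by rewrite ler_wpM2r ?sqr_ge0// ler_wpM2l.
have tail : (\esum_(l in calJ j0 S `&` [set l | (J < l.1)%N]) (\int[P]_w f l w) <=
    (c4 * c3 * th ^+ J)%:E)%E.
  (* The tail starts at the level J + 1; the extra power of [th] is given away. On these levels the
     approximation vanishes, so the error is the coordinate of Z itself. *)
  apply: (@le_trans _ _ (c4 * c3 * th ^+ J.+1)%:E); last first.
    have /andP[t0 /ltW t1] := decay_rate_lt1 hrhat.
    by rewrite lee_fin ler_wpM2l ?mulr_ge0// exprS ler_piMl// exprn_ge0// ltW.
  apply: le_trans (H3 J.+1 c4 c40); apply: le_esum => l [Jl /= lJ].
  rewrite /f asboolT// /F; under eq_integral do rewrite (extend_out _ lJ) subr0.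
  rewrite (cov_second_moment hCov); last by case: (psi_L2 hS Jl).
  by rewrite lee_fin; exact: H4.
apply: (le_trans (leeD fin tail)); rewrite -EFinD lee_fin mulrDr.
have t0 : 0 <= th ^+ J by rewrite exprn_ge0// powR_ge0.
have u1 : 0 <= c1 * c2 by rewrite mulr_ge0.
have u2 : 0 <= c4 * c3 by rewrite mulr_ge0.
have := mulr_ge0 u1 t0; have := mulr_ge0 u2 (sqr_ge0 E); lra.
Qed.

End Sampling.

Unset Implicit Arguments.
Set Strict Implicit.
Set Printing Implicit Defensive.

Theorem theorem4p1
  (* the manifold, its volume measure and the spectral resolution of its
     Laplace-Beltrami operator *)
  (R : realType) (n D : nat) (hn : (0 < n)%N) (hD : (n < D)%N)
  (M : closed_manifold R n D)
  (vol : {measure set (borel M) -> \bar R}) (hvol : riemannian_volume vol)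
  (B : laplace_basis vol)
  (* the operators A and C = A^{-2} *)
  (rhat : R) (hrhat : n%:R / 2 < rhat)
  (A : operator M) (hA : OPS vol rhat A) (hAsym : self_adjoint vol A)
  (hApos : coercive B A rhat)
  (C : dist M -> dist M) (hC : inverse_square B A rhat C)
  (* the Gaussian random field *)
  (dsp : measure_display) (Omega : measurableType dsp) (P : probability Omega R)
  (W : (M -> R) -> Omega -> R) (hW : white_noise vol P W)
  (Z : Omega -> M -> R) (hZ : solves vol P A Z W)
  (hCov : covariance_operator B P Z C)
  (* the biorthogonal multiresolution analyses *)
  (I : choiceType) (j0 : nat) (S : @mra_data R n D M I) (d dt : nat)
  (hS : biorthogonal_mra B j0 S d dt)
  (hgamma : (0 < regularity B j0 (V vol S))%E)
  (hgammat : (rhat%:E < regularity B j0 (Vt vol S))%E)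
  (* the tapered covariance matrices *)
  (eps0 d' : R) (a a' : R -> R) (ctm ctp : R) (heps0 : 0 < eps0)
  (hP : compression_properties B j0 S C rhat d' dt a a' d eps0 ctm ctp)
  (* the standard normal vectors, coupled to the coordinates of Z *)
  (xi : forall J : nat, Omega -> 'cV[R]_(psec j0 S J))
  (hxi : forall J, (j0 <= J)%N -> std_normal P (xi J))
  (hcoupling : forall J, (j0 <= J)%N ->
     {ae P, forall w,
        \col_i ip vol (Z w) (psi S (lam j0 S J i).1 (lam j0 S J i).2) =
        Dmx j0 S J (- rhat) *m sqrtmx (R_mx B j0 S C rhat J) *m xi J w}) :
  let Reps := R_eps B j0 S C rhat d' dt a a' in
  (exists c K0 : R -> R, (forall kappa, 0 < c kappa /\ 0 < K0 kappa) /\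
     forall cm cp eps : R, 0 < cm -> cm <= cp -> 0 < eps < eps0 ->
       (forall J, (j0 <= J)%N -> spectrum_in (Reps eps J) cm cp) ->
       forall J K : nat, (j0 <= J)%N -> (0 < K)%N ->
         opnorm (sqrtmx (Reps eps J) - S_mx (Reps eps J) cm cp K) <=
           K0 (cp / cm) * expR (- c (cp / cm) * K%:R))
  /\
  (exists K0 c : R, 0 < K0 /\ 0 < c /\
     forall (J K : nat) (eps s : R), (j0 <= J)%N -> (0 < K)%N ->
       0 < eps < eps0 -> 0 <= s < rhat - n%:R / 2 ->
       ((\int[P]_w \esum_(l in calJ j0 S)
           ((ip vol (Z w) (psi S l.1 l.2) -
             extend (Dmx j0 S J (- rhat) *m S_mx (Reps eps J) ctm ctp K *m xi J w)
                    l) ^+ 2)%:E) `^ 2^-1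
        <= (K0 * (2 `^ (- (s * J%:R)) + eps + expR (- c * K%:R)))%:E)%E).
Proof.
move=> Reps.
have [ZL2 Zmeas _] := hZ.
have Ltest := L2_test hvol.
have rhat_gt0 : 0 < rhat by rewrite (le_lt_trans _ hrhat)// divr_ge0.
split.
  (* The spectra lie below [ctp] for all admissible eps and J, so [ctp] is a legitimate bound for
     every cm, and the constants become functions of the ratio alone. *)
  have [F HF] := choice (fun kap => opnorm_S_mx_error kap ctp).
  exists (fun kap => (F kap).1), (fun kap => (F kap).2).
  split=> [kap|cm cp eps cm0 cmp he sp J K hJ K0]; first by case: (HF kap).
  have [_ _ H] := HF (cp / cm).
  have Esym := tr_R_eps hP he hJ; have spE := R_eps_spectrum hP he hJ.
  exact: (H _ _ ctm cm cp K Esym spE cm0 cmp erefl (sp J hJ) K0).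
have [c [e [c0 e0 H]]] := mean_square_error rhat_gt0 Ltest ZL2 Zmeas hCov hS hgamma
  hgammat heps0 hP hxi hcoupling hrhat.
(* The summand 1 ensures positivity, as c may be 0. *)
exists (Num.sqrt c + 1), e; split; first by rewrite ltr_wpDl// sqrtr_ge0.
split=> // J K eps s hJ K0 he /andP[s0 sr].
set a0 := 2 `^ _; set E := expR _; set k := Num.sqrt c + 1.
have a0_ge0 : 0 <= a0 by exact: powR_ge0.
have E_ge0 : 0 <= E by exact: expR_ge0.
have eps_ge0 : 0 <= eps by move: he => /andP[/ltW].
have k_ge0 : 0 <= k by rewrite addr_ge0// sqrtr_ge0.
have t_ge0 : 0 <= k * (a0 + eps + E) by rewrite mulr_ge0// !addr_ge0.
have -> : (k * (a0 + eps + E))%:E = (((k * (a0 + eps + E)) ^+ 2)%:E `^ 2^-1)%E.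
  by rewrite poweR_EFin powR12_sqrt ?sqr_ge0// sqrtr_sqr ger0_norm.
(* Since 2 s < 2 rhat - n, the tail rate, which does not involve s, is dominated for all admissible
   s at once; this keeps the constant independent of s. *)
have th_le : 2 `^ (n%:R - 2 * rhat) ^+ J <= a0 ^+ 2.
  rewrite -powR_mulrn ?powR_ge0// -powRrM /a0 expr2 -powRD ?pnatr_eq0 ?implybT//.
  rewrite ler_powR ?ler1n//.
  have J0 : 0 <= J%:R :> R by [].
  nra.
apply: gt0_ler_poweR => //.
- rewrite in_itv/= leey andbT integral_ge0// => w _.
  by apply: esum_ge0 => l _; rewrite lee_fin sqr_ge0.
- by rewrite in_itv/= leey lee_fin sqr_ge0.
apply: (le_trans (H J K eps hJ K0 he)); rewrite lee_fin exprMn.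
have kc : c <= k ^+ 2.
  rewrite -[leLHS](sqr_sqrtr c0) lerXn2r ?nnegrE ?sqrtr_ge0//.
  by rewrite /k lerDl.
apply: ler_pM => //; first by rewrite addr_ge0 ?exprn_ge0 ?powR_ge0 ?addr_ge0.
rewrite -/E; have := mulr_ge0 a0_ge0 (addr_ge0 eps_ge0 E_ge0).
move: th_le; set t := _ ^+ J; nra.
Qed.
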